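(* Let $\ell\ge2$. (1) There is an embedding of Lie algebras of $\widehat{\mathfrak{gl}}_\ell'$ into $a_\infty$ (and from there into $\widetilde{\mathbf{Cl}}$, with $c$ sent to $1$), given by $c\mapsto c$ and, for the matrix units $X_{i,j}\in\mathfrak{gl}_\ell$ and $m\in\mathbb{Z}$, $$X_{i,j}\otimes t^m\mapsto\sum_{k\in\mathbb{Z}}\overline E_{i-\frac12+k\ell,\ j-\frac12+k\ell+m\ell}.$$ Thus $\mathbf{F}$ carries an action of $\widehat{\mathfrak{gl}}_\ell'$, which agrees on the subalgebra $\widehat{\mathfrak{sl}}_\ell'$ with the action of $\widehat{\mathfrak{sl}}_\ell'$ on $\mathbf{F}$. (2) The action can be extended to all of $\widehat{\mathfrak{gl}}_\ell$ by letting $d$ act on $|\lambda,h\rangle$ as multiplication by the number of $c_{\bar 0}$ colored boxes in $\lambda$. (3) Each $\mathbf{F}^{(h)}$, $h\in\mathbb{Z}$, is preserved by this action, and is irreducible as a representation of $\widehat{\mathfrak{gl}}_\ell$.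
   Context: All vector spaces and algebras are over $\mathbb{C}$. The Clifford algebra $\mathbf{Cl}$ is generated by $\psi_m,\psi_m^*$, $m\in\mathbb{Z}+\frac12$, with $\psi_n\psi_m+\psi_m\psi_n=0$, $\psi_n^*\psi_m^*+\psi_m^*\psi_n^*=0$, $\psi_n\psi_m^*+\psi_m^*\psi_n=\delta_{m,n}$. Fermionic Fock space $\mathbf{F}$ has basis the semi-infinite wedges $e_{m_1}\wedge e_{m_2}\wedge\cdots$ with $m_i\in\mathbb{Z}+\frac12$, $m_1>m_2>\cdots$, $m_{k+1}=m_k-1$ for all large $k$; wedges are anti-commutative. $\mathbf{Cl}$ acts by $\psi_m v=e_m\wedge v$, and $\psi_m^*v=0$ if $e_m$ is not a factor of the wedge $v$, $\psi_m^*v=v'$ if $v=e_m\wedge v'$. A charged partition is a pair $(\lambda,h)$ of a partition and an integer $h$ (the charge). The same basis of $\mathbf{F}$ is indexed by charged partitions: $|\lambda,h\rangle$ is the wedge $e_{m_1}\wedge e_{m_2}\wedge\cdots$ with $m_i=\lambda_i+h-i+\frac12$ (with $\lambda_i=0$ for $i$ larger than the number of parts). $\mathbf{F}^{(h)}$ is the span of all $|\lambda,h\rangle$ with charge $h$. The box of $\lambda$ in row $r$ and column $s$ is colored $c_{\bar j}$ where $\bar j$ is the residue of $h+s-r$ modulo $\ell$. $\widetilde{\mathbf{Cl}}$ is the completion of $\mathbf{Cl}$ whose elements are infinite sums $z+\sum_{m<N}X_m\psi_m+\sum_{m>M}Y_m\psi_m^*$ with $z\in\mathbb{C}$, $N,M\in\mathbb{Z}$,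 $X_m,Y_m\in\mathbf{Cl}$; that is, $\varprojlim_N\mathbf{Cl}/J_N$ with $J_N$ the left ideal generated by all $\psi_m^*,\psi_{-m}$ with $m>N$. It is an algebra and acts on $\mathbf{F}$, extending the action of $\mathbf{Cl}$. $a_\infty$ is, as a vector space, $\{\overline A\}\oplus\mathbb{C}c$, where $A=(a_{i,j})_{i,j\in\mathbb{Z}+\frac12}$ runs over the matrices such that for some $k$, $a_{i,j}=0$ whenever $|i-j|>k$; $c$ is central and $$[\overline A,\overline B]=\overline{AB-BA}+\Big(\sum_{m<0<n}a_{m,n}b_{n,m}-\sum_{n<0<m}a_{m,n}b_{n,m}\Big)c.$$ $E_{m,n}$ is the matrix with a single $1$ in position $(m,n)$, and $\overline E_{m,n}$ the corresponding element of $a_\infty$. $a_\infty$ embeds in $\widetilde{\mathbf{Cl}}$ (as a Lie-associative map, i.e. a linear map taking brackets to commutators) by $\overline E_{m,n}\mapsto\psi_m\psi_n^*$ if $m\ne n$ or $m>0$, $\overline E_{n,n}\mapsto-\psi_n^*\psi_n$ if $n<0$, $c\mapsto1$, extended to infinite sums; this makes $\mathbf{F}$ a representation of $a_\infty$. $\widehat{\mathfrak{gl}}_\ell=(\mathfrak{gl}_\ell\otimes\mathbb{C}[t,t^{-1}])\oplus\mathbb{C}c\oplus\mathbb{C}d$, with $c$ central, $[X\otimes t^n,Y\otimes t^m]=(XY-YX)\otimes t^{m+n}+n\,\delta_{n,-m}\operatorname{tr}(XY)\,c$, and $[d,X\otimes t^n]=n\,X\otimes t^n$. $\widehat{\mathfrak{gl}}_\ell'=(\mathfrak{gl}_\ell\otimes\mathbb{C}[t,t^{-1}])\oplus\mathbb{C}c$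 and $\widehat{\mathfrak{sl}}_\ell'=(\mathfrak{sl}_\ell\otimes\mathbb{C}[t,t^{-1}])\oplus\mathbb{C}c$ are Lie subalgebras. The action of $\widehat{\mathfrak{sl}}_\ell'$ on $\mathbf{F}$ is the one with $c$ acting as $1$ and given by the linear extension of $X_{i,j}\otimes t^m\mapsto\sum_{k\in\mathbb{Z}}\overline E_{i-\frac12+k\ell,\ j-\frac12+k\ell+m\ell}$ (restricted to trace-zero matrices), composed with the action of $a_\infty$ on $\mathbf{F}$.
   Formalization: In (2), d acts on |λ,h⟩ as minus the number of c_0 colored boxes in λ: with the stated conventions X⊗t^n lowers that number by n, so multiplication by the number itself would violate [d, X⊗t^n] = n X⊗t^n. *)

(* Defs.v *)
From HB Require Import structures.
From mathcomp Require Import all_boot all_order all_algebra.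
From mathcomp Require Import finmap.
From mathcomp Require Import monalg.
From mathcomp Require Import boolp classical_sets functions cardinality fsbigop.
From mathcomp Require Import generic_quotient zify.
From mathcomp Require Export reals complex.

Set Implicit Arguments.
Unset Strict Implicit.
Unset Printing Implicit Defensive.

Import Order.TTheory GRing.Theory Num.Theory.
Local Open Scope ring_scope.


(* Elements of Z + 1/2 are encoded by integers throughout: m : int stands for
   the half-integer m + 1/2.  Thus "positive" reads [0 <= m], "negative" reads
   [m < 0], and -(m + 1/2) is encoded by -m - 1. *)

(* s stands for the wedge e_{s 0} /\ e_{s 1} /\ ... *)
Definition is_wedge (s : nat -> int) : bool :=
  `[< (forall k, s k.+1 < s k) /\
      (exists n, forall k, (n <= k)%N -> s k.+1 = s k - 1) >].

Record wedge := Wedge { wedge_seq :> nat -> int; _ : is_wedge wedge_seq }.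
HB.instance Definition _ := [isSub for wedge_seq].
HB.instance Definition _ := [Choice of wedge by <:].

Lemma wedge_lt (w : wedge) k : w k.+1 < w k.
Proof. by case: w => s /= /asboolP[]. Qed.

Lemma wedge_tail (w : wedge) : exists n, forall k, (n <= k)%N -> w k.+1 = w k - 1.
Proof. by case: w => s /= /asboolP[]. Qed.

Lemma wedge_ltn (w : wedge) i j : (i < j)%N -> w j < w i.
Proof.
elim: j => // j IH; rewrite ltnS leq_eqVlt => /orP[/eqP->|/IH h].
  exact: wedge_lt.
exact: lt_trans (wedge_lt w j) h.
Qed.

Lemma wedge_le (w : wedge) i j : (i <= j)%N -> w j <= w i.
Proof. by rewrite leq_eqVlt => /orP[/eqP->//|/(wedge_ltn w)/ltW]. Qed.

Lemma wedge_unbounded (w : wedge) (m : int) : exists k, w k <= m.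
Proof.
have h k : w k <= w 0%N - k%:Z.
  by elim: k => [|k IH]; [lia | have := wedge_lt w k; lia].
by exists `|w 0%N - m|%N; have := h `|w 0%N - m|%N; lia.
Qed.

(* The number of factors e_n of w with n > m (see lt_wedge_pos). *)
Definition wedge_pos (w : wedge) (m : int) : nat :=
  ex_minn (wedge_unbounded w m).

Lemma lt_wedge_pos w m k : (k < wedge_pos w m)%N = (m < w k).
Proof.
rewrite /wedge_pos; case: ex_minnP => p hp hmin.
case: (ltnP k p) => hkp.
  by apply/esym; rewrite ltNge; apply/negP => /hmin; lia.
by apply/esym/negbTE; rewrite -leNgt; apply: le_trans hp; exact: wedge_le.
Qed.

Implicit Types (w : wedge) (m n : int).

Lemma wedge_posE w m p : (forall k, (k < p)%N = (m < w k)) -> wedge_pos w m = p.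
Proof.
move=> h; case: (ltngtP (wedge_pos w m) p) => //.
  by rewrite h -lt_wedge_pos ltnn.
by rewrite lt_wedge_pos -h ltnn.
Qed.

Lemma wedge_pos_leq w m k : w k <= m -> (wedge_pos w m <= k)%N.
Proof. by rewrite leNgt -lt_wedge_pos -leqNgt. Qed.

Lemma wedge_pos_at w m : w (wedge_pos w m) <= m.
Proof. by rewrite leNgt -lt_wedge_pos ltnn. Qed.

Lemma wedge_pos_anti w m n : n <= m -> (wedge_pos w m <= wedge_pos w n)%N.
Proof. by move=> h; apply/wedge_pos_leq/(le_trans (wedge_pos_at w n)). Qed.

Definition wedge_mem (w : wedge) (m : int) : bool := w (wedge_pos w m) == m.

Lemma wedge_memP w m : reflect (exists k, w k = m) (wedge_mem w m).
Proof.
apply: (iffP eqP) => [h|[k hk]]; first by exists (wedge_pos w m).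
suff -> : wedge_pos w m = k by [].
apply: wedge_posE => j; rewrite -hk; case: (ltngtP j k) => [/(wedge_ltn w)->//|h|->].
  by apply/esym/negbTE; rewrite -leNgt; apply/ltW/wedge_ltn.
by rewrite ltxx.
Qed.

Lemma wedge_pos_pred w m : wedge_pos w (m - 1) = (wedge_pos w m + wedge_mem w m)%N.
Proof.
apply: wedge_posE => k; rewrite /wedge_mem.
have h1 := lt_wedge_pos w m k.
have h2 := lt_wedge_pos w m (wedge_pos w m); rewrite ltnn in h2.
have h3 : (k = wedge_pos w m) \/ (k < wedge_pos w m)%N \/ (wedge_pos w m < k)%N by lia.
case: eqP => hm /=.
  case: h3 => [->|[h|h]]; rewrite ?hm; [lia|lia|].
  by have := wedge_ltn w h; lia.
case: h3 => [->|[h|h]]; [lia|lia|].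
by have := wedge_ltn w h; lia.
Qed.

Lemma wedge_pos_inj w w' : (forall m, wedge_pos w m = wedge_pos w' m) -> w = w'.
Proof.
move=> h; apply/val_inj/funext => k /=.
have e m : (m < w k) = (m < w' k) by rewrite -!lt_wedge_pos h.
by have := e (w k); have := e (w' k); lia.
Qed.

(* e_m /\ w, sorted, when e_m is not a factor of w; the sign is dealt with in
   [psi_basis]. *)
Definition wedge_ins_seq (w : wedge) (m : int) (k : nat) : int :=
  if (k < wedge_pos w m)%N then w k
  else if k == wedge_pos w m then m else w k.-1.

Definition wedge_del_seq (w : wedge) (m : int) (k : nat) : int :=
  if (k < wedge_pos w m)%N then w k else w k.+1.

Lemma wedge_ins_subproof w m : ~~ wedge_mem w m -> is_wedge (wedge_ins_seq w m).
Proof.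
move=> hm; apply/asboolP; split => [k|]; last first.
  have [n hn] := wedge_tail w; exists (n + wedge_pos w m).+1 => k hk.
  rewrite /wedge_ins_seq !ifF; [|lia..].
  by case: k hk => // k hk; rewrite /= hn //; lia.
have /eqP hp := hm; have h2 := wedge_pos_at w m; rewrite /wedge_ins_seq.
have h1 := lt_wedge_pos w m k; set p := wedge_pos w m in hp h1 h2 *.
have [h|[h|[h|h]]] : (k.+1 < p \/ k.+1 = p \/ k = p \/ p < k)%N by lia.
- by rewrite h ifT ?wedge_lt //; lia.
- by rewrite -h ltnn eqxx ltnSn; lia.
- by rewrite h ltnn eqxx !ifF /=; lia.
- by rewrite !ifF /=; [apply: wedge_ltn; lia | lia..].
Qed.

Lemma wedge_del_subproof w m : is_wedge (wedge_del_seq w m).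
Proof.
apply/asboolP; split => [k|]; last first.
  have [n hn] := wedge_tail w; exists (n + wedge_pos w m)%N => k hk.
  by rewrite /wedge_del_seq !ifF ?hn //; lia.
by rewrite /wedge_del_seq; case: ifP => h; case: ifP => h'; apply: wedge_ltn; lia.
Qed.

(* insubd falls back on w when e_m is already a factor of w. *)
Definition wedge_ins (w : wedge) (m : int) : wedge := insubd w (wedge_ins_seq w m).
Definition wedge_del (w : wedge) (m : int) : wedge :=
  Wedge (wedge_del_subproof w m).

Lemma wedge_insE w m k : ~~ wedge_mem w m -> wedge_ins w m k = wedge_ins_seq w m k.
Proof.
move=> h; rewrite /wedge_ins -[wedge_seq _]/(val _) val_insubd.
by rewrite wedge_ins_subproof.
Qed.

Lemma wedge_pos_ins w m n : ~~ wedge_mem w m ->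
  wedge_pos (wedge_ins w m) n = (wedge_pos w n + (n < m)%R)%N.
Proof.
move=> hm; apply: wedge_posE => k; rewrite wedge_insE // /wedge_ins_seq.
case: (ltnP k (wedge_pos w m)) => h1; last case: eqP => [->|h2].
- rewrite -lt_wedge_pos; case: (ltrP n m) => h; last by rewrite addn0.
  by have := wedge_pos_anti w (ltW h); lia.
- case: (ltrP n m) => h; first by have := wedge_pos_anti w (ltW h); lia.
  by have := wedge_pos_anti w h; lia.
- case: k h1 h2 => [|k] h1 h2; first lia.
  rewrite /= -lt_wedge_pos; case: (ltrP n m) => h; first by rewrite addn1.
  by have := wedge_pos_anti w h; lia.
Qed.

Lemma wedge_pos_del w m n : wedge_mem w m ->
  wedge_pos w n = (wedge_pos (wedge_del w m) n + (n < m)%R)%N.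
Proof.
move=> /eqP hm.
have p1 : n < m -> (wedge_pos w m < wedge_pos w n)%N.
  by move=> h; rewrite lt_wedge_pos hm.
suff -> : wedge_pos (wedge_del w m) n = (wedge_pos w n - (n < m)%R)%N by lia.
apply: wedge_posE => k; rewrite /= /wedge_del_seq.
case: (ltnP k (wedge_pos w m)) => h1; rewrite -lt_wedge_pos.
- case: (ltrP n m) => h; last by rewrite subn0.
  by have := p1 h; lia.
- case: (ltrP n m) => h; first by have := p1 h; lia.
  by have := wedge_pos_anti w h; lia.
Qed.

Lemma wedge_mem_ins w m n : ~~ wedge_mem w m ->
  wedge_mem (wedge_ins w m) n = wedge_mem w n || (n == m).
Proof.
move=> h; have := wedge_pos_pred (wedge_ins w m) n.
by rewrite !wedge_pos_ins // wedge_pos_pred; case: (wedge_mem w n); case: wedge_mem; lia.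
Qed.

Lemma wedge_mem_del w m n : wedge_mem w m ->
  wedge_mem (wedge_del w m) n = wedge_mem w n && (n != m).
Proof.
move=> h; have := wedge_pos_pred w n.
rewrite !(wedge_pos_del _ h) wedge_pos_pred.
move: h; case: (eqVneq n m) => [->|hn] h; rewrite ?h.
  by case: wedge_mem; lia.
by case: (wedge_mem w n); case: wedge_mem; lia.
Qed.

Section Fock.
Variable K : fieldType.

Definition fock := {malg K[wedge]}.
HB.instance Definition _ := GRing.Lmodule.on fock.

Definition wvec (w : wedge) : fock := << w >>.

Definition linext (f : wedge -> fock) (v : fock) : fock :=
  \sum_(w <- msupp v) v@_w *: f w.

Lemma linextEw f (v : fock) (D : {fset wedge}) : (msupp v `<=` D)%fset ->
  linext f v = \sum_(w <- D) v@_w *: f w.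
Proof.
move=> le; rewrite /linext (big_fset_incl _ le) // => w _.
by rewrite -mcoeff_eq0 => /eqP->; rewrite scale0r.
Qed.

Lemma linext_is_linear f : linear (linext f).
Proof.
move=> a u v; pose D := (msupp u `|` msupp v `|` msupp (a *: u + v))%fset.
rewrite !(@linextEw f _ D) ?fsubsetUr //.
- rewrite scaler_sumr -big_split /=; apply: eq_bigr => w _.
  by rewrite mcoeffD mcoeffZ scalerDl scalerA.
- by rewrite /D -fsetUA fsetUC -fsetUA fsubsetUl.
- by rewrite /D -fsetUA fsubsetUl.
Qed.

HB.instance Definition _ f :=
  GRing.isLinear.Build K fock fock _ (linext f) (linext_is_linear f).

Lemma linext_wvec f w : linext f (wvec w) = f w.
Proof.
rewrite (@linextEw f (wvec w) [fset w]%fset) ?msuppU_le //.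
by rewrite big_seq_fset1 mcoeffUU scale1r.
Qed.

Lemma wvec_neq0 w : wvec w != 0.
Proof. by rewrite monalgU_eq0 oner_eq0. Qed.

Lemma fock_ind (P : fock -> Prop) : P 0 -> (forall a w u, P u -> P (a *: wvec w + u)) ->
  forall v, P v.
Proof.
move=> P0 PD v; rewrite [v]monalgE; elim/big_rec: _ => // w u _ /PD.
move=> /(_ v@_w w); suff -> : v@_w *: wvec w = << v@_w *g w >> by [].
by apply/malgP => k; rewrite mcoeffZ !mcoeffU mulrnAr mulr1.
Qed.

Lemma fock_linear_ext (f g : fock -> fock) : linear f -> linear g ->
  (forall w, f (wvec w) = g (wvec w)) -> forall v, f v = g v.
Proof.
move=> lf lg h.
have z (k : fock -> fock) : linear k -> k 0 = 0.
  by move=> lk; have := lk (-1) 0 0; rewrite scaler0 addr0 scaleN1r addNr.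
elim/fock_ind => [|a w u IH]; first by rewrite !z.
by rewrite lf lg IH h.
Qed.

(* The signs are those produced by moving e_m to (resp. from) its place in the
   decreasing wedge. *)
Definition psi_basis (m : int) (w : wedge) : fock :=
  if wedge_mem w m then 0 else (-1) ^+ wedge_pos w m *: wvec (wedge_ins w m).

Definition psis_basis (m : int) (w : wedge) : fock :=
  if wedge_mem w m then (-1) ^+ wedge_pos w m *: wvec (wedge_del w m) else 0.

Definition psi_op (m : int) : fock -> fock := linext (psi_basis m).
Definition psis_op (m : int) : fock -> fock := linext (psis_basis m).
HB.instance Definition _ m := GRing.Linear.copy (psi_op m) (linext (psi_basis m)).
HB.instance Definition _ m := GRing.Linear.copy (psis_op m) (linext (psis_basis m)).

Lemma psi_opE m w : psi_op m (wvec w) = psi_basis m w.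
Proof. exact: linext_wvec. Qed.

Lemma psis_opE m w : psis_op m (wvec w) = psis_basis m w.
Proof. exact: linext_wvec. Qed.

Lemma psi_opP m a u v : psi_op m (a *: u + v) = a *: psi_op m u + psi_op m v.
Proof. exact: linearP. Qed.

Lemma psis_opP m a u v : psis_op m (a *: u + v) = a *: psis_op m u + psis_op m v.
Proof. exact: linearP. Qed.

Lemma signr_cancel a b (x : fock) : odd a != odd b ->
  (-1) ^+ a *: x + (-1) ^+ b *: x = 0.
Proof.
rewrite -scalerDl -(signr_odd _ a) -(signr_odd _ b).
by case: (odd a); case: (odd b) => //= _; rewrite expr0 expr1 ?addNr ?subrr scale0r.
Qed.

Lemma psi_op_anti m n v : psi_op n (psi_op m v) + psi_op m (psi_op n v) = 0.
Proof.
pose f v := psi_op n (psi_op m v) + psi_op m (psi_op n v).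
apply: (@fock_linear_ext f (fun=> 0)) => [a x y|a x y|w]; rewrite /f.
- by rewrite !psi_opP addrACA scalerDr.
- by rewrite scaler0 addr0.
rewrite !(psi_opE, psis_opE) /psi_basis.
case: (boolP (wedge_mem w m)) => hm; case: (boolP (wedge_mem w n)) => hn;
  rewrite ?linear0 ?addr0 ?add0r // ?linearZ /= ?(psi_opE, psis_opE) /psi_basis.
- by rewrite wedge_mem_ins // hm scaler0.
- by rewrite wedge_mem_ins // hn scaler0.
rewrite !wedge_mem_ins // (negbTE hm) (negbTE hn) /= eq_sym.
case: eqP => [_|hmn]; first by rewrite !scaler0 addr0.
have h1 : ~~ wedge_mem (wedge_ins w m) n.
  by rewrite wedge_mem_ins // negb_or hn; apply/eqP => /esym.
have h2 : ~~ wedge_mem (wedge_ins w n) m.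
  by rewrite wedge_mem_ins // negb_or hm; apply/eqP.
have -> : wedge_ins (wedge_ins w n) m = wedge_ins (wedge_ins w m) n.
  by apply: wedge_pos_inj => k; rewrite !wedge_pos_ins // addnAC.
rewrite !scalerA -!exprD !wedge_pos_ins //; apply: signr_cancel.
by rewrite !oddD; case: (ltgtP m n) => // _; do 2 case: odd.
Qed.

Lemma psis_op_anti m n v : psis_op n (psis_op m v) + psis_op m (psis_op n v) = 0.
Proof.
pose f v := psis_op n (psis_op m v) + psis_op m (psis_op n v).
apply: (@fock_linear_ext f (fun=> 0)) => [a x y|a x y|w]; rewrite /f.
- by rewrite !psis_opP addrACA scalerDr.
- by rewrite scaler0 addr0.
rewrite !(psi_opE, psis_opE) /psis_basis.
case: (boolP (wedge_mem w m)) => hm; case: (boolP (wedge_mem w n)) => hn;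
  rewrite ?linear0 ?addr0 ?add0r // ?linearZ /= ?(psi_opE, psis_opE) /psis_basis; last first.
- by rewrite wedge_mem_del // (negbTE hm) scaler0.
- by rewrite wedge_mem_del // (negbTE hn) scaler0.
rewrite !wedge_mem_del // hm hn /= eq_sym.
case: eqP => [_|hmn]; first by rewrite !scaler0 addr0.
have h1 : wedge_mem (wedge_del w m) n by rewrite wedge_mem_del // hn; apply/eqP => /esym.
have h2 : wedge_mem (wedge_del w n) m by rewrite wedge_mem_del // hm; apply/eqP.
have -> : wedge_del (wedge_del w n) m = wedge_del (wedge_del w m) n.
  apply: wedge_pos_inj => k.
  have := wedge_pos_del k hm; have := wedge_pos_del k hn.
  by have := wedge_pos_del k h1; have := wedge_pos_del k h2; lia.
rewrite !scalerA -!exprD; apply: signr_cancel.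
rewrite (wedge_pos_del n hm) (wedge_pos_del m hn).
by rewrite !oddD; case: (ltgtP m n) => //= _; do 2 case: odd.
Qed.

Lemma psi_psis_op_anti m n v :
  psi_op n (psis_op m v) + psis_op m (psi_op n v) = (n == m)%:R *: v.
Proof.
pose f v := psi_op n (psis_op m v) + psis_op m (psi_op n v).
apply: (@fock_linear_ext f ( *:%R (n == m)%:R)) => [a x y|a x y|w]; rewrite /f.
- by rewrite psis_opP psi_opP psi_opP psis_opP addrACA scalerDr.
- by rewrite scalerDr !scalerA mulrC.
rewrite !(psi_opE, psis_opE) /psi_basis /psis_basis.
case: (eqVneq n m) => [->|hnm].
  rewrite scale1r; case: (boolP (wedge_mem w m)) => hm; rewrite linear0 ?addr0 ?add0r.
    have h : ~~ wedge_mem (wedge_del w m) m by rewrite wedge_mem_del // eqxx andbF.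
    rewrite linearZ /= (psi_opE, psis_opE) /psi_basis (negbTE h) scalerA -exprD.
    have -> : wedge_ins (wedge_del w m) m = w.
      by apply: wedge_pos_inj => k; rewrite wedge_pos_ins // (wedge_pos_del k hm).
    by rewrite (wedge_pos_del m hm) ltxx addn0 -signr_odd oddD addbb scale1r.
  have h : wedge_mem (wedge_ins w m) m by rewrite wedge_mem_ins // eqxx orbT.
  rewrite linearZ /= (psi_opE, psis_opE) /psis_basis h scalerA -exprD.
  have -> : wedge_del (wedge_ins w m) m = w.
    apply: wedge_pos_inj => k; apply/eqP; rewrite -(eqn_add2r (k < m)%R).
    by rewrite -wedge_pos_del // wedge_pos_ins.
  by rewrite wedge_pos_ins // ltxx addn0 -signr_odd oddD addbb scale1r.
rewrite scale0r.
case: (boolP (wedge_mem w m)) => hm; case: (boolP (wedge_mem w n)) => hn;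
  rewrite ?linear0 ?addr0 ?add0r // ?linearZ /= ?(psi_opE, psis_opE) /psi_basis /psis_basis.
- by rewrite wedge_mem_del // hn hnm scaler0.
- have h1 : ~~ wedge_mem (wedge_del w m) n by rewrite wedge_mem_del // (negbTE hn).
  have h2 : wedge_mem (wedge_ins w n) m by rewrite wedge_mem_ins // hm.
  rewrite (negbTE h1) h2.
  have -> : wedge_del (wedge_ins w n) m = wedge_ins (wedge_del w m) n.
    apply: wedge_pos_inj => k; apply/eqP; rewrite -(eqn_add2r (k < m)%R).
    by rewrite -wedge_pos_del // !wedge_pos_ins // addnAC -wedge_pos_del.
  rewrite !scalerA -!exprD; apply: signr_cancel.
  rewrite wedge_pos_ins // (wedge_pos_del n hm) !oddD.
  by case: (ltgtP m n) hnm => //= _ _; do 2 case: odd.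
- by rewrite wedge_mem_ins // (negbTE hm) eq_sym (negbTE hnm) scaler0.
Qed.

End Fock.


Section Clifford.
Local Open Scope quotient_scope.
Variable K : fieldType.
Local Notation fock := (fock K).

(* The Clifford algebra, presented by generators and relations: expressions in
   the generators modulo the smallest congruence containing the K-algebra
   axioms and the Clifford relations. *)
Inductive cl_expr : Type :=
| ClConst of K
| ClPsi of int
| ClPsis of int
| ClAdd of cl_expr & cl_expr
| ClMul of cl_expr & cl_expr.

Inductive cl_rel : cl_expr -> cl_expr -> Prop :=
| cl_refl s : cl_rel s s
| cl_sym s t : cl_rel s t -> cl_rel t s
| cl_trans s t u : cl_rel s t -> cl_rel t u -> cl_rel s u
| cl_congD s s' t t' : cl_rel s s' -> cl_rel t t' ->
    cl_rel (ClAdd s t) (ClAdd s' t')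
| cl_congM s s' t t' : cl_rel s s' -> cl_rel t t' ->
    cl_rel (ClMul s t) (ClMul s' t')
| cl_addA s t u : cl_rel (ClAdd s (ClAdd t u)) (ClAdd (ClAdd s t) u)
| cl_addC s t : cl_rel (ClAdd s t) (ClAdd t s)
| cl_add0 s : cl_rel (ClAdd (ClConst 0) s) s
| cl_addN s : cl_rel (ClAdd (ClMul (ClConst (-1)) s) s) (ClConst 0)
| cl_mulA s t u : cl_rel (ClMul s (ClMul t u)) (ClMul (ClMul s t) u)
| cl_mul1l s : cl_rel (ClMul (ClConst 1) s) s
| cl_mul1r s : cl_rel (ClMul s (ClConst 1)) s
| cl_mulDl s t u : cl_rel (ClMul (ClAdd s t) u) (ClAdd (ClMul s u) (ClMul t u))
| cl_mulDr s t u : cl_rel (ClMul s (ClAdd t u)) (ClAdd (ClMul s t) (ClMul s u))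
| cl_constD a b : cl_rel (ClConst (a + b)) (ClAdd (ClConst a) (ClConst b))
| cl_constM a b : cl_rel (ClConst (a * b)) (ClMul (ClConst a) (ClConst b))
| cl_constC a s : cl_rel (ClMul (ClConst a) s) (ClMul s (ClConst a))
| cl_psi_psi n m :
    cl_rel (ClAdd (ClMul (ClPsi n) (ClPsi m)) (ClMul (ClPsi m) (ClPsi n)))
           (ClConst 0)
| cl_psis_psis n m :
    cl_rel (ClAdd (ClMul (ClPsis n) (ClPsis m)) (ClMul (ClPsis m) (ClPsis n)))
           (ClConst 0)
| cl_psi_psis n m :
    cl_rel (ClAdd (ClMul (ClPsi n) (ClPsis m)) (ClMul (ClPsis m) (ClPsi n)))
           (ClConst (n == m)%:R).

HB.instance Definition _ := gen_eqMixin cl_expr.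
HB.instance Definition _ := gen_choiceMixin cl_expr.

Definition cl_relb (s t : cl_expr) : bool := `[< cl_rel s t >].

Lemma cl_relb_refl : reflexive cl_relb.
Proof. by move=> s; apply/asboolP/cl_refl. Qed.
Lemma cl_relb_sym : symmetric cl_relb.
Proof. by move=> s t; apply/asboolP/asboolP; apply: cl_sym. Qed.
Lemma cl_relb_trans : transitive cl_relb.
Proof. by move=> s t u /asboolP h /asboolP h'; apply/asboolP/(cl_trans h). Qed.

Canonical cl_equiv := EquivRel cl_relb cl_relb_refl cl_relb_sym cl_relb_trans.

Definition clifford := {eq_quot cl_relb}.
HB.instance Definition _ := Choice.on clifford.
HB.instance Definition _ := EqQuotient.on clifford.

Definition cl_of (s : cl_expr) : clifford := \pi_clifford s.

Lemma cl_ofP s t : cl_rel s t -> cl_of s = cl_of t.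
Proof. by move=> h; apply/eqmodP/asboolP. Qed.

Lemma cl_of_eq s t : cl_of s = cl_of t -> cl_rel s t.
Proof. by move=> /eqmodP/asboolP. Qed.

Lemma cl_reprK x : cl_of (repr x) = x. Proof. exact: reprK. Qed.

Lemma cl_repr_of s : cl_rel (repr (cl_of s)) s.
Proof. by apply: cl_of_eq; rewrite cl_reprK. Qed.

Lemma cl_ofW (P : clifford -> Prop) : (forall s, P (cl_of s)) -> forall x, P x.
Proof. by move=> h x; rewrite -(cl_reprK x). Qed.

Definition cl_add (x y : clifford) := cl_of (ClAdd (repr x) (repr y)).
Definition cl_mul (x y : clifford) := cl_of (ClMul (repr x) (repr y)).
Definition cl_opp (x : clifford) := cl_of (ClMul (ClConst (-1)) (repr x)).
Definition cl_scale (a : K) (x : clifford) := cl_of (ClMul (ClConst a) (repr x)).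

Lemma cl_ofD s t : cl_add (cl_of s) (cl_of t) = cl_of (ClAdd s t).
Proof. by apply/cl_ofP/cl_congD; exact: cl_repr_of. Qed.

Lemma cl_ofM s t : cl_mul (cl_of s) (cl_of t) = cl_of (ClMul s t).
Proof. by apply/cl_ofP/cl_congM; exact: cl_repr_of. Qed.

Lemma cl_ofN s : cl_opp (cl_of s) = cl_of (ClMul (ClConst (-1)) s).
Proof. by apply/cl_ofP/cl_congM; [exact: cl_refl|exact: cl_repr_of]. Qed.

Lemma cl_ofZ a s : cl_scale a (cl_of s) = cl_of (ClMul (ClConst a) s).
Proof. by apply/cl_ofP/cl_congM; [exact: cl_refl|exact: cl_repr_of]. Qed.

Fact cl_addA_ : associative cl_add.
Proof.
elim/cl_ofW=> s; elim/cl_ofW=> t; elim/cl_ofW=> u.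
by rewrite !cl_ofD; apply/cl_ofP/cl_addA.
Qed.

Fact cl_addC_ : commutative cl_add.
Proof.
by elim/cl_ofW=> s; elim/cl_ofW=> t; rewrite !cl_ofD; apply/cl_ofP/cl_addC.
Qed.

Fact cl_add0_ : left_id (cl_of (ClConst 0)) cl_add.
Proof. by elim/cl_ofW=> s; rewrite !cl_ofD; apply/cl_ofP/cl_add0. Qed.

Fact cl_addN_ : left_inverse (cl_of (ClConst 0)) cl_opp cl_add.
Proof. by elim/cl_ofW=> s; rewrite cl_ofN cl_ofD; apply/cl_ofP/cl_addN. Qed.

HB.instance Definition _ :=
  GRing.isZmodule.Build clifford cl_addA_ cl_addC_ cl_add0_ cl_addN_.

Fact cl_mulA_ : associative cl_mul.
Proof.
elim/cl_ofW=> s; elim/cl_ofW=> t; elim/cl_ofW=> u.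
by rewrite !cl_ofM; apply/cl_ofP/cl_mulA.
Qed.

Fact cl_mul1l_ : left_id (cl_of (ClConst 1)) cl_mul.
Proof. by elim/cl_ofW=> s; rewrite !cl_ofM; apply/cl_ofP/cl_mul1l. Qed.

Fact cl_mul1r_ : right_id (cl_of (ClConst 1)) cl_mul.
Proof. by elim/cl_ofW=> s; rewrite !cl_ofM; apply/cl_ofP/cl_mul1r. Qed.

Fact cl_mulDl_ : left_distributive cl_mul cl_add.
Proof.
elim/cl_ofW=> s; elim/cl_ofW=> t; elim/cl_ofW=> u.
by rewrite !(cl_ofM, cl_ofD); apply/cl_ofP/cl_mulDl.
Qed.

Fact cl_mulDr_ : right_distributive cl_mul cl_add.
Proof.
elim/cl_ofW=> s; elim/cl_ofW=> t; elim/cl_ofW=> u.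
by rewrite !(cl_ofM, cl_ofD); apply/cl_ofP/cl_mulDr.
Qed.

HB.instance Definition _ := GRing.Zmodule_isPzRing.Build clifford
  cl_mulA_ cl_mul1l_ cl_mul1r_ cl_mulDl_ cl_mulDr_.

Fact cl_scaleA_ a b x : cl_scale a (cl_scale b x) = cl_scale (a * b) x.
Proof.
elim/cl_ofW: x => s; rewrite !cl_ofZ; apply/cl_ofP.
apply: cl_trans (cl_mulA _ _ _) _; apply: cl_congM (cl_refl _).
exact/cl_sym/cl_constM.
Qed.

Fact cl_scale1_ : left_id 1 cl_scale.
Proof. by elim/cl_ofW=> s; rewrite cl_ofZ; apply/cl_ofP/cl_mul1l. Qed.

Fact cl_scaleDr_ : right_distributive cl_scale +%R.
Proof.
move=> a; elim/cl_ofW=> s; elim/cl_ofW=> t.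
rewrite /GRing.add /= !(cl_ofZ, cl_ofD); exact/cl_ofP/cl_mulDr.
Qed.

Fact cl_scaleDl_ x : {morph cl_scale^~ x : a b / a + b}.
Proof.
elim/cl_ofW: x => s a b; rewrite [in RHS]/GRing.add /= !(cl_ofZ, cl_ofD).
apply/cl_ofP; apply: cl_trans (cl_mulDl _ _ _); apply: cl_congM (cl_refl _).
exact: cl_constD.
Qed.

HB.instance Definition _ := GRing.Zmodule_isLmodule.Build K clifford
  cl_scaleA_ cl_scale1_ cl_scaleDr_ cl_scaleDl_.

Definition psi (m : int) : clifford := cl_of (ClPsi m).
Definition psis (m : int) : clifford := cl_of (ClPsis m).

Fixpoint cl_expr_act (s : cl_expr) (v : fock) : fock :=
  match s with
  | ClConst a => a *: v
  | ClPsi m => psi_op m v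
  | ClPsis m => psis_op m v
  | ClAdd s t => cl_expr_act s v + cl_expr_act t v
  | ClMul s t => cl_expr_act s (cl_expr_act t v)
  end.

Lemma cl_expr_actP s a u v :
  cl_expr_act s (a *: u + v) = a *: cl_expr_act s u + cl_expr_act s v.
Proof.
elim: s u v => [b|m|m|s IHs t IHt|s IHs t IHt] u v /=.
- by rewrite scalerDr !scalerA mulrC.
- exact: psi_opP.
- exact: psis_opP.
- by rewrite IHs IHt addrACA scalerDr.
- by rewrite IHt IHs.
Qed.

Lemma cl_expr_actD s u v :
  cl_expr_act s (u + v) = cl_expr_act s u + cl_expr_act s v.
Proof. by have := cl_expr_actP s 1 u v; rewrite !scale1r. Qed.

Lemma cl_expr_act0 s : cl_expr_act s 0 = 0.
Proof. by apply: (addrI (cl_expr_act s 0)); rewrite -cl_expr_actD !addr0. Qed.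

Lemma cl_expr_actZ s a v : cl_expr_act s (a *: v) = a *: cl_expr_act s v.
Proof. by have := cl_expr_actP s a v 0; rewrite cl_expr_act0 !addr0. Qed.

Lemma cl_expr_act_rel s t : cl_rel s t -> cl_expr_act s =1 cl_expr_act t.
Proof.
elim=> {s t} //=.
- by move=> s t _ h v; rewrite h.
- by move=> s t u _ h1 _ h2 v; rewrite h1.
- by move=> s s' t t' _ h1 _ h2 v; rewrite h1 h2.
- by move=> s s' t t' _ h1 _ h2 v; rewrite h1 h2.
- by move=> s t u v; rewrite addrA.
- by move=> s t v; rewrite addrC.
- by move=> s v; rewrite scale0r add0r.
- by move=> s v; rewrite scaleN1r addNr scale0r.
- by move=> s v; rewrite scale1r.
- by move=> s v; rewrite scale1r.
- by move=> s t u v; rewrite cl_expr_actD.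
- by move=> a b v; rewrite scalerDl.
- by move=> a b v; rewrite scalerA.
- by move=> a s v; rewrite cl_expr_actZ.
- by move=> n m v; rewrite psi_op_anti scale0r.
- by move=> n m v; rewrite psis_op_anti scale0r.
- by move=> n m v; rewrite psi_psis_op_anti.
Qed.

Definition cl_act (x : clifford) (v : fock) : fock := cl_expr_act (repr x) v.

Lemma cl_act_of s v : cl_act (cl_of s) v = cl_expr_act s v.
Proof. exact/cl_expr_act_rel/cl_repr_of. Qed.

Lemma cl_act_psi m v : cl_act (psi m) v = psi_op m v.
Proof. exact: cl_act_of. Qed.

Lemma cl_act_psis m v : cl_act (psis m) v = psis_op m v.
Proof. exact: cl_act_of. Qed.

Lemma cl_act1 v : cl_act 1 v = v.
Proof. by rewrite cl_act_of /= scale1r. Qed.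

Lemma cl_actM x y v : cl_act (x * y) v = cl_act x (cl_act y v).
Proof.
elim/cl_ofW: x => s; elim/cl_ofW: y => t.
by rewrite /GRing.mul /= cl_ofM !cl_act_of.
Qed.

Lemma cl_actD x y v : cl_act (x + y) v = cl_act x v + cl_act y v.
Proof.
elim/cl_ofW: x => s; elim/cl_ofW: y => t.
by rewrite [in LHS]/GRing.add /= cl_ofD !cl_act_of.
Qed.

Lemma cl_actZ a x v : cl_act (a *: x) v = a *: cl_act x v.
Proof.
by elim/cl_ofW: x => s; rewrite [in LHS]/GRing.scale /= cl_ofZ !cl_act_of.
Qed.

Lemma cl_act0l v : cl_act 0 v = 0.
Proof. by rewrite cl_act_of /= scale0r. Qed.

Lemma cl_actP x a u v : cl_act x (a *: u + v) = a *: cl_act x u + cl_act x v.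
Proof. exact: cl_expr_actP. Qed.

HB.instance Definition _ x :=
  GRing.isLinear.Build K fock fock _ (cl_act x) (cl_actP x).

Fact is_wedge_vacuum : is_wedge (fun k => - k%:Z - 1).
Proof.
apply/asboolP; split=> [k|]; first lia.
by exists 0%N => k _; lia.
Qed.
Definition wedge_vacuum := Wedge is_wedge_vacuum.

Fact cl_1_neq0 : (1 : clifford) != 0.
Proof.
apply/eqP => h; have := cl_act1 (wvec K wedge_vacuum).
by rewrite h cl_act0l => /esym/eqP; rewrite (negbTE (wvec_neq0 _ _)).
Qed.

HB.instance Definition _ := GRing.PzSemiRing_isNonZero.Build clifford cl_1_neq0.

Fact cl_scaleAl a (x y : clifford) : a *: (x * y) = a *: x * y.
Proof.
elim/cl_ofW: x => s; elim/cl_ofW: y => t.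
rewrite /GRing.scale /GRing.mul /= !(cl_ofZ, cl_ofM); exact/cl_ofP/cl_mulA.
Qed.

HB.instance Definition _ := GRing.LSemiModule_isLSemiAlgebra.Build K clifford cl_scaleAl.

Fact cl_scaleAr a (x y : clifford) : a *: (x * y) = x * (a *: y).
Proof.
elim/cl_ofW: x => s; elim/cl_ofW: y => t.
rewrite /GRing.scale /GRing.mul /= !(cl_ofZ, cl_ofM); apply/cl_ofP.
apply: cl_trans (cl_mulA _ _ _) _; apply: cl_trans (cl_sym (cl_mulA _ _ _)).
exact: cl_congM (cl_constC _ _) (cl_refl _).
Qed.

HB.instance Definition _ := GRing.LSemiAlgebra_isSemiAlgebra.Build K clifford cl_scaleAr.

Lemma cl_of_add s t : cl_of s + cl_of t = cl_of (ClAdd s t).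
Proof. exact: cl_ofD. Qed.

Lemma cl_of_mul s t : cl_of s * cl_of t = cl_of (ClMul s t).
Proof. exact: cl_ofM. Qed.

Lemma cl_of_const a : cl_of (ClConst a) = a%:A.
Proof.
by rewrite /GRing.scale /= cl_ofZ; apply/cl_ofP/cl_sym/cl_mul1r.
Qed.

Lemma psi_psi n m : psi n * psi m + psi m * psi n = 0.
Proof. by rewrite !cl_of_mul cl_of_add; apply/cl_ofP/cl_psi_psi. Qed.

Lemma psis_psis n m : psis n * psis m + psis m * psis n = 0.
Proof. by rewrite !cl_of_mul cl_of_add; apply/cl_ofP/cl_psis_psis. Qed.

Lemma psi_psis n m : psi n * psis m + psis m * psi n = (n == m)%:R.
Proof.
rewrite !cl_of_mul cl_of_add (cl_ofP (cl_psi_psis n m)) cl_of_const.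
by case: eqP => _; rewrite ?scale1r ?scale0r.
Qed.

Lemma clifford_ind (P : clifford -> Prop) :
  (forall a, P a%:A) -> (forall m, P (psi m)) -> (forall m, P (psis m)) ->
  (forall x y, P x -> P y -> P (x + y)) -> (forall x y, P x -> P y -> P (x * y)) ->
  forall x, P x.
Proof.
move=> PC Pp Ps PD PM; elim/cl_ofW; elim=> //.
- by move=> a; rewrite cl_of_const.
- by move=> s IHs t IHt; rewrite -cl_ofD; apply: PD.
- by move=> s IHs t IHt; rewrite -cl_ofM; apply: PM.
Qed.

End Clifford.


Section Completion.
Variable K : fieldType.
Local Notation fock := (fock K).
Local Notation clifford := (clifford K).
Local Notation psi := (psi K).
Local Notation psis := (psis K).

(* The left ideal J_N generated by psi*_m and psi_{-m}, m > N, in the encoding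
   of half-integers by integers. *)
Inductive clJ (N : nat) : clifford -> Prop :=
| clJ_psis (m : int) : N%:Z <= m -> clJ N (psis m)
| clJ_psi (m : int) : N%:Z <= m -> clJ N (psi (- m - 1))
| clJ0 : clJ N 0
| clJD x y : clJ N x -> clJ N y -> clJ N (x + y)
| clJM x y : clJ N y -> clJ N (x * y).

Lemma clJZ N a x : clJ N x -> clJ N (a *: x).
Proof. by move=> h; rewrite -[x]mul1r scalerAl; apply: clJM. Qed.

Lemma clJN N x : clJ N x -> clJ N (- x).
Proof. by rewrite -scaleN1r; apply: clJZ. Qed.

Lemma clJS N M x : (N <= M)%N -> clJ M x -> clJ N x.
Proof.
move=> le; elim=> [m h|m h||y z _ h1 _ h2|y z _ h].
- by apply: clJ_psis; lia.
- by apply: clJ_psi; lia.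
- exact: clJ0.
- exact: clJD.
- exact: clJM.
Qed.

Lemma clJ_mulr (y : clifford) N :
  exists M, forall L z, (M <= L)%N -> clJ L z -> clJ N (z * y).
Proof.
elim/clifford_ind: y N => [a|m|m|x y IHx IHy|x y IHx IHy] N.
- exists N => L z le h; rewrite -scalerAr mulr1.
  exact/clJZ/(clJS le).
- exists (N + `|m|.+1)%N => L z le; elim=> [k h|k h||u v _ h1 _ h2|u v _ h].
  + have := psi_psis K m k; rewrite (_ : (m == k) = false); last lia.
    move=> /eqP; rewrite addrC addr_eq0 => /eqP->.
    by apply/clJN/clJM/clJ_psis; lia.
  + have := psi_psi K m (- k - 1) => /eqP; rewrite addrC addr_eq0 => /eqP->.
    by apply/clJN/clJM/clJ_psi; lia.
  + by rewrite mul0r; exact: clJ0.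
  + by rewrite mulrDl; exact: clJD.
  + by rewrite -mulrA; exact: clJM.
- exists (N + `|m|.+1)%N => L z le; elim=> [k h|k h||u v _ h1 _ h2|u v _ h].
  + have := psis_psis K m k => /eqP; rewrite addrC addr_eq0 => /eqP->.
    by apply/clJN/clJM/clJ_psis; lia.
  + have := psi_psis K (- k - 1) m; rewrite (_ : (- k - 1 == m) = false); last lia.
    move=> /eqP; rewrite addr_eq0 => /eqP->.
    by apply/clJN/clJM/clJ_psi; lia.
  + by rewrite mul0r; exact: clJ0.
  + by rewrite mulrDl; exact: clJD.
  + by rewrite -mulrA; exact: clJM.
- have [M1 h1] := IHx N; have [M2 h2] := IHy N.
  exists (M1 + M2)%N => L z le h; rewrite mulrDr.
  by apply: clJD; [apply: h1 h|apply: h2 h]; lia.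
- have [M1 h1] := IHy N; have [M2 h2] := IHx M1.
  by exists M2 => L z le h; rewrite mulrA; apply: (h1 M1) => //; apply: h2 h.
Qed.

Definition eqJ N (x y : clifford) := clJ N (x - y).

Lemma eqJ_refl N x : eqJ N x x. Proof. by rewrite /eqJ subrr; exact: clJ0. Qed.
Lemma eqJ_sym N x y : eqJ N x y -> eqJ N y x.
Proof. by rewrite /eqJ -(opprB x); exact: clJN. Qed.
Lemma eqJ_trans N y x z : eqJ N x y -> eqJ N y z -> eqJ N x z.
Proof. by move=> h h'; rewrite /eqJ -[x - z](subrKA y); exact: clJD h h'. Qed.
Lemma eqJD N x y x' y' : eqJ N x x' -> eqJ N y y' -> eqJ N (x + y) (x' + y').
Proof. by rewrite /eqJ opprD addrACA; exact: clJD. Qed.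
Lemma eqJZ N a x x' : eqJ N x x' -> eqJ N (a *: x) (a *: x').
Proof. by rewrite /eqJ -scalerBr; exact: clJZ. Qed.
Lemma eqJM N x y y' : eqJ N y y' -> eqJ N (x * y) (x * y').
Proof. by rewrite /eqJ -mulrBr; exact: clJM. Qed.
Lemma eqJS N M x y : (N <= M)%N -> eqJ M x y -> eqJ N x y.
Proof. exact: clJS. Qed.

(* The completion as the inverse limit of the Cl / J_N: coherent families of
   cosets. *)
Definition is_cl_lim (X : nat -> set clifford) : bool :=
  `[< (forall N, exists x, X N = [set y | eqJ N y x]%classic) /\
      (forall N, (X N.+1 `<=` X N)%classic) >].

Record cclifford := CClifford {
  cc_coset :> nat -> set clifford;
  _ : is_cl_lim cc_coset }.
HB.instance Definition _ := [isSub for cc_coset].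
HB.instance Definition _ := [Choice of cclifford by <:].

Lemma cc_cosetP (X : cclifford) N : exists x, X N = [set y | eqJ N y x]%classic.
Proof. by case: X => X /= /asboolP[]. Qed.

Definition cc_rep (X : cclifford) (N : nat) : clifford := sval (cid (cc_cosetP X N)).

Lemma cc_repE (X : cclifford) N y : X N y <-> eqJ N y (cc_rep X N).
Proof. by rewrite /cc_rep; case: cid => x /= ->. Qed.

Lemma cc_rep_mem (X : cclifford) N : X N (cc_rep X N).
Proof. exact/cc_repE/eqJ_refl. Qed.

Lemma cc_coset_le (X : cclifford) N M : (N <= M)%N -> (X M `<=` X N)%classic.
Proof.
move=> /subnK <-; elim: (M - N)%N => // k IH; rewrite addSn => y.
by case: X IH => X /= /asboolP[_ h] IH /h; exact: IH.
Qed.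

Lemma cc_rep_le (X : cclifford) N M : (N <= M)%N -> eqJ N (cc_rep X M) (cc_rep X N).
Proof. by move=> h; apply/cc_repE/(cc_coset_le h)/cc_rep_mem. Qed.

Lemma cc_eqP (X Y : cclifford) :
  (forall N, eqJ N (cc_rep X N) (cc_rep Y N)) -> X = Y.
Proof.
move=> h; apply/val_inj/funext => N; apply/seteqP; split => y /=.
  by move=> /cc_repE h'; apply/cc_repE/(eqJ_trans h').
by move=> /cc_repE h'; apply/cc_repE/(eqJ_trans h')/eqJ_sym.
Qed.

Definition cl_coherent (s : nat -> clifford) := forall N, eqJ N (s N.+1) (s N).

Fact cc_mk_subproof s : cl_coherent s ->
  is_cl_lim (fun N => [set y | eqJ N y (s N)]%classic).
Proof.
move=> h; apply/asboolP; split => N; first by exists (s N).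
by move=> y /= h'; apply: eqJ_trans (h N); apply: eqJS h'.
Qed.

Definition cc_mk s (h : cl_coherent s) : cclifford := CClifford (cc_mk_subproof h).

Lemma cc_mkE s (h : cl_coherent s) N : eqJ N (cc_rep (cc_mk h) N) (s N).
Proof. by have := cc_rep_mem (cc_mk h) N. Qed.

Fact cc_const_subproof x : cl_coherent (fun=> x).
Proof. by move=> N; exact: eqJ_refl. Qed.
Definition cc_of (x : clifford) : cclifford := cc_mk (cc_const_subproof x).

Fact cc_add_subproof (X Y : cclifford) : cl_coherent (fun N => cc_rep X N + cc_rep Y N).
Proof. by move=> N; apply: eqJD; exact: cc_rep_le. Qed.
Definition cc_add X Y := cc_mk (cc_add_subproof X Y).

Fact cc_scale_subproof a (X : cclifford) : cl_coherent (fun N => a *: cc_rep X N).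
Proof. by move=> N; apply: eqJZ; exact: cc_rep_le. Qed.
Definition cc_scale a X := cc_mk (cc_scale_subproof a X).

(* The product of the cosets x_N and y_N is x_M y_N + J_N for any M with
   J_M y_N contained in J_N. *)
Definition cc_ord (y : clifford) N : nat := sval (cid (clJ_mulr y N)).

Lemma cc_ordP y N z L : (cc_ord y N <= L)%N -> clJ L z -> clJ N (z * y).
Proof. by rewrite /cc_ord; case: cid => M /= h; exact: h. Qed.

Lemma cc_ord_eqJ y N z z' L : (cc_ord y N <= L)%N -> eqJ L z z' -> eqJ N (z * y) (z' * y).
Proof. by move=> h h'; rewrite /eqJ -mulrBl; apply: cc_ordP h h'. Qed.

Definition cc_mul_seq (X Y : cclifford) N :=
  cc_rep X (cc_ord (cc_rep Y N) N) * cc_rep Y N.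

Lemma cc_mul_seqE X Y N M a b : (cc_ord (cc_rep Y N) N <= M)%N ->
  eqJ M a (cc_rep X M) -> eqJ N b (cc_rep Y N) -> eqJ N (cc_mul_seq X Y N) (a * b).
Proof.
move=> le ha hb; apply: eqJ_trans (eqJM _ (eqJ_sym hb)).
apply: cc_ord_eqJ (leqnn _) _; apply: eqJ_trans (eqJ_sym (cc_rep_le _ le)) _.
by apply/eqJ_sym/(eqJS le).
Qed.

Fact cc_mul_subproof X Y : cl_coherent (cc_mul_seq X Y).
Proof.
move=> N; pose M := (cc_ord (cc_rep Y N) N + cc_ord (cc_rep Y N.+1) N.+1)%N.
apply: (@eqJ_trans _ (cc_rep X M * cc_rep Y N.+1)).
  apply: eqJS (leqnSn _) _; apply: (cc_mul_seqE (M := M)); [lia|exact: eqJ_refl..].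
apply/eqJ_sym/(cc_mul_seqE (M := M)); [lia|exact: eqJ_refl|exact: cc_rep_le].
Qed.
Definition cc_mul X Y := cc_mk (cc_mul_subproof X Y).

Lemma cc_mulE X Y N M a b : (cc_ord (cc_rep Y N) N <= M)%N ->
  eqJ M a (cc_rep X M) -> eqJ N b (cc_rep Y N) -> eqJ N (cc_rep (cc_mul X Y) N) (a * b).
Proof.
by move=> le ha hb; apply: eqJ_trans (cc_mkE _ _) _; apply: cc_mul_seqE ha hb.
Qed.

Fact cc_addA : associative cc_add.
Proof.
move=> X Y Z; apply: cc_eqP => N; apply: eqJ_trans (cc_mkE _ _) _.
apply: eqJ_trans (eqJD (eqJ_refl _ _) (cc_mkE _ _)) _; rewrite addrA.
by apply/eqJ_sym/(eqJ_trans (cc_mkE _ _))/eqJD; [exact: cc_mkE|exact: eqJ_refl].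
Qed.

Fact cc_addC : commutative cc_add.
Proof.
move=> X Y; apply: cc_eqP => N; apply: eqJ_trans (cc_mkE _ _) _.
by rewrite addrC; apply/eqJ_sym/cc_mkE.
Qed.

Fact cc_add0 : left_id (cc_of 0) cc_add.
Proof.
move=> X; apply: cc_eqP => N; apply: eqJ_trans (cc_mkE _ _) _.
rewrite -{2}[cc_rep X N]add0r; apply: eqJD (eqJ_refl _ _); exact: cc_mkE.
Qed.

Fact cc_addN : left_inverse (cc_of 0) (cc_scale (-1)) cc_add.
Proof.
move=> X; apply: cc_eqP => N; apply: eqJ_trans (cc_mkE _ _) _.
apply: eqJ_trans (eqJD (cc_mkE _ _) (eqJ_refl _ _)) _; rewrite scaleN1r addNr.
exact/eqJ_sym/cc_mkE.
Qed.

HB.instance Definition _ :=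
  GRing.isZmodule.Build cclifford cc_addA cc_addC cc_add0 cc_addN.

Fact cc_mulA : associative cc_mul.
Proof.
move=> X Y Z; apply: cc_eqP => N.
pose M1 := cc_ord (cc_rep Z N) N.
pose M2 := cc_ord (cc_rep Y M1) M1.
pose M3 := cc_ord (cc_rep (cc_mul Y Z) N) N.
pose M := (N + M1 + M2 + M3)%N.
apply: (@eqJ_trans _ (cc_rep X M * (cc_rep Y M * cc_rep Z M))).
  apply: (cc_mulE (M := M)); [lia|exact: eqJ_refl|].
  by apply/eqJ_sym/(cc_mulE (M := M)); [lia|exact: eqJ_refl|apply: cc_rep_le; lia].
rewrite mulrA; apply/eqJ_sym/(cc_mulE (M := M1)) => //; last by apply: cc_rep_le; lia.
by apply/eqJ_sym/(cc_mulE (M := M)); [lia|exact: eqJ_refl|apply: cc_rep_le; lia].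
Qed.

Fact cc_mul1l : left_id (cc_of 1) cc_mul.
Proof.
move=> X; apply: cc_eqP => N; rewrite -[cc_rep X N]mul1r.
by apply: (cc_mulE (leqnn _)); [apply/eqJ_sym/cc_mkE|exact: eqJ_refl].
Qed.

Fact cc_mul1r : right_id (cc_of 1) cc_mul.
Proof.
move=> X; apply: cc_eqP => N.
pose M := (N + cc_ord (cc_rep (cc_of 1%R) N) N)%N.
apply: (@eqJ_trans _ (cc_rep X M * 1)); last by rewrite mulr1; apply: cc_rep_le; lia.
by apply: (cc_mulE (M := M)); [lia|exact: eqJ_refl|apply/eqJ_sym/cc_mkE].
Qed.

Fact cc_mulDl : left_distributive cc_mul cc_add.
Proof.
move=> X Y Z; apply: cc_eqP => N; pose M := cc_ord (cc_rep Z N) N.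
apply: (@eqJ_trans _ ((cc_rep X M + cc_rep Y M) * cc_rep Z N)).
  by apply: (cc_mulE (leqnn _)); [apply/eqJ_sym/cc_mkE|exact: eqJ_refl].
rewrite mulrDl; apply/eqJ_sym/(eqJ_trans (cc_mkE _ _))/eqJD;
  by apply: (cc_mulE (leqnn _)); exact: eqJ_refl.
Qed.

Fact cc_mulDr : right_distributive cc_mul cc_add.
Proof.
move=> X Y Z; apply: cc_eqP => N.
pose M := (cc_ord (cc_rep Y N) N + cc_ord (cc_rep Z N) N
           + cc_ord (cc_rep (cc_add Y Z) N) N)%N.
apply: (@eqJ_trans _ (cc_rep X M * (cc_rep Y N + cc_rep Z N))).
  by apply: (cc_mulE (M := M)); [lia|exact: eqJ_refl|apply/eqJ_sym/cc_mkE].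
rewrite mulrDr; apply/eqJ_sym/(eqJ_trans (cc_mkE _ _))/eqJD;
  by apply: (cc_mulE (M := M)); [lia|exact: eqJ_refl..].
Qed.

HB.instance Definition _ := GRing.Zmodule_isPzRing.Build cclifford
  cc_mulA cc_mul1l cc_mul1r cc_mulDl cc_mulDr.

Fact cc_scaleA a b X : cc_scale a (cc_scale b X) = cc_scale (a * b) X.
Proof.
apply: cc_eqP => N; apply: eqJ_trans (cc_mkE _ _) _.
apply: eqJ_trans (eqJZ _ (cc_mkE _ _)) _; rewrite scalerA; exact/eqJ_sym/cc_mkE.
Qed.

Fact cc_scale1 : left_id 1 cc_scale.
Proof.
by move=> X; apply: cc_eqP => N; have := cc_mkE (cc_scale_subproof 1 X) N; rewrite scale1r.
Qed.

Fact cc_scaleDr : right_distributive cc_scale +%R.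
Proof.
move=> a X Y; apply: cc_eqP => N; apply: eqJ_trans (cc_mkE _ _) _.
apply: eqJ_trans (eqJZ _ (cc_mkE _ _)) _; rewrite scalerDr.
by apply/eqJ_sym/(eqJ_trans (cc_mkE _ _))/eqJD; exact: cc_mkE.
Qed.

Fact cc_scaleDl X : {morph cc_scale^~ X : a b / a + b}.
Proof.
move=> a b; apply: cc_eqP => N; apply: eqJ_trans (cc_mkE _ _) _; rewrite scalerDl.
by apply/eqJ_sym/(eqJ_trans (cc_mkE _ _))/eqJD; exact: cc_mkE.
Qed.

HB.instance Definition _ := GRing.Zmodule_isLmodule.Build K cclifford
  cc_scaleA cc_scale1 cc_scaleDr cc_scaleDl.

Fact cc_scaleAl a (X Y : cclifford) : a *: (X * Y) = a *: X * Y.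
Proof.
apply: cc_eqP => N; apply: eqJ_trans (cc_mkE _ _) _; pose M := cc_ord (cc_rep Y N) N.
apply: (@eqJ_trans _ (a *: (cc_rep X M * cc_rep Y N))).
  by apply/eqJZ/(cc_mulE (leqnn _)); exact: eqJ_refl.
rewrite scalerAl; apply/eqJ_sym/(cc_mulE (leqnn _)); last exact: eqJ_refl.
exact/eqJ_sym/cc_mkE.
Qed.

Fact cc_scaleAr a (X Y : cclifford) : a *: (X * Y) = X * (a *: Y).
Proof.
apply: cc_eqP => N; apply: eqJ_trans (cc_mkE _ _) _.
pose M := (cc_ord (cc_rep Y N) N + cc_ord (cc_rep (a *: Y) N) N)%N.
apply: (@eqJ_trans _ (a *: (cc_rep X M * cc_rep Y N))).
  by apply/eqJZ/(cc_mulE (M := M)); [lia|exact: eqJ_refl..].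
rewrite scalerAr; apply/eqJ_sym/(cc_mulE (M := M)); [lia|exact: eqJ_refl|].
exact/eqJ_sym/cc_mkE.
Qed.

Lemma clJ_kill_wedge (w : wedge) : exists N, forall y, clJ N y -> cl_act y (wvec K w) = 0.
Proof.
have [n hn] := wedge_tail w.
have mem m : m <= w n -> wedge_mem w m.
  move=> h; apply/wedge_memP; exists (n + `|w n - m|)%N.
  have e j : w (n + j)%N = w n - j%:Z.
    by elim: j => [|j IH]; [rewrite addn0 subr0 | rewrite addnS hn ?IH; lia].
  by rewrite e; lia.
have nmem m : w 0%N < m -> ~~ wedge_mem w m.
  move=> h; apply/negP => /wedge_memP[k hk].
  by have := wedge_le w (leq0n k); lia.
exists (`|w 0%N| + `|w n|).+1 => y; elim=> [m h|m h||x z _ h1 _ h2|x z _ h].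
- by rewrite cl_act_psis psis_opE /psis_basis (negbTE (nmem m _)) //; lia.
- by rewrite cl_act_psi psi_opE /psi_basis mem //; lia.
- exact: cl_act0l.
- by rewrite cl_actD h1 h2 addr0.
- by rewrite cl_actM h linear0.
Qed.

Lemma clJ_kill (v : fock) : exists N, forall y, clJ N y -> cl_act y v = 0.
Proof.
elim/fock_ind: v => [|a w u [N h]]; first by exists 0%N => y _; rewrite linear0.
have [M h'] := clJ_kill_wedge w; exists (N + M)%N => y hy.
rewrite cl_actP h ?h' ?scaler0 ?addr0 //; apply: clJS hy; lia.
Qed.

(* X acts on v through its class in Cl / J_N, for any N with J_N v = 0. *)
Definition cc_act (X : cclifford) (v : fock) : fock :=
  cl_act (cc_rep X (sval (cid (clJ_kill v)))) v.

Lemma cc_actE (X : cclifford) v N y :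
  (forall z, clJ N z -> cl_act z v = 0) -> X N y -> cc_act X v = cl_act y v.
Proof.
move=> hN /cc_repE hy; rewrite /cc_act; case: cid => M /= hM.
have e L z z' : (forall y, clJ L y -> cl_act y v = 0) -> eqJ L z z' -> cl_act z v = cl_act z' v.
  by move=> hL /hL; rewrite -scaleN1r addrC cl_actD cl_actZ scaleN1r => /eqP; rewrite addrC subr_eq0 => /eqP.
rewrite (e _ _ _ hN hy).
case: (leqP N M) => h; last have {}h := ltnW h.
  exact/(e N)/cc_rep_le.
by apply/esym/(e M)/cc_rep_le.
Qed.

Lemma cc_act_of x v : cc_act (cc_of x) v = cl_act x v.
Proof. by have [N hN] := clJ_kill v; apply: (cc_actE hN); exact: eqJ_refl. Qed.

Lemma cc_actP X a u v : cc_act X (a *: u + v) = a *: cc_act X u + cc_act X v.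
Proof.
have [N hN] := clJ_kill u; have [M hM] := clJ_kill v.
have hu z : clJ (N + M)%N z -> cl_act z u = 0.
  by move=> h; apply/hN/(clJS _ h)/leq_addr.
have hv z : clJ (N + M)%N z -> cl_act z v = 0.
  by move=> h; apply/hM/(clJS _ h)/leq_addl.
have huv z : clJ (N + M)%N z -> cl_act z (a *: u + v) = 0.
  by move=> h; rewrite cl_actP hu // hv // scaler0 addr0.
have m := cc_rep_mem X (N + M).
by rewrite (cc_actE huv m) (cc_actE hu m) (cc_actE hv m) cl_actP.
Qed.

HB.instance Definition _ X :=
  GRing.isLinear.Build K fock fock _ (cc_act X) (cc_actP X).

Lemma cc_act1 v : cc_act 1 v = v.
Proof. by rewrite cc_act_of cl_act1. Qed.

Lemma cc_act0l v : cc_act 0 v = 0.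
Proof. by rewrite cc_act_of cl_act0l. Qed.

Lemma cc_actDl X Y v : cc_act (X + Y) v = cc_act X v + cc_act Y v.
Proof.
have [N hN] := clJ_kill v.
rewrite (cc_actE hN (cc_rep_mem X N)) (cc_actE hN (cc_rep_mem Y N)) -cl_actD.
by apply: (cc_actE hN); apply/cc_repE/eqJ_sym/cc_mkE.
Qed.

Lemma cc_actZl a X v : cc_act (a *: X) v = a *: cc_act X v.
Proof.
have [N hN] := clJ_kill v.
rewrite (cc_actE hN (cc_rep_mem X N)) -cl_actZ.
by apply: (cc_actE hN); apply/cc_repE/eqJ_sym/cc_mkE.
Qed.

Lemma cc_actM X Y v : cc_act (X * Y) v = cc_act X (cc_act Y v).
Proof.
have [N hN] := clJ_kill v; rewrite (cc_actE hN (cc_rep_mem Y N)).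
set u := cl_act _ v; have [M hM] := clJ_kill u.
pose L := (M + cc_ord (cc_rep Y N) N)%N.
have hL z : clJ L z -> cl_act z u = 0 by move=> h; apply/hM/(clJS _ h)/leq_addr.
rewrite (cc_actE hL (cc_rep_mem X L)) -cl_actM.
apply: (cc_actE hN); apply/cc_repE/eqJ_sym/(cc_mulE (M := L)); try exact: eqJ_refl.
lia.
Qed.

Fact cc_1_neq0 : (1 : cclifford) != 0.
Proof.
apply/eqP => h; have := cc_act1 (wvec K wedge_vacuum).
by rewrite h cc_act0l => /esym/eqP; rewrite (negbTE (wvec_neq0 _ _)).
Qed.

HB.instance Definition _ := GRing.PzSemiRing_isNonZero.Build cclifford cc_1_neq0.
HB.instance Definition _ :=
  GRing.LSemiModule_isLSemiAlgebra.Build K cclifford cc_scaleAl.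
HB.instance Definition _ :=
  GRing.LSemiAlgebra_isSemiAlgebra.Build K cclifford cc_scaleAr.

End Completion.


Section Ainf.
Variable K : fieldType.
Local Notation clifford := (clifford K).
Local Notation psi := (psi K).
Local Notation psis := (psis K).

(* Matrices indexed by Z + 1/2 with finitely many nonzero diagonals. *)
Definition is_band (A : int -> int -> K^o) : bool :=
  `[< exists k : nat, forall i j, (k < `|i - j|)%N -> A i j = 0 >].

Record bandmx := BandMx { band_entry :> int -> int -> K^o; _ : is_band band_entry }.
HB.instance Definition _ := [isSub for band_entry].
HB.instance Definition _ := [Choice of bandmx by <:].

Fact is_band_closed : submod_closed is_band.
Proof.
split; first by apply/asboolP; exists 0%N.
move=> a A B /asboolP[k hk] /asboolP[k' hk']; apply/asboolP.
exists (k + k')%N => i j h; rewrite /GRing.add /= /GRing.add /= /GRing.scale /= /GRing.scale /=.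
by rewrite hk ?hk'; [rewrite scaler0 addr0|lia..].
Qed.
HB.instance Definition _ := GRing.isSubmodClosed.Build K (int -> int -> K^o) is_band
  is_band_closed.
HB.instance Definition _ := [SubChoice_isSubLmodule of bandmx by <:].

Lemma band_bound (A : bandmx) :
  exists k : nat, forall i j, (k < `|i - j|)%N -> A i j = 0.
Proof. by case: A => A /= /asboolP. Qed.

Fact band_mul_subproof (A B : bandmx) :
  is_band (fun i j => \sum_(k \in [set: int]) A i k * B k j).
Proof.
have [k hk] := band_bound A; have [k' hk'] := band_bound B.
apply/asboolP; exists (k + k')%N => i j h; apply: fsbig1 => n _.
have [h1|h1] := leqP `|i - n| k; last by rewrite hk // mul0r.
by rewrite hk' ?mulr0 //; lia.
Qed.
Definition band_mul (A B : bandmx) : bandmx := BandMx (band_mul_subproof A B).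

(* a_infinity; the second component is the coefficient of c. *)
Definition ainf := (bandmx * K^o)%type.
HB.instance Definition _ := GRing.Lmodule.on ainf.

Definition ainf_c : ainf := (0, 1).

Definition ainf_bracket (x y : ainf) : ainf :=
  (band_mul x.1 y.1 - band_mul y.1 x.1,
   \sum_(p \in [set p : int * int | p.1 < 0 <= p.2]%classic)
      x.1 p.1 p.2 * y.1 p.2 p.1
   - \sum_(p \in [set p : int * int | p.2 < 0 <= p.1]%classic)
      x.1 p.1 p.2 * y.1 p.2 p.1).

(* The matrix unit E_{m,n}, and its image in the Clifford algebra. *)
Definition munit (m n i j : int) : K := ((i == m) && (j == n))%:R.

Definition cl_munit (m n : int) : clifford :=
  if (m != n) || (0 <= m) then psi m * psis n else - (psis n * psi n).

Lemma cl_munitJ N m n : (m < - N%:Z) || (N%:Z <= n) -> clJ N (cl_munit m n).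
Proof.
rewrite /cl_munit => /orP h.
have e (i : int) : - (- i - 1) - 1 = i by lia.
case: ifP => c; last first.
  have -> : n = m by lia.
  apply/clJN/clJM; rewrite -(e m); apply: clJ_psi; lia.
case: h => h; last exact/clJM/clJ_psis.
have hmn : (m == n) = false \/ 0 <= m by lia.
case: hmn => [hmn|]; last lia.
have := psi_psis K m n; rewrite hmn => /eqP; rewrite addr_eq0 => /eqP->.
by apply/clJN/clJM; rewrite -(e m); apply: clJ_psi; lia.
Qed.

(* Modulo J_N the infinite sum of the a_{i,j} cl_munit i j reduces to the
   terms with - N <= i and j < N (see [cl_munitJ]), finitely many of which are
   nonzero. *)
Definition ainf_box (N : nat) : set (int * int) :=
  [set p | - N%:Z <= p.1 /\ p.2 < N%:Z]%classic.

Definition ainf_cl_seq (x : ainf) (N : nat) : clifford :=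
  \sum_(p \in ainf_box N) (x.1 p.1 p.2 : K) *: cl_munit p.1 p.2 + (x.2 : K)%:A.

Lemma ainf_box_finite (A : bandmx) N :
  finite_set (ainf_box N `&`
    (fun p => (A p.1 p.2 : K) *: cl_munit p.1 p.2) @^-1` [set~ 0])%classic.
Proof.
have [k hk] := band_bound A; pose L := (N + k).+1.
pose f (p : nat * nat) : int * int := (p.1%:Z - L%:Z, p.2%:Z - L%:Z).
apply: (@sub_finite_set _ _ (f @` (`I_(L + L) `*` `I_(L + L)))%classic); last first.
  by apply: finite_image; apply: finite_setX; exact: finite_II.
move=> [i j] /= [[/= hi hj] h].
have hij : (`|i - j| <= k)%N.
  by rewrite leqNgt; apply/negP => /hk e; apply: h; rewrite e scale0r.
exists (absz (i + L%:Z), absz (j + L%:Z)); rewrite /f /=; first by split => /=; lia.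
by congr pair; lia.
Qed.

Fact ainf_cl_coherent x : cl_coherent (ainf_cl_seq x).
Proof.
move=> N; rewrite /eqJ /ainf_cl_seq opprD addrACA subrr addr0.
pose F (p : int * int) := (x.1 p.1 p.2 : K) *: cl_munit p.1 p.2.
have -> : \sum_(p \in ainf_box N.+1) F p =
    \sum_(p \in (ainf_box N.+1 `&` ainf_box N)%classic) F p +
    \sum_(p \in (ainf_box N.+1 `&` ~` ainf_box N)%classic) F p.
  rewrite fsbig_supp (fsbigID (ainf_box N)) /=; last exact: (ainf_box_finite x.1).
  by congr (_ + _); rewrite setIAC -fsbig_supp.
rewrite (_ : ainf_box N.+1 `&` ainf_box N = ainf_box N)%classic; last first.
  by apply: setIidr => -[i j] [/= h1 h2]; split => /=; lia.
rewrite addrAC subrr add0r big_seq.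
elim/big_ind: _ => [|y z|[i j]]; [exact: clJ0|exact: clJD|].
rewrite in_finite_support; last first.
  apply: sub_finite_set (ainf_box_finite x.1 N.+1) => p [[h1 h2] h3]; by split.
rewrite inE => -[[_ h] _]; apply/clJZ/cl_munitJ.
by apply/negP => /negP; rewrite negb_or -leNgt -ltNge => /andP[h1 h2]; apply: h.
Qed.

Definition ainf_cl (x : ainf) : cclifford K := cc_mk (ainf_cl_coherent x).

End Ainf.

Section AffineLie.
Variables (K : fieldType) (l : nat).

(* gl_l[t, t^-1]: f stands for the finite sum of the f n (x) t^n. *)
Definition is_loop (f : int -> 'M[K]_l) : bool :=
  `[< exists N : nat, forall n, (N < `|n|)%N -> f n = 0 >].

Record loop := Loop { loop_coef :> int -> 'M[K]_l; _ : is_loop loop_coef }.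
HB.instance Definition _ := [isSub for loop_coef].
HB.instance Definition _ := [Choice of loop by <:].

Fact is_loop_closed : submod_closed is_loop.
Proof.
split; first by apply/asboolP; exists 0%N.
move=> a f g /asboolP[N hN] /asboolP[N' hN']; apply/asboolP.
exists (N + N')%N => n h; rewrite /GRing.add /= /GRing.scale /=.
by rewrite hN ?hN'; [rewrite scaler0 addr0|lia..].
Qed.
HB.instance Definition _ := GRing.isSubmodClosed.Build K (int -> 'M[K]_l) is_loop
  is_loop_closed.
HB.instance Definition _ := [SubChoice_isSubLmodule of loop by <:].

Lemma loop_bound (f : loop) : exists N : nat, forall n, (N < `|n|)%N -> f n = 0.
Proof. by case: f => f /= /asboolP. Qed.

Fact loop_mono_subproof (X : 'M[K]_l) (m : int) :
  is_loop (fun n => if n == m then X else 0).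
Proof.
by apply/asboolP; exists `|m|%N => n h; case: eqP => // e; move: h; rewrite e ltnn.
Qed.
(* X (x) t^m. *)
Definition loop_mono X m : loop := Loop (loop_mono_subproof X m).

Fact loop_bracket_subproof (f g : loop) :
  is_loop (fun p => \sum_(n \in [set: int]) (f n *m g (p - n) - g (p - n) *m f n)).
Proof.
have [N hN] := loop_bound f; have [N' hN'] := loop_bound g.
apply/asboolP; exists (N + N')%N => p h; apply: fsbig1 => n _.
have [h1|h1] := leqP `|n| N; last by rewrite hN // mul0mx mulmx0 subrr.
by rewrite hN' ?mulmx0 ?mul0mx ?subrr //; lia.
Qed.
Definition loop_bracket (f g : loop) : loop := Loop (loop_bracket_subproof f g).

Fact loop_deriv_subproof (f : loop) : is_loop (fun n => n%:~R *: f n).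
Proof.
by have [N hN] := loop_bound f; apply/asboolP; exists N => n /hN->; rewrite scaler0.
Qed.
(* ad d, that is, t d/dt. *)
Definition loop_deriv (f : loop) : loop := Loop (loop_deriv_subproof f).

(* The second component is the coefficient of c. *)
Definition glhat' := (loop * K^o)%type.
HB.instance Definition _ := GRing.Lmodule.on glhat'.

Definition glhat'_c : glhat' := (0, 1).

Definition glhat'_bracket (x y : glhat') : glhat' :=
  (loop_bracket x.1 y.1,
   \sum_(n \in [set: int]) n%:~R * \tr (x.1 n *m y.1 (- n))).

(* The second component is the coefficient of d. *)
Definition glhat := (glhat' * K^o)%type.
HB.instance Definition _ := GRing.Lmodule.on glhat.

Definition glhat_d : glhat := (0, 1).

Definition glhat_bracket (x y : glhat) : glhat :=
  (glhat'_bracket x.1 y.1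
     + ((x.2 : K) *: loop_deriv y.1.1 - (y.2 : K) *: loop_deriv x.1.1, 0), 0).

Record slhat' := SlHat {
  slhat'_val :> glhat';
  slhat'_tr0 : forall n, \tr (slhat'_val.1 n) = 0 }.

(* The sum over k of the E_{i-1/2+kl, j-1/2+kl+ml}; i and j are counted from 0
   here, so that the half-integer i-1/2+kl is encoded by i + k * l. *)
Fact shift_band_subproof (i j : 'I_l) (m : int) :
  is_band (fun p q => \sum_(k \in [set: int])
    munit K (i%:Z + k * l%:Z) (j%:Z + k * l%:Z + m * l%:Z) p q).
Proof.
apply/asboolP; exists (absz (i%:Z - j%:Z - m * l%:Z)%R) => p q h; apply: fsbig1 => k _.
rewrite /munit; case: eqP => //= h1; case: eqP => //= h2.
by move: h; rewrite h1 h2; lia.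
Qed.
Definition ainf_shift (i j : 'I_l) (m : int) : ainf K :=
  (BandMx (shift_band_subproof i j m), 0).

Definition slhat'_act (x : slhat') (v : fock K) : fock K :=
  cc_act (ainf_cl (\sum_(m \in [set: int]) \sum_(i < l) \sum_(j < l)
            ((slhat'_val x).1 m) i j *: ainf_shift i j m)) v
  + ((slhat'_val x).2 : K) *: v.

End AffineLie.

Definition is_nat_partition (s : seq nat) : bool := sorted geq s && (0%N \notin s).
Record nat_partition := NatPartition { parts :> seq nat; _ : is_nat_partition parts }.

Lemma nat_partition_le (la : nat_partition) k : (nth 0 la k.+1 <= nth 0 la k)%N.
Proof.
case: la => s /= /andP[hs _]; have [h|h] := ltnP k.+1 (size s).
  exact: (sortedP 0%N hs).
by rewrite nth_default.
Qed.

Fact wedge_of_subproof (la : nat_partition) (h : int) :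
  is_wedge (fun k => (nth 0%N la k)%:Z + h - k%:Z - 1).
Proof.
apply/asboolP; split => [k|]; first by have := nat_partition_le la k; lia.
by exists (size la) => k hk; rewrite !nth_default; lia.
Qed.
Definition wedge_of la h : wedge := Wedge (wedge_of_subproof la h).

Definition ket (K : fieldType) (la : nat_partition) (h : int) : fock K :=
  wvec K (wedge_of la h).

Definition fock_charge (K : fieldType) (h : int) : set (fock K) :=
  [set v | exists s : seq (K * nat_partition),
     v = \sum_(p <- s) p.1 *: ket K p.2 h]%classic.
Arguments fock_charge : clear implicits.

(* Rows and columns are counted from 0; this does not change s - r. *)
Definition box_color (l : nat) (h : int) (r s : nat) : int :=
  ((h + s%:Z - r%:Z) %% l%:Z)%Z.

(* The number of boxes of color 0 of la in charge h.  X_{i,j} (x) t^n moves a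
   factor from j-1/2+(k+n)l to i-1/2+kl, hence lowers this number by n; so an
   operator d with [d, X (x) t^n] = n X (x) t^n acts by minus this number. *)
Definition num_c0 (l : nat) (h : int) (la : nat_partition) : nat :=
  \sum_(r < size la) \sum_(s < nth 0 la r) (box_color l h r s == 0).

Section Rep.
Variable K : fieldType.

Definition lie_embedding (L M : lmodType K) (brL : L -> L -> L) (brM : M -> M -> M)
    (f : L -> M) : Prop :=
  [/\ linear f, injective f & forall x y, f (brL x y) = brM (f x) (f y)].

Definition commutator (A : algType K) (x y : A) : A := x * y - y * x.

Definition lie_rep (L : lmodType K) (br : L -> L -> L) (V : lmodType K)
    (rho : L -> V -> V) : Prop :=
  [/\ forall x, linear (rho x), forall v, linear (rho^~ v) &
      forall x y v, rho (br x y) v = rho x (rho y v) - rho y (rho x v)].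

Definition invariant_under (L V : Type) (rho : L -> V -> V) (W : set V) : Prop :=
  forall x v, W v -> W (rho x v).

Definition subspace (V : lmodType K) (W : set V) : Prop :=
  W 0 /\ forall a u v, W u -> W v -> W (a *: u + v).

Definition irreducible_on (L V : lmodType K) (rho : L -> V -> V) (U : set V) : Prop :=
  (exists2 v, U v & v != 0) /\
  forall W : set V, subspace W -> (W `<=` U)%classic -> invariant_under rho W ->
    W = [set 0]%classic \/ W = U.

End Rep.

(* Main.v *)
(* The image of a loop f is the matrix whose (p, q) entry is the (p mod l, q mod l)
   entry of f (floor(q/l) - floor(p/l)); being periodic along the diagonal, it is a
   band matrix.  Modulo J_N an element of a_infinity is a finite combination of
   the elements E_{i,j} of the Clifford algebra over a large square, so brackets are
   computed by finite sums.

   The operator of a band matrix A satisfies [A, psi_m] = sum_p A_{p,m} psi_p, so the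
   diagonal matrices act on |la,h> by scalars.  The identity matrix measures the
   charge, which is therefore preserved; the matrix with entries floor(p/l) counts
   the boxes of color 0, up to its value on the vacuum of the same charge.

   Irreducibility already holds for the principal Heisenberg operators
   al_n = sum_p E_{p,p+n}, which lie in the image.  Newton's identities
   n e_n = sum_k (-1)^(k-1) al_k e_{n-k} define operators with
   e_n psi_m = psi_m e_n + psi_{m-1} e_{n-1} that kill |la,h> when la has less than n
   rows and remove its first column when it has n rows.  Applying e_r to a nonzero
   vector, with r its largest number of rows, shortens all first rows, so a nonzero
   submodule contains the vacuum.  For the form with orthonormal basis |la,h> the
   transpose of al_n is al_{-n}; the transpose of e_n maps la without its first
   column to la plus partitions of the same size with more rows, so the vacuum
   generates everything. *)

From HB Require Import structures.
Require Import Defs.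
From mathcomp Require Import all_boot all_order all_algebra.
From mathcomp Require Import finmap monalg.
From mathcomp Require Import boolp classical_sets functions fsbigop zify ring.
From mathcomp Require Import reals complex.

Set Implicit Arguments.
Unset Strict Implicit.
Unset Printing Implicit Defensive.

Import Order.TTheory GRing.Theory Num.Theory.
Local Open Scope ring_scope.

(** * Finite index windows and finitely supported sums *)

Definition window (L : nat) : seq int := [seq i%:Z - L%:Z | i <- iota 0 (L + L)].

Lemma mem_window L (m : int) : (m \in window L) = (- L%:Z <= m < L%:Z).
Proof.
apply/mapP/idP => [[k] | h]; first by rewrite mem_iota => ? ->; lia.
by exists (absz (m + L%:Z)); rewrite ?mem_iota; lia.
Qed.

Lemma window_uniq L : uniq (window L).
Proof. by rewrite map_inj_uniq ?iota_uniq // => i j; lia. Qed.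

Lemma fsum_seq (V : nmodType) (I : choiceType) (s : seq I) (P : pred I) (F : I -> V) :
  uniq s -> (forall i, P i -> i \notin s -> F i = 0) ->
  \sum_(i \in [set i | P i]%classic) F i = \sum_(i <- s | P i) F i.
Proof. by move=> us h; rewrite (bigfs _ us h). Qed.

Lemma fsumT_seq (V : nmodType) (I : choiceType) (s : seq I) (F : I -> V) :
  uniq s -> (forall i, i \notin s -> F i = 0) ->
  \sum_(i \in [set: I]%classic) F i = \sum_(i <- s) F i.
Proof.
move=> us h; rewrite (bigfs (P := predT) _ us) => [|i _ /h//].
by congr (\big[_/_]_(_ \in _) _); apply/seteqP.
Qed.

Lemma big_delta_seq (V : nmodType) (I : eqType) (s : seq I) (j : I) (F : I -> V) :
  uniq s -> \sum_(i <- s | i == j) F i = if j \in s then F j else 0.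
Proof.
move=> us; case: ifP => hj; last first.
  by rewrite big1_seq // => i /andP[/eqP-> ]; rewrite hj.
by rewrite -big_filter filter_pred1_uniq // big_seq1.
Qed.

(** * The embedding of a_infinity into the completed Clifford algebra *)

Section FiniteSquares.
Variable K : fieldType.
Local Notation clifford := (clifford K).
Local Notation psi := (psi K).
Local Notation psis := (psis K).

(** The subtracted scalar is the expectation of [psi i * psis j] on the charge-zero vacuum, so both
    cases of the normal ordering fit one formula. *)
Lemma cl_munitE i j :
  cl_munit K i j = psi i * psis j - ((i == j) && (i < 0))%:R.
Proof.
rewrite /cl_munit; case: (eqVneq i j) => [->|] /=; last by rewrite subr0.
case: (ltrP j 0) => h; rewrite ?subr0 //.
by have := psi_psis K j j; rewrite eqxx => <-; rewrite opprD addrA subrr add0r.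
Qed.

Lemma psis_psiE i j : psis j * psi i = (i == j)%:R - psi i * psis j.
Proof. by rewrite -(psi_psis K i j) addrAC subrr add0r. Qed.

Lemma psi_psiN i j : psi i * psi j = - (psi j * psi i).
Proof. by apply/eqP; rewrite -addr_eq0 psi_psi. Qed.

Lemma psis_psisN i j : psis i * psis j = - (psis j * psis i).
Proof. by apply/eqP; rewrite -addr_eq0 psis_psis. Qed.

Lemma munit_psi i j m :
  cl_munit K i j * psi m = psi m * cl_munit K i j + (j == m)%:R *: psi i.
Proof.
rewrite !cl_munitE mulrBl mulrBr -mulrA psis_psiE mulrBr !mulrA (psi_psiN i m).
rewrite -(commr_nat (psi m)) mulNr opprK.
by rewrite !mulr_natr scaler_nat (eq_sym m) -addrA addrC.
Qed.

Lemma munit_psis i j m :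
  cl_munit K i j * psis m = psis m * cl_munit K i j - (i == m)%:R *: psis j.
Proof.
rewrite !cl_munitE mulrBl mulrBr -mulrA psis_psisN mulrN mulrA.
rewrite -(commr_nat (psis m)) mulrA psis_psiE mulrBl scaler_nat mulr_natl.
by rewrite [RHS]addrAC [_ - psi i * _ * _]addrC addrK.
Qed.

(** The commutator is a derivation on [psi k * psis m]. Putting the two resulting quadratic terms
    back into normal order leaves the difference of their scalars, which is the cocycle. *)
Lemma munit_comm i j k m :
  cl_munit K i j * cl_munit K k m - cl_munit K k m * cl_munit K i j =
  (j == k)%:R *: cl_munit K i m - (m == i)%:R *: cl_munit K k j
  + ((j == k)%:R * (m == i)%:R * ((0 <= j)%R%:R - (0 <= i)%R%:R)) *: 1.
Proof.
have -> : cl_munit K i j * cl_munit K k m - cl_munit K k m * cl_munit K i j =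
    cl_munit K i j * (psi k * psis m) - psi k * psis m * cl_munit K i j.
  by rewrite (cl_munitE k m) mulrBr mulrBl commr_nat opprB addrA subrK.
rewrite mulrA munit_psi mulrDl -!mulrA munit_psis mulrBr.
set a := psi k * _; rewrite -addrA [a - _ + _]addrC addrA.
rewrite subrK -scalerAr -scalerAl (eq_sym i) !cl_munitE.
case: (eqVneq j k) => [->|_]; case: (eqVneq m i) => [->|_];
  rewrite ?eqxx ?mulr1 ?mul1r ?mulr0 ?mul0r ?scale0r ?scale1r ?addr0 ?subr0 ?add0r //=.
rewrite !ltNge scalerBl; do 2 case: (0 <= _) => /=;
  rewrite ?scale1r ?scale0r ?subr0 ?sub0r ?addr0 // ?opprB.
- by rewrite subrr addr0.
- by rewrite addrAC subrK.
- by rewrite addrAC addrA subrK.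
- by rewrite addrA subrK.
Qed.

Definition square_cl (A : int -> int -> K) (L : nat) : clifford :=
  \sum_(i <- window L) \sum_(j <- window L) A i j *: cl_munit K i j.

Lemma clJ_sum N (I : Type) (s : seq I) (P : pred I) (F : I -> clifford) :
  (forall i, P i -> clJ N (F i)) -> clJ N (\sum_(i <- s | P i) F i).
Proof. by move=> h; elim/big_ind: _ => //; [exact: clJ0 | exact: clJD]. Qed.

(** The band of width [k] puts every nonzero entry with [-N <= i] and [j < N] inside the square of
    size [N + k]; all other entries of a larger square contribute elements of [J_N]. *)
Lemma ainf_cl_seq_square (x : ainf K) N : exists L0, forall L, (L0 <= L)%N ->
  eqJ N (ainf_cl_seq x N) (square_cl x.1 L + (x.2 : K)%:A).
Proof.
have [k hk] := band_bound x.1; exists (N + k)%N => L hL.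
rewrite /ainf_cl_seq; apply: eqJD (eqJ_refl _ _).
pose s := [seq (i, j) | i <- window L, j <- window L].
have us : uniq s by apply: allpairs_uniq => [||[? ?] [? ?]]; rewrite ?window_uniq.
pose P (p : int * int) := (- N%:Z <= p.1) && (p.2 < N%:Z).
have -> : ainf_box N = [set p | P p]%classic.
  by apply/seteqP; split=> p /= => [[h1 h2]|/andP[]]; rewrite /P ?h1.
rewrite (fsum_seq us) => [|[i j] /andP[/= hi hj] hs]; last first.
  rewrite hk ?scale0r // ltnNge; apply: contra hs => hij.
  by apply/allpairsP; exists (i, j); rewrite /= !mem_window; split=> //; lia.
have -> : square_cl x.1 L = \sum_(p <- s) (x.1 p.1 p.2 : K) *: cl_munit K p.1 p.2.
  by rewrite big_allpairs.
rewrite [X in eqJ _ _ X](bigID P) /eqJ opprD addrA subrr sub0r.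
apply/clJN/clJ_sum => -[i j]; rewrite negb_and -leNgt -ltNge => h.
exact/clJZ/cl_munitJ.
Qed.

Lemma comm_sums (A : pzRingType) (I J : Type) (r : seq I) (s : seq J)
    (F : I -> A) (G : J -> A) :
  (\sum_(i <- r) F i) * (\sum_(j <- s) G j) - (\sum_(j <- s) G j) * (\sum_(i <- r) F i)
  = \sum_(i <- r) \sum_(j <- s) (F i * G j - G j * F i).
Proof.
rewrite !mulr_suml; under eq_bigr do rewrite mulr_sumr.
under [X in _ - X]eq_bigr do rewrite mulr_sumr.
rewrite [X in _ - X]exchange_big -sumrB; apply: eq_bigr => i _.
by rewrite -sumrB.
Qed.

Lemma sum_delta_scale (V : lmodType K) L j (F : int -> V) : j \in window L ->
  \sum_(i <- window L) (i == j)%:R *: F i = F j.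
Proof.
move=> h; have := big_delta_seq j F (window_uniq L); rewrite h => <-.
rewrite [RHS]big_mkcond; by apply: eq_bigr => i _; case: eqP; rewrite ?scale1r ?scale0r.
Qed.

Definition window_mul (A B : int -> int -> K) L i m : K :=
  \sum_(j <- window L) A i j * B j m.

Definition window_cocycle (A B : int -> int -> K) L : K :=
  \sum_(i <- window L) \sum_(j <- window L)
    A i j * B j i * ((0 <= j)%R%:R - (0 <= i)%R%:R).

(** The fourfold sum of commutators of matrix units collapses along its Kronecker deltas; where two
    deltas meet, the scalar [window_cocycle] is left. *)
Lemma square_comm A B L :
  square_cl A L * square_cl B L - square_cl B L * square_cl A L =
  square_cl (fun i m => window_mul A B L i m - window_mul B A L i m) L
  + (window_cocycle A B L)%:A.
Proof.
rewrite /square_cl comm_sums.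
have -> : \sum_(i <- window L) \sum_(k <- window L)
    ((\sum_(j <- window L) A i j *: cl_munit K i j) *
     (\sum_(m <- window L) B k m *: cl_munit K k m) -
     (\sum_(m <- window L) B k m *: cl_munit K k m) *
     (\sum_(j <- window L) A i j *: cl_munit K i j)) =
   \sum_(i <- window L) \sum_(k <- window L) \sum_(j <- window L) \sum_(m <- window L)
    ((j == k)%:R *: ((A i j * B k m) *: cl_munit K i m)
     - (m == i)%:R *: ((A i j * B k m) *: cl_munit K k j)
     + (m == i)%:R *: ((j == k)%:R *:
        (A i j * B k m * ((0 <= j)%R%:R - (0 <= i)%R%:R))%:A)).
  apply: eq_bigr => i _; apply: eq_bigr => k _; rewrite comm_sums.
  apply: eq_bigr => j _; apply: eq_bigr => m _.
  rewrite -!scalerAl -!scalerAr !scalerA [B k m * _]mulrC -scalerBr munit_comm.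
  rewrite !scalerDr !scalerN !scalerA; congr (_ *: _ - _ *: _ + _ *: _).
  - exact: mulrC.
  - exact: mulrC.
  - by rewrite mulrCA mulrA [(_ == _)%:R * _]mulrC -!mulrA mulrCA.
transitivity (\sum_(i <- window L) \sum_(k <- window L)
    (\sum_(m <- window L) (A i k * B k m) *: cl_munit K i m
     - \sum_(j <- window L) (A i j * B k i) *: cl_munit K k j
     + (A i k * B k i * ((0 <= k)%R%:R - (0 <= i)%R%:R))%:A)).
  apply: eq_big_seq => i hi; apply: eq_big_seq => k hk.
  under eq_bigr do rewrite big_split sumrB /= -scaler_sumr sum_delta_scale //
    sum_delta_scale //.
  by rewrite big_split sumrB /= !sum_delta_scale.
under eq_bigr do rewrite big_split sumrB /=.
rewrite big_split sumrB /=; congr (_ + _); last first.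
  rewrite /window_cocycle scaler_suml; apply: eq_bigr => i _.
  by rewrite scaler_suml.
under [RHS]eq_bigr do under eq_bigr do rewrite scalerBl.
under [RHS]eq_bigr do rewrite sumrB; rewrite sumrB; congr (_ - _).
  apply: eq_bigr => i _; rewrite exchange_big; apply: eq_bigr => j _.
  by rewrite /window_mul scaler_suml.
rewrite exchange_big; apply: eq_bigr => i _; rewrite exchange_big.
apply: eq_bigr => j _; rewrite /window_mul scaler_suml; apply: eq_bigr => k _.
by rewrite mulrC.
Qed.

Lemma ainf_cl_rep (x : ainf K) N : exists L0, forall L, (L0 <= L)%N ->
  eqJ N (cc_rep (ainf_cl x) N) (square_cl x.1 L + (x.2 : K)%:A).
Proof.
have [L0 h] := ainf_cl_seq_square x N; exists L0 => L /h.
exact/eqJ_trans/cc_mkE.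
Qed.

(** Only these entries matter modulo [J_N]. For them, an intermediate index outside the window is
    too far from [i] on the left, or from [m] on the right, for the bands. *)
Lemma window_mulE (A B : bandmx K) N : exists L0, forall L, (L0 <= L)%N ->
  forall i m, - N%:Z <= i -> m < N%:Z -> band_mul A B i m = window_mul A B L i m.
Proof.
have [k hk] := band_bound A; have [k' hk'] := band_bound B.
exists (N + k + k').+1 => L hL i m hi hm; apply: fsumT_seq (window_uniq L) _ => j.
rewrite mem_window => hj; case: (ltP j 0) => h.
  by rewrite hk ?mul0r //; lia.
by rewrite hk' ?mulr0 //; lia.
Qed.

(** A contributing pair has indices on opposite sides of zero, hence both within the band width of
    zero. The difference of the two indicators is the sign that tells the two sums apart. *)
Lemma window_cocycleE (x y : ainf K) : exists L0, forall L, (L0 <= L)%N ->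
  (ainf_bracket x y).2 = window_cocycle x.1 y.1 L.
Proof.
have [k hk] := band_bound x.1; exists k => L hL /=.
pose s := [seq (i, j) | i <- window L, j <- window L].
have us : uniq s by apply: allpairs_uniq => [||[? ?] [? ?]]; rewrite ?window_uniq.
pose F (p : int * int) := x.1 p.1 p.2 * y.1 p.2 p.1.
rewrite !(fsum_seq (F := F) us) /F.
- rewrite /window_cocycle 2!(big_mkcond _ F) -sumrB big_allpairs.
  apply: eq_bigr => i _; apply: eq_bigr => j _ /=; rewrite !ltNge.
  do 2 case: (0 <= _); rewrite /= ?subrr ?mulr0 ?subr0 ?mulr1 //.
  by rewrite !sub0r mulrN mulr1.
- case=> i j /= h hs; rewrite hk ?mul0r // ltnNge; apply: contra hs => hij.
  by apply/allpairsP; exists (i, j); rewrite /= !mem_window; split=> //; lia.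
- case=> i j /= h hs; rewrite hk ?mul0r // ltnNge; apply: contra hs => hij.
  by apply/allpairsP; exists (i, j); rewrite /= !mem_window; split=> //; lia.
Qed.

(** Right multiplication by a representative of [Y] need not preserve [J_N], but it carries [J_M]
    into [J_N] for large [M]. *)
Lemma cc_rep_mul (X Y : cclifford K) N : exists2 M, (N <= M)%N & forall a b,
  eqJ M a (cc_rep X M) -> eqJ M b (cc_rep Y M) -> eqJ N (cc_rep (X * Y) N) (a * b).
Proof.
exists (N + cc_ord (cc_rep Y N) N)%N => [|a b ha hb]; first lia.
apply: cc_mulE ha _; first lia.
by apply: eqJ_trans (cc_rep_le _ (leq_addr _ _)); apply: eqJS hb; apply: leq_addr.
Qed.

Lemma cc_repD (X Y : cclifford K) N : eqJ N (cc_rep (X + Y) N) (cc_rep X N + cc_rep Y N).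
Proof. exact: cc_mkE. Qed.

Lemma cc_repZ a (X : cclifford K) N : eqJ N (cc_rep (a *: X) N) (a *: cc_rep X N).
Proof. exact: cc_mkE. Qed.

Lemma cc_repN (X : cclifford K) N : eqJ N (cc_rep (- X) N) (- cc_rep X N).
Proof. by rewrite -!scaleN1r; exact: cc_repZ. Qed.

Lemma commutator_scalar (A : algType K) (a b : A) (z z' : K) :
  (a + z%:A) * (b + z'%:A) - (b + z'%:A) * (a + z%:A) = a * b - b * a.
Proof.
have h (x y : A) (t : K) : (x + t%:A) * y - y * (x + t%:A) = x * y - y * x.
  by rewrite mulrDl mulrDr -scalerAl -scalerAr mul1r mulr1 opprD addrACA subrr addr0.
by rewrite h -[LHS]opprB h opprB.
Qed.

(** Modulo [J_N], and modulo the deeper ideals that the products require, every element becomes a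
    square of one common size [L]. There [square_comm] applies, and its central term is already the
    exact cocycle. *)
Lemma ainf_cl_bracket (x y : ainf K) :
  ainf_cl (ainf_bracket x y) = commutator (ainf_cl x) (ainf_cl y).
Proof.
apply: cc_eqP => N.
have [M1 le1 h1] := cc_rep_mul (ainf_cl x) (ainf_cl y) N.
have [M2 le2 h2] := cc_rep_mul (ainf_cl y) (ainf_cl x) N.
have [L1 hx1] := ainf_cl_rep x M1; have [L2 hx2] := ainf_cl_rep x M2.
have [L3 hy1] := ainf_cl_rep y M1; have [L4 hy2] := ainf_cl_rep y M2.
have [L5 hc] := window_cocycleE x y; have [L6 hxy] := ainf_cl_rep (ainf_bracket x y) N.
have [L7 hm] := window_mulE x.1 y.1 N; have [L8 hm'] := window_mulE y.1 x.1 N.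
pose L := (L1 + L2 + L3 + L4 + L5 + L6 + L7 + L8)%N.
have {hxy} := hxy L; have {hc} := hc L; have {hm} := hm L; have {hm'} := hm' L.
have {h1} := h1 _ _ (eqJ_sym (hx1 L _)) (eqJ_sym (hy1 L _)).
have {h2} := h2 _ _ (eqJ_sym (hy2 L _)) (eqJ_sym (hx2 L _)).
have [le_1 le_2 le_3 le_4] : [/\ L1 <= L, L2 <= L, L3 <= L & L4 <= L]%N.
  by rewrite /L; split; lia.
have [le_5 le_6 le_7 le_8] : [/\ L5 <= L, L6 <= L, L7 <= L & L8 <= L]%N.
  by rewrite /L; split; lia.
move=> /(_ le_4 le_2) h2 /(_ le_1 le_3) h1 /(_ le_8) hm' /(_ le_7) hm /(_ le_5) hc.
move=> /(_ le_6) hxy.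
apply: eqJ_trans hxy _; apply/eqJ_sym.
apply: eqJ_trans (cc_repD _ _ _) _; apply: eqJ_trans (eqJD h1 (cc_repN _ _)) _.
have {}h2 : eqJ N (- cc_rep (ainf_cl y * ainf_cl x) N)
   (- ((square_cl y.1 L + (y.2 : K)%:A) * (square_cl x.1 L + (x.2 : K)%:A))).
  by rewrite -!scaleN1r; apply: eqJZ.
apply: eqJ_trans (eqJD (eqJ_refl _ _) h2) _.
have -> : (square_cl x.1 L + (x.2 : K)%:A) * (square_cl y.1 L + (y.2 : K)%:A)
   - (square_cl y.1 L + (y.2 : K)%:A) * (square_cl x.1 L + (x.2 : K)%:A)
   = square_cl x.1 L * square_cl y.1 L - square_cl y.1 L * square_cl x.1 L.
  exact: commutator_scalar.
rewrite square_comm -hc; apply: eqJD (eqJ_refl _ _).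
rewrite /eqJ /square_cl -sumrB; apply: clJ_sum => i _; rewrite -sumrB.
apply: clJ_sum => m _; rewrite -scalerBl.
(* The truncated matrix product may be wrong for [i < -N] or [N <= m], but there the matrix unit
   lies in [J_N]. *)
have [him|him] := boolP ((i < - N%:Z) || (N%:Z <= m)); first exact/clJZ/cl_munitJ.
have [hi h'm] : - N%:Z <= i /\ m < N%:Z by lia.
have -> : (ainf_bracket x y).1 i m = band_mul x.1 y.1 i m - band_mul y.1 x.1 i m by [].
by rewrite hm // hm' // subrr scale0r; exact: clJ0.
Qed.

Lemma ainf_cl_linear : linear (@ainf_cl K).
Proof.
move=> a x y; apply: cc_eqP => N.
have [L1 hx] := ainf_cl_rep x N; have [L2 hy] := ainf_cl_rep y N.
have [L3 hxy] := ainf_cl_rep (a *: x + y) N.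
apply: eqJ_trans (hxy (L1 + L2 + L3)%N _) _; first lia.
apply/eqJ_sym/(eqJ_trans (cc_repD _ _ _))/(eqJ_trans (eqJD (cc_repZ _ _ _) (eqJ_refl _ _))).
apply: eqJ_trans (eqJD (eqJZ _ (hx (L1 + L2 + L3)%N _)) (hy (L1 + L2 + L3)%N _)) _; [lia..|].
rewrite scalerDr addrACA scalerA -scalerDl.
suff <- : square_cl (a *: x + y).1 (L1 + L2 + L3) =
  a *: square_cl x.1 (L1 + L2 + L3) + square_cl y.1 (L1 + L2 + L3) by exact: eqJ_refl.
rewrite scaler_sumr -big_split; apply: eq_bigr => i _.
rewrite scaler_sumr -big_split; apply: eq_bigr => j _ /=.
by rewrite scalerA -scalerDl.
Qed.

Lemma ainf_cl_c : ainf_cl (ainf_c K) = 1.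
Proof.
apply: cc_eqP => N; have [L h] := ainf_cl_rep (ainf_c K) N.
apply: eqJ_trans (h L (leqnn _)) _; rewrite /square_cl big1 => [|i _]; last first.
  by rewrite big1 // => j _; rewrite scale0r.
by rewrite add0r scale1r; apply/eqJ_sym/cc_mkE.
Qed.

End FiniteSquares.

(** * The action on Fock space *)

Section Action.
Variable K : fieldType.
Local Notation act x := (cc_act (ainf_cl x)).

(** Once [J_N] kills [v], the class modulo [J_N] determines the action, and a large square
    represents it. *)
Lemma ainf_actE (x : ainf K) v : exists L0, forall L, (L0 <= L)%N ->
  act x v = cl_act (@square_cl K x.1 L) v + (x.2 : K) *: v.
Proof.
have [N hN] := clJ_kill v; have [L0 h] := ainf_cl_rep x N; exists L0 => L /h hL.
have -> : (x.2 : K) *: v = cl_act (x.2 : K)%:A v by rewrite cl_actZ cl_act1.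
rewrite -cl_actD; apply: (cc_actE hN).
exact/cc_repE/eqJ_sym.
Qed.

Lemma ainf_actP a (x y : ainf K) v : act (a *: x + y) v = a *: act x v + act y v.
Proof. by rewrite ainf_cl_linear cc_actDl cc_actZl. Qed.

Lemma ainf_act0 v : act (0 : ainf K) v = 0.
Proof. by have := ainf_actP (-1) 0 0 v; rewrite scaler0 addr0 scaleN1r addNr. Qed.

Lemma ainf_actZ a (x : ainf K) v : act (a *: x) v = a *: act x v.
Proof. by have := ainf_actP a x 0 v; rewrite addr0 ainf_act0 addr0. Qed.

Lemma ainf_act_bracket (x y : ainf K) v :
  act (ainf_bracket x y) v = act x (act y v) - act y (act x v).
Proof.
by rewrite ainf_cl_bracket cc_actDl -scaleN1r cc_actZl scaleN1r !cc_actM.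
Qed.

Lemma cl_act_sum (I : Type) (s : seq I) (F : I -> clifford K) v :
  cl_act (\sum_(i <- s) F i) v = \sum_(i <- s) cl_act (F i) v.
Proof.
elim: s => [|i s IH]; first by rewrite !big_nil cl_act0l.
by rewrite !big_cons cl_actD IH.
Qed.

Lemma square_psi (A : int -> int -> K) L m : m \in window L ->
  square_cl A L * psi K m = psi K m * square_cl A L + \sum_(i <- window L) A i m *: psi K i.
Proof.
move=> hm; rewrite mulr_suml mulr_sumr -big_split; apply: eq_bigr => i _ /=.
rewrite mulr_suml mulr_sumr -(sum_delta_scale (fun=> A i m *: psi K i) hm).
rewrite -big_split; apply: eq_bigr => j _ /=.
rewrite -scalerAl munit_psi scalerDr -scalerAr; congr (_ + _).
by case: eqP => [->|_]; rewrite ?scale0r ?scaler0 ?scale1r.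
Qed.

Lemma act_psi_window (x : ainf K) m v : exists L0, forall L, (L0 <= L)%N ->
  act x (psi_op m v) =
  psi_op m (act x v) + \sum_(i <- window L) (x.1 i m : K) *: psi_op i v.
Proof.
have [L1 h1] := ainf_actE x v; have [L2 h2] := ainf_actE x (psi_op m v).
exists (L1 + L2 + absz m).+1 => L hL; rewrite (h1 L) ?(h2 L); [|lia..].
have hm : m \in window L by rewrite mem_window; lia.
rewrite linearD linearZ /= [RHS]addrAC; congr (_ + _).
rewrite -!cl_act_psi -!cl_actM square_psi // cl_actD; congr (_ + _).
rewrite cl_act_sum; apply: eq_bigr => i _.
by rewrite cl_actZ cl_act_psi.
Qed.

Lemma act_psi (x : ainf K) m q (a : K) v :
  (forall p, (x.1 p m : K) = if p == q then a else 0) ->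
  act x (psi_op m v) = psi_op m (act x v) + a *: psi_op q v.
Proof.
move=> hx; have [L0 h] := act_psi_window x m v.
rewrite (h (L0 + absz q).+1); last lia.
have hq : q \in window (L0 + absz q).+1 by rewrite mem_window; lia.
congr (_ + _); rewrite -[RHS](sum_delta_scale (fun q => a *: psi_op q v) hq).
apply: eq_bigr => i _.
by rewrite hx; case: eqP => _; rewrite ?scale0r ?scale1r.
Qed.

End Action.

(** * Basis vectors as iterated wedge products over a vacuum *)

Section Kets.
Variable K : fieldType.

Definition empty_partition : nat_partition := @NatPartition [::] isT.

Local Notation vac c := (wvec K (wedge_of empty_partition c)).

Fact wedge_behead_subproof (w : wedge) : is_wedge (fun k => w k.+1).
Proof.
apply/asboolP; split=> [k|]; first exact: wedge_lt.
by have [n hn] := wedge_tail w; exists n => k h; apply: hn; lia.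
Qed.
Definition wedge_behead (w : wedge) : wedge := Wedge (wedge_behead_subproof w).

Lemma psi_op_behead (w : wedge) : psi_op (w 0%N) (wvec K (wedge_behead w)) = wvec K w.
Proof.
have hp : wedge_pos (wedge_behead w) (w 0%N) = 0%N.
  apply: wedge_posE => k; rewrite ltn0; apply/esym/negbTE; rewrite -leNgt /=.
  exact: wedge_le.
have hm : wedge_mem (wedge_behead w) (w 0%N) = false.
  by rewrite /wedge_mem hp /=; apply/negbTE; have := wedge_lt w 0; lia.
rewrite psi_opE /psi_basis hm hp expr0 scale1r; congr wvec.
apply/val_inj/funext => k; rewrite /= wedge_insE ?hm // /wedge_ins_seq hp ltn0.
by case: k.
Qed.

(** Splitting off the first factor of a ket leaves a ket of charge [h - 1]. Zero entries are allowed
    in the list, since they arise when every part is lowered by one. *)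
Fixpoint psi_ket (s : seq nat) (h : int) : fock K :=
  if s is a :: s' then psi_op (a%:Z + h - 1) (psi_ket s' (h - 1)) else vac h.

Lemma psi_ketE s h (w : wedge) :
  (forall k, w k = (nth 0%N s k)%:Z + h - k%:Z - 1) -> psi_ket s h = wvec K w.
Proof.
elim: s h w => [|a s IH] h w hw /=.
  by congr wvec; apply/val_inj/funext => k; rewrite /= hw.
rewrite -psi_op_behead hw /=.
have -> : a%:Z + h - 0 - 1 = a%:Z + h - 1 by lia.
by rewrite (IH (h - 1) (wedge_behead w)) // => k; rewrite /= hw /=; lia.
Qed.

Lemma psi_ket_ket (la : nat_partition) h : psi_ket la h = ket K la h.
Proof. by apply: psi_ketE => k. Qed.

Lemma vacS c : psi_op c (vac c) = vac (c + 1).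
Proof.
have h (w : wedge) : (forall k, w k = (nth 0%N [:: 0%N] k)%:Z + (c + 1) - k%:Z - 1) ->
    psi_ket [:: 0%N] (c + 1) = wvec K w by exact: psi_ketE.
have {}h := h (wedge_of empty_partition (c + 1)).
rewrite -h; last by case=> [|[]].
by rewrite /= (_ : 0 + (c + 1) - 1 = c) ?addrK //; lia.
Qed.

End Kets.

(** * Wedges parametrised by charged partitions *)

Section Partitions.

Lemma nth_strip0 (s : seq nat) k : sorted geq s ->
  nth 0%N [seq a <- s | a != 0%N] k = nth 0%N s k.
Proof.
elim: s k => // a s IH k /= hs; case: eqP => [a0|_] /=; last first.
  by case: k => //= k; apply: IH; apply: path_sorted hs.
have h0 : all (fun b => b == 0%N) s.
  move: hs; rewrite a0 path_sortedE; last by move=> ? ? ?; lia.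
  by case/andP=> h _; apply: sub_all h => b; rewrite /= leqn0.
have -> : [seq x <- s | x != 0%N] = [::].
  by apply/eqP; rewrite -size_eq0 size_filter -leqn0 leqNgt -has_count -all_predC;
    apply: sub_all h0 => b /= ->.
rewrite nth_nil; case: k => [|k] /=; first by [].
by case: (ltnP k (size s)) => hk; [rewrite (eqP (all_nthP 0%N h0 _ hk))|rewrite nth_default].
Qed.

Fact strip0_subproof (s : seq nat) : sorted geq s ->
  is_nat_partition [seq a <- s | a != 0%N].
Proof.
move=> hs; apply/andP; split; last by rewrite mem_filter.
by apply: sorted_filter hs => ? ? ?; lia.
Qed.
Definition strip0 s (hs : sorted geq s) : nat_partition := NatPartition (strip0_subproof hs).

Lemma partition_nth_gt0 (la : nat_partition) k : (0 < nth 0%N la k)%N = (k < size la)%N.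
Proof.
case: (ltnP k (size la)) => h; last by rewrite nth_default.
case: la h => s /= /andP[_ h0] hk; rewrite lt0n; apply: contra h0 => /eqP <-.
exact: mem_nth.
Qed.

Lemma partition_eq (la mu : nat_partition) :
  (forall k, nth 0%N la k = nth 0%N mu k) -> la = mu.
Proof.
move=> h; have hs : size la = size mu.
  have hk k : (k < size la)%N = (k < size mu)%N by rewrite -!partition_nth_gt0 h.
  by have := hk (size la); have := hk (size mu); rewrite !ltnn; lia.
have : parts la = parts mu by apply: (eq_from_nth (x0 := 0%N)).
case: la mu {h hs} => [s hs] [t ht] /= e; case: t / e ht => ht.
by congr NatPartition; apply: bool_irrelevance.
Qed.

Lemma wedge_of_inj h : injective (wedge_of^~ h).
Proof.
move=> la mu e; apply: partition_eq => k.
have : wedge_of la h k = wedge_of mu h k by rewrite e.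
by move=> /=; lia.
Qed.

Lemma wedge_of_surj (w : wedge) : exists la h, w = wedge_of la h.
Proof.
have [n hn] := wedge_tail w.
have hw j : w (n + j)%N = w n - j%:Z.
  by elim: j => [|j IH]; [rewrite addn0 subr0 | rewrite addnS hn ?IH; lia].
(* With this charge the part at position [n] is zero, and so are all later ones. *)
pose h := w n + n%:Z + 1.
have pos k : 0 <= w k - h + k%:Z + 1.
  have [lt|le] := ltnP k n; last first.
    have := hw (k - n)%N; rewrite subnKC // => e; rewrite e /h. lia.
  (* Induction on the distance to [n]: the factors drop by at least one at each position, so a part
     is at least the next one. *)
  have : forall d k, (k + d = n)%N -> 0 <= w k - h + k%:Z + 1.
    elim=> [|d IH] j e; first by rewrite /h; have -> : j = n; lia.
    by have := IH j.+1; have := wedge_lt w j; lia.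
  by apply; apply: subnKC; exact: ltnW.
pose s := mkseq (fun k => absz (w k - h + k%:Z + 1)) n.
have hs : sorted geq s.
  apply/(sortedP 0%N) => k; rewrite size_mkseq => hk; rewrite !nth_mkseq; [|lia..].
  by have := wedge_lt w k; have := pos k; have := pos k.+1; rewrite /=; lia.
exists (strip0 hs), h; apply/val_inj/funext => k /=; rewrite nth_strip0 //.
have [lt|le] := ltnP k n; first by rewrite nth_mkseq //; have := pos k; lia.
rewrite nth_default ?size_mkseq //.
by have := hw (k - n)%N; rewrite subnKC // /h => ->; lia.
Qed.

End Partitions.

(** * Matrices supported on a single diagonal, and injectivity of [ainf_cl] *)

Section ShiftMatrices.
Variable K : fieldType.
Local Notation act x := (cc_act (ainf_cl x)).
Local Notation vac c := (wvec K (wedge_of empty_partition c)).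

Fact shift_ainf_subproof (f : int -> K) (n : int) :
  @is_band K (fun p q => if q == p + n then f p else 0).
Proof. by apply/asboolP; exists (absz n) => p q h; case: eqP => // e; lia. Qed.

Definition shift_ainf f n : ainf K := (BandMx (shift_ainf_subproof f n), 0).

Lemma act_shift_psi f n m v : act (shift_ainf f n) (psi_op m v) =
  psi_op m (act (shift_ainf f n) v) + f (m - n) *: psi_op (m - n) v.
Proof.
apply: act_psi => p /=; have -> : (m == p + n) = (p == m - n) by lia.
by case: eqP => [->|].
Qed.

Lemma cl_act_square (A : int -> int -> K) L v : cl_act (square_cl A L) v =
  \sum_(i <- window L) \sum_(j <- window L) A i j *: cl_act (cl_munit K i j) v.
Proof.
rewrite cl_act_sum; apply: eq_bigr => i _; rewrite cl_act_sum.
by apply: eq_bigr => j _; rewrite cl_actZ.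
Qed.

Lemma wedge_mem_vac c m : wedge_mem (wedge_of empty_partition c) m = (m < c).
Proof.
apply/wedge_memP/idP => [[k <-]|h] /=; first by rewrite nth_nil; lia.
by exists (absz (c - m - 1)%R); rewrite nth_nil; lia.
Qed.

(** [psis (i + n)] is nonzero on the vacuum only if [i + n < c]; then [e_i], with [i < i + n], is
    still a factor and [psi i] gives zero. *)
Lemma act_shift_vac f n c : 0 < n -> act (shift_ainf f n) (vac c) = 0.
Proof.
move=> hn; have [L h] := ainf_actE (shift_ainf f n) (vac c).
rewrite (h L) // scale0r addr0 cl_act_square big1 // => i _; rewrite big1 // => j _ /=.
case: eqP => [->|_]; last by rewrite scale0r.
rewrite /cl_munit; have -> : i != i + n by lia.
rewrite cl_actM cl_act_psis cl_act_psi psis_opE /psis_basis wedge_mem_vac.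
case: ifP => hc; last by rewrite linear0 scaler0.
rewrite linearZ /= psi_opE /psi_basis wedge_mem_del ?wedge_mem_vac //.
by rewrite (_ : (i < c) && (i != i + n)) ?scaler0 //; lia.
Qed.

Definition diag_ainf f : ainf K := shift_ainf f 0.

Lemma munit_diag i w : exists e : K, cl_act (cl_munit K i i) (wvec K w) = e *: wvec K w.
Proof.
rewrite cl_munitE -scaleN1r cl_actD cl_actZ eqxx /=.
have -> (b : bool) : cl_act b%:R (wvec K w) = (b%:R : K) *: wvec K w.
  by case: b; rewrite ?cl_act1 ?cl_act0l ?scale0r ?scale1r.
suff [e ->] : exists e : K, cl_act (psi K i * psis K i) (wvec K w) = e *: wvec K w.
  by eexists; rewrite scalerA -scalerDl.
rewrite cl_actM cl_act_psis cl_act_psi; case: (boolP (wedge_mem w i)) => hi.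
  (* The added term [psis i] of [psi i w], zero because [e_i] is already a factor, completes the
     anticommutator. *)
  exists 1; rewrite -[LHS]addr0 -[X in _ + X](linear0 (@psis_op K i)).
  have <- : psi_op i (wvec K w) = 0 by rewrite psi_opE /psi_basis hi.
  by rewrite psi_psis_op_anti eqxx.
by exists 0; rewrite psis_opE /psis_basis (negbTE hi) linear0 scale0r.
Qed.

Definition diag_eig f (w : wedge) : K := (act (diag_ainf f) (wvec K w))@_w.

Lemma act_diag_wvec f w : act (diag_ainf f) (wvec K w) = diag_eig f w *: wvec K w.
Proof.
suff [e he] : exists e : K, act (diag_ainf f) (wvec K w) = e *: wvec K w.
  by rewrite /diag_eig he mcoeffZ mcoeffUU mulr1.
have [L h] := ainf_actE (diag_ainf f) (wvec K w).
rewrite (h L) // scale0r addr0 cl_act_square.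
have hi i : exists e : K,
    \sum_(j <- window L) (diag_ainf f).1 i j *: cl_act (cl_munit K i j) (wvec K w) =
    e *: wvec K w.
  have [e he] := munit_diag i w.
  exists (\sum_(j <- window L) if j == i then f i * e else 0); rewrite scaler_suml.
  apply: eq_bigr => j _ /=; rewrite addr0; case: eqP => [->|_]; rewrite ?scale0r //.
  by rewrite he scalerA.
exists (\sum_(i <- window L) sval (cid (hi i))); rewrite scaler_suml.
by apply: eq_bigr => i _; case: cid.
Qed.

Lemma act_diag_coef f v w : (act (diag_ainf f) v)@_w = diag_eig f w * v@_w.
Proof.
elim/fock_ind: v => [|a w' u IH]; first by rewrite linear0 !mcoeff0 mulr0.
rewrite linearD linearZ /= act_diag_wvec !mcoeffD !mcoeffZ mcoeffU IH mulrDr.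
by congr (_ + _); case: eqP => [->|_]; [exact: mulrCA|rewrite !mulr0].
Qed.

Local Notation vace f c := (diag_eig f (wedge_of empty_partition c)).

(** The vacuum of charge [c + 1] is [psi c] applied to that of charge [c], and [psi c] raises the
    eigenvalue by [f c]. *)
Lemma diag_eig_vacS f c : vace f (c + 1) = vace f c + f c.
Proof.
have := act_diag_wvec f (wedge_of empty_partition (c + 1)).
rewrite -vacS act_shift_psi act_diag_wvec linearZ /= subr0 -scalerDl => /eqP.
rewrite -subr_eq0 -scalerBl vacS scaler_eq0 (negbTE (wvec_neq0 _ _)) orbF subr_eq0.
by move=> /eqP.
Qed.

Lemma psi_ket_cons a s h :
  psi_ket K (a :: s) h = psi_op (a%:Z + h - 1) (psi_ket K s (h - 1)).
Proof. by []. Qed.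

(** Every [psi] contributes the value of [f] at its index. Splitting off a row lowers the charge of
    the vacuum by one, and [diag_eig_vacS] turns the contribution into a difference with the same
    row of the vacuum. *)
Lemma act_diag_ket f (s : seq nat) h : act (diag_ainf f) (psi_ket K s h) =
  (vace f h + \sum_(r < size s) (f ((nth 0%N s r)%:Z + h - r%:Z - 1) - f (h - r%:Z - 1)))
  *: psi_ket K s h.
Proof.
elim: s h => [|a s IH] h; first by rewrite big_ord0 addr0 act_diag_wvec.
rewrite psi_ket_cons act_shift_psi IH linearZ [in LHS]subr0 -scalerDl; congr (_ *: _).
have := diag_eig_vacS f (h - 1); rewrite subrK => ->.
rewrite big_ord_recl [nth _ _ _]/= !subr0.
under [in RHS]eq_bigr => r _.
  rewrite lift0 [nth _ _ _]/=.
  rewrite (_ : h - r.+1%:Z - 1 = h - 1 - r%:Z - 1); last lia.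
  rewrite (_ : _ + h - r.+1%:Z - 1 = (nth 0%N s r)%:Z + (h - 1) - r%:Z - 1); last lia.
  over.
set S := \sum_(i < _) _.
rewrite -!addrA; congr (_ + _).
by rewrite [RHS]addrCA [f (h - 1) + _]addrA subrr add0r addrC.
Qed.

Lemma ainf_eqP (x y : ainf K) : (forall p q, x.1 p q = y.1 p q) -> x.2 = y.2 -> x = y.
Proof.
case: x y => [A a] [B b] /= h ->; congr pair; apply/val_inj/funext => p.
by apply/funext => q; exact: h.
Qed.

(** Already the action on Fock space is faithful. If [x] acts by zero, so does its commutator with
    [psi m]; applying [psis p] to the value on [vac p] isolates the entry in row [p] and column [m].
    What is left of [x] is a scalar. *)
Lemma ainf_cl_inj : injective (@ainf_cl K).
Proof.
suff ker (x : ainf K) : ainf_cl x = 0 -> x = 0.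
  move=> x y e; apply/eqP; rewrite -subr_eq0; apply/eqP/ker.
  by rewrite addrC -scaleN1r ainf_cl_linear e scaleN1r addNr.
move=> hx; have x0 v : act x v = 0 by rewrite hx cc_act0l.
have hA p m : x.1 p m = 0.
  have [L0 h] := act_psi_window x m (vac p).
  have {h} := h (L0 + absz p).+1; rewrite !x0 linear0 add0r => h.
  have {h} h := congr1 (@psis_op K p) (h ltac:(lia)); rewrite linear0 linear_sum in h.
  have hp : p \in window (L0 + absz p).+1 by rewrite mem_window; lia.
  have e : psis_op p (vac p) = 0 by rewrite psis_opE /psis_basis wedge_mem_vac ltxx.
  have : \sum_(i <- window (L0 + absz p).+1) (i == p)%:R *: ((x.1 i m : K) *: vac p) = 0.
    rewrite [RHS]h; apply: eq_bigr => i _; rewrite [RHS]linearZ /=.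
    have := psi_psis_op_anti p i (vac p); rewrite e linear0 add0r => ->.
    by rewrite scalerA mulrC -scalerA.
  rewrite sum_delta_scale // => /eqP.
  by rewrite scaler_eq0 (negbTE (wvec_neq0 _ _)) orbF => /eqP.
apply: ainf_eqP => //; have := x0 (vac 0); have [L h] := ainf_actE x (vac 0).
rewrite (h L) // cl_act_square big1 => [|i _]; last first.
  by rewrite big1 // => j _; rewrite hA scale0r.
rewrite add0r => /eqP; rewrite scaler_eq0 (negbTE (wvec_neq0 _ _)) orbF.
by move=> /eqP.
Qed.

End ShiftMatrices.

(** * Charge *)

Section Charge.
Variable K : numFieldType.
Local Notation act x := (cc_act (ainf_cl x)).
Local Notation vace f c := (diag_eig f (wedge_of empty_partition c)).

(** The cocycle only sees pairs of indices on opposite sides of zero, which are off the diagonal, so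
    a diagonal matrix produces no central term. *)
Lemma diag_bracketE (f : int -> K) (x : ainf K) :
  (forall p q, (ainf_bracket (diag_ainf f) x).1 p q = (f p - f q) * x.1 p q) /\
  (ainf_bracket (diag_ainf f) x).2 = 0.
Proof.
split=> [p q|].
  rewrite -[LHS]/(band_mul (diag_ainf f).1 x.1 p q - band_mul x.1 (diag_ainf f).1 p q).
  rewrite mulrBl; congr (_ - _) => /=.
    rewrite (fsumT_seq (s := [:: p])) // => [|i]; first by rewrite big_seq1 addr0 eqxx.
    by rewrite inE addr0 => /negbTE->; rewrite mul0r.
  rewrite (fsumT_seq (s := [:: q])) // => [|i].
    by rewrite big_seq1 addr0 eqxx mulrC.
  by rewrite inE addr0 eq_sym => /negbTE->; rewrite mulr0.
by rewrite /= !fsbig1 ?subrr // => -[i j] /= hij; rewrite addr0; case: eqP => [e|];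
  rewrite ?mul0r //; lia.
Qed.

Lemma act_diag_comm (f : int -> K) (x y : ainf K) v :
  (forall p q, y.1 p q = (f p - f q) * x.1 p q) -> y.2 = 0 ->
  act (diag_ainf f) (act x v) - act x (act (diag_ainf f) v) = act y v.
Proof.
move=> h1 h2; have [e1 e2] := diag_bracketE f x.
rewrite -ainf_act_bracket; congr (cc_act (ainf_cl _) _); apply: ainf_eqP => [p q|].
  by rewrite e1 h1.
by rewrite e2 h2.
Qed.

Lemma diag_eig_wedge (f : int -> K) la h : diag_eig f (wedge_of la h) =
  vace f h + \sum_(r < size la) (f ((nth 0%N la r)%:Z + h - r%:Z - 1) - f (h - r%:Z - 1)).
Proof.
have := act_diag_ket f la h; rewrite psi_ket_ket /ket act_diag_wvec => /eqP.
rewrite -subr_eq0 -scalerBl scaler_eq0 (negbTE (wvec_neq0 _ _)) orbF subr_eq0.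
by move=> /eqP.
Qed.

Local Notation one_ := (fun=> 1 : K).

Lemma charge_vac c : vace one_ c = vace one_ 0 + c%:~R.
Proof.
elim/int_ind: c => [|n IH|n IH]; first by rewrite addr0.
  by rewrite -addn1 PoszD diag_eig_vacS IH rmorphD /= addrA.
apply: (addIr 1); rewrite -(diag_eig_vacS one_ (- n.+1%:Z)).
have -> : - n.+1%:Z + 1 = - n%:Z by lia.
by rewrite IH -addrA; congr (_ + _); rewrite -[1]/(1%:~R) -rmorphD; congr (_%:~R); lia.
Qed.

Lemma charge_wedge la h : diag_eig one_ (wedge_of la h) = vace one_ 0 + h%:~R.
Proof. by rewrite diag_eig_wedge -charge_vac big1 ?addr0 // => r _; rewrite subrr. Qed.

Lemma wedge_chargeP (w : wedge) : {h | exists la, w = wedge_of la h}.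
Proof. by apply: cid; have [la [h e]] := wedge_of_surj w; exists h, la. Qed.

Definition charge (w : wedge) : int := sval (wedge_chargeP w).

(** [charge] is defined by a choice; the eigenvalue of the identity matrix, which in characteristic
    zero determines the charge, shows that the choice is forced. *)
Lemma chargeE la h : charge (wedge_of la h) = h.
Proof.
rewrite /charge; case: wedge_chargeP => /= h' [mu e].
have := charge_wedge la h; rewrite e charge_wedge => /addrI.
exact: intr_inj.
Qed.

Lemma wedge_of_charge w : exists la, w = wedge_of la (charge w).
Proof. by rewrite /charge; case: wedge_chargeP. Qed.

Lemma fock_chargeP h (v : fock K) :
  fock_charge K h v <-> (forall w, v@_w != 0 -> charge w = h).
Proof.
split=> [[s ->] w|hv].
  have [<- //|hw /eqP[]] := eqVneq (charge w) h.
  elim: s => [|p s IH]; first by rewrite big_nil mcoeff0.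
  rewrite big_cons mcoeffD mcoeffZ mcoeffU IH addr0.
  by case: eqP => [e|]; rewrite ?mulr0 //; rewrite -e chargeE eqxx in hw.
suff [s e] : exists s : seq (K * nat_partition), \sum_(w <- msupp v) v@_w *: wvec K w =
    \sum_(p <- s) p.1 *: ket K p.2 h.
  exists s; rewrite -e [LHS]monalgE; apply: eq_bigr => w _.
  by apply/malgP => k; rewrite mcoeffZ !mcoeffU mulrnAr mulr1.
have : all (fun w => v@_w != 0) (msupp v).
  by apply/allP => w; rewrite mcoeff_neq0.
elim: (msupp v : seq wedge) => [|w D IH] /=; first by exists [::]; rewrite !big_nil.
move=> /andP[/hv hw /IH[s e]]; have [la hla] := wedge_of_charge w.
by exists ((v@_w, la) :: s); rewrite !big_cons e /= {2}hla hw.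
Qed.

Lemma fock_chargeE h (v : fock K) :
  fock_charge K h v <-> act (diag_ainf one_) v = (vace one_ 0 + h%:~R) *: v.
Proof.
rewrite fock_chargeP; split=> [hv|e w hw].
  apply/malgP => w; rewrite act_diag_coef mcoeffZ.
  have [->|/hv <-] := eqVneq v@_w 0; first by rewrite !mulr0.
  by have [la {1}->] := wedge_of_charge w; rewrite charge_wedge.
have := congr1 (mcoeff w) e; rewrite act_diag_coef mcoeffZ => /(mulIf hw).
have [la {1}->] := wedge_of_charge w; rewrite charge_wedge => /addrI.
exact: intr_inj.
Qed.

(** By [diag_bracketE] the identity matrix is central in [ainf], so its eigenspaces are stable. *)
Lemma act_fock_charge (x : ainf K) h v : fock_charge K h v -> fock_charge K h (act x v).
Proof.
move=> /fock_chargeE hv; apply/fock_chargeE.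
have h0 p q : (0 : ainf K).1 p q = (1 - 1) * x.1 p q by rewrite subrr mul0r.
have := act_diag_comm v h0 erefl; rewrite hv linearZ /= => /eqP.
by rewrite ainf_act0 subr_eq0 => /eqP.
Qed.

(** Serves to shift [d] by a constant on each charge component, which normalises it on every vacuum
    and leaves commutators with the image of [ainf] unchanged. *)
Definition charge_scalar (g : int -> K) : fock K -> fock K :=
  linext (fun w => g (charge w) *: wvec K w).
HB.instance Definition _ g := GRing.Linear.copy (charge_scalar g)
  (linext (fun w => g (charge w) *: wvec K w)).

Lemma charge_scalarE g h v : fock_charge K h v -> charge_scalar g v = g h *: v.
Proof.
case=> s ->; rewrite linear_sum scaler_sumr; apply: eq_bigr => p _.
by rewrite linearZ /= [charge_scalar _ _]linext_wvec chargeE scalerA mulrC -scalerA.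
Qed.

Lemma charge_scalar_act g x v : charge_scalar g (act x v) = act x (charge_scalar g v).
Proof.
pose f1 v := charge_scalar g (act x v); pose f2 v := act x (charge_scalar g v).
apply: (@fock_linear_ext _ f1 f2) => [a u w|a u w|w]; rewrite /f1 /f2.
- by rewrite !linearP.
- by rewrite !linearP.
have hw : fock_charge K (charge w) (wvec K w).
  by have [la {2}->] := wedge_of_charge w; exists [:: (1, la)]; rewrite big_seq1 scale1r.
by rewrite (charge_scalarE _ hw) linearZ /= (charge_scalarE _ (act_fock_charge x hw)).
Qed.

End Charge.

(** * Loops as band matrices *)

Section Blocks.
Variables (l : nat) (l_gt0 : (0 < l)%N).
Local Notation quo p := (p %/ l%:Z)%Z.

Fact residue_subproof (p : int) : (absz (p %% l%:Z)%Z < l)%N.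
Proof.
have h0 : l%:Z != 0 by lia.
by have := modz_ge0 p h0; have := ltz_mod p h0; lia.
Qed.
Definition residue (p : int) : 'I_l := Ordinal (residue_subproof p).

Lemma block_eq (p : int) : p = quo p * l%:Z + (residue p)%:Z.
Proof.
have h0 : l%:Z != 0 by lia.
by rewrite /= gez0_abs ?modz_ge0 //; exact: divz_eq.
Qed.

Lemma block_quo (a : int) (i : 'I_l) : quo (a * l%:Z + i%:Z) = a.
Proof.
rewrite divzMDl; last by lia.
by rewrite divz_small ?addr0 //; have := ltn_ord i; lia.
Qed.

Lemma block_residue (a : int) (i : 'I_l) : residue (a * l%:Z + i%:Z) = i.
Proof.
apply/val_inj => /=; rewrite modzMDl modz_small //.
by have := ltn_ord i; lia.
Qed.

Lemma block_ge0 (a : int) (i : 'I_l) : (0 <= a * l%:Z + i%:Z) = (0 <= a).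
Proof. by have := ltn_ord i; nia. Qed.

Lemma quo_dist (p q : int) N : (N.+1 * l < absz (p - q)%R)%N ->
  (N < absz (quo q - quo p)%R)%N.
Proof.
have := ltn_ord (residue p); have := ltn_ord (residue q).
by have := block_eq p; have := block_eq q; nia.
Qed.

(** The window of size [M * l] is cut into the blocks of length [l] on which the quotient is
    constant. *)
Lemma sum_window_block (V : nmodType) (F : int -> V) M :
  \sum_(p <- window (M * l)) F p =
  \sum_(a <- window M) \sum_(i < l) F (a * l%:Z + i%:Z).
Proof.
rewrite -(big_allpairs (F := fun p : int * 'I_l => F (p.1 * l%:Z + p.2%:Z))) /=.
rewrite -(big_map (fun p : int * 'I_l => p.1 * l%:Z + p.2%:Z) predT F).
apply: perm_big; apply: uniq_perm; first exact: window_uniq.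
  rewrite map_inj_uniq => [|[a i] [b j] /= e].
    by apply: allpairs_uniq; [exact: window_uniq|exact: index_enum_uniq|move=> [? ?] [? ?]].
  congr pair; first by rewrite -(block_quo a i) e block_quo.
  by rewrite -(block_residue a i) e block_residue.
move=> p; rewrite mem_window; apply/idP/mapP => [hp|[[a i]]].
  exists (quo p, residue p); last exact: block_eq.
  apply/allpairsP; exists (quo p, residue p).
  split=> //=; rewrite ?mem_index_enum // mem_window.
  by have := ltn_ord (residue p); have := block_eq p; nia.
case/allpairsP => -[b j] /= [+ _ [-> ->]] ->; rewrite mem_window.
by have := ltn_ord j; nia.
Qed.

Lemma quoS (x : int) : quo (x + 1) = quo x + ((x + 1) %% l%:Z == 0)%Z.
Proof.
have e1 := block_eq x; have e2 := block_eq (x + 1).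
have -> : ((x + 1) %% l%:Z == 0)%Z = (residue (x + 1) == 0%N :> nat).
  by rewrite /=; lia.
have := ltn_ord (residue x); have := ltn_ord (residue (x + 1)).
by case: eqP => h; rewrite ?h in e2 *; nia.
Qed.

(** Lengthening a row by one box raises its wedge index by one, and the quotient jumps exactly when
    the new index is a multiple of [l]. That index is [h] plus column minus row of the new box, so
    the jumps count the boxes of color zero. *)
Lemma num_c0E (K : pzRingType) h (la : nat_partition) : (num_c0 l h la)%:R =
  \sum_(r < size la) ((quo ((nth 0%N la r)%:Z + h - r%:Z - 1))%:~R
    - (quo (h - r%:Z - 1))%:~R) :> K.
Proof.
rewrite /num_c0 natr_sum; apply: eq_bigr => r _; rewrite natr_sum.
elim: (nth 0%N la r) => [|n IH]; first by rewrite big_ord0 add0r subrr.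
rewrite big_ord_recr /= IH /box_color.
have -> : n.+1%:Z + h - r%:Z - 1 = (n%:Z + h - r%:Z - 1) + 1 by lia.
rewrite quoS rmorphD /= addrAC.
rewrite (_ : _ + h - r%:Z - 1 + 1 = h + n%:Z - r%:Z); last lia.
by case: eqP.
Qed.

End Blocks.

Section Embedding.
Variables (K : numFieldType) (l : nat) (l_gt0 : (0 < l)%N).
Local Notation quo p := (p %/ l%:Z)%Z.
Local Notation res := (residue l_gt0).
Local Notation act x := (cc_act (ainf_cl x)).

Fact loop_band_subproof (f : loop K l) :
  @is_band K (fun p q => f (quo q - quo p) (res p) (res q)).
Proof.
have [N hN] := loop_bound f; apply/asboolP; exists (N.+1 * l)%N => p q h.
by rewrite hN ?mxE //; apply: quo_dist h.
Qed.
Definition loop_band f : bandmx K := BandMx (loop_band_subproof f).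

Definition loop_ainf (x : glhat' K l) : ainf K := (loop_band x.1, x.2).

Lemma loop_ainf_linear : linear loop_ainf.
Proof. by move=> a x y; apply: ainf_eqP => // p q; rewrite /= !mxE. Qed.

Lemma loop_eqP (f g : loop K l) : (forall n i j, f n i j = g n i j) -> f = g.
Proof. by move=> h; apply/val_inj/funext => n; apply/matrixP => i j; exact: h. Qed.

(** The rows of block zero already contain every coefficient of the loop, whence injectivity. *)
Lemma loop_ainf_block f n (i j : 'I_l) : (loop_band f i%:Z (j%:Z + n * l%:Z) : K) = f n i j.
Proof.
transitivity (f (quo (n * l%:Z + j%:Z) - quo (0 * l%:Z + i%:Z))
    (res (0 * l%:Z + i%:Z)) (res (n * l%:Z + j%:Z))).
  by rewrite /= [j%:Z + _]addrC mul0r add0r.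
by rewrite !(block_quo l_gt0) !block_residue subr0.
Qed.

Lemma loop_ainf_inj : injective loop_ainf.
Proof.
move=> [f a] [g b] e; have e1 := congr1 fst e; have e2 := congr1 snd e.
rewrite /= in e1 e2; rewrite e2; congr pair; apply: loop_eqP => n i j.
by rewrite -!loop_ainf_block e1.
Qed.

Lemma fsum_shift (V : nmodType) (H : int -> V) (c : int) M :
  (forall k, (M <= absz k + absz c)%N -> H k = 0) ->
  \sum_(k \in [set: int]) H k = \sum_(a <- window M) H (a - c).
Proof.
move=> h; rewrite -(big_map (fun a => a - c) predT H); apply: fsumT_seq.
  by rewrite map_inj_uniq ?window_uniq // => a b; lia.
move=> k hk; apply: h; rewrite leqNgt; apply: contra hk => hk.
by apply/mapP; exists (k + c); rewrite ?mem_window; lia.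
Qed.

Lemma fsum_refl (V : nmodType) (H : int -> V) (c : int) M :
  (forall k, (M <= absz k + absz c)%N -> H k = 0) ->
  \sum_(k \in [set: int]) H k = \sum_(a <- window M) H (c - a).
Proof.
move=> h; rewrite -(big_map (fun a => c - a) predT H); apply: fsumT_seq.
  by rewrite map_inj_uniq ?window_uniq // => a b; lia.
move=> k hk; apply: h; rewrite leqNgt; apply: contra hk => hk.
by apply/mapP; exists (c - k); rewrite ?mem_window; lia.
Qed.

(** Over whole blocks the sum over intermediate indices groups into products of [l] by [l]
    matrices. *)
Lemma window_mul_block (f g : loop K l) M p q :
  window_mul (loop_band f) (loop_band g) (M * l) p q =
  \sum_(a <- window M) (f (a - quo p) *m g (quo q - a)) (res p) (res q).
Proof.
rewrite /window_mul (sum_window_block l_gt0); apply: eq_bigr => a _.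
by rewrite mxE; apply: eq_bigr => i _ /=; rewrite (block_quo l_gt0) (block_residue l_gt0 a i).
Qed.

(** Block multiplication is convolution of coefficients. The first product is matched by translating
    the summation index; the second by reflecting it, since there the index belongs to the right
    factor. *)
Lemma loop_bracket_band (f g : loop K l) p q :
  (loop_band (loop_bracket f g) p q : K) =
  band_mul (loop_band f) (loop_band g) p q - band_mul (loop_band g) (loop_band f) p q.
Proof.
have [N hN] := loop_bound f.
have [L1 h1] := window_mulE (loop_band f) (loop_band g) (absz p + absz q).+1.
have [L2 h2] := window_mulE (loop_band g) (loop_band f) (absz p + absz q).+1.
pose M := (L1 + L2 + N + absz (quo p) + absz (quo q)).+1.
have hM : (L1 <= M * l)%N /\ (L2 <= M * l)%N by split; rewrite /M; nia.
have hM0 (k d : int) : (M <= absz k + absz d)%N ->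
    (absz d <= absz (quo p) + absz (quo q))%N -> f k = 0.
  by rewrite /M => ? ?; apply: hN; lia.
rewrite (h1 (M * l)%N) ?(h2 (M * l)%N); [|lia..].
rewrite !window_mul_block /=; set c := quo q - quo p.
rewrite (fsum_shift (c := 0) (M := M)) => [|k hk]; last first.
  by rewrite (hM0 _ _ hk) ?mul0mx ?mulmx0 ?subrr //; lia.
rewrite sumrB mxE mxE; congr (_ - _).
  transitivity ((\sum_(a <- window M) f (a - quo p) *m g (quo q - a)) (res p) (res q)).
    congr (fun_of_matrix _ _ _).
    transitivity (\sum_(a \in [set: int]) f a *m g (c - a)).
      rewrite (fsum_shift (c := 0) (M := M)) => [|k hk] //.
      by rewrite (hM0 _ _ hk) ?mul0mx //; lia.
    rewrite (fsum_shift (c := quo p) (M := M)) => [|k hk].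
      by apply: eq_bigr => a _; congr (_ *m g _); rewrite /c; lia.
    by rewrite (hM0 _ _ hk) ?mul0mx //; lia.
  by rewrite summxE.
transitivity ((\sum_(a <- window M) g (a - quo p) *m f (quo q - a)) (res p) (res q)).
  congr (fun_of_matrix _ _ _).
  transitivity (\sum_(a \in [set: int]) g (c - a) *m f a).
    rewrite (fsum_shift (c := 0) (M := M)) => [|k hk] //.
    by rewrite (hM0 _ _ hk) ?mulmx0 //; lia.
  rewrite (fsum_refl (c := quo q) (M := M)) => [|k hk].
    by apply: eq_bigr => a _; congr (g _ *m f _); rewrite /c; lia.
  by rewrite (hM0 _ _ hk) ?mulmx0 //; lia.
by rewrite summxE.
Qed.

End Embedding.

(** Translation by [n] moves exactly [n] integers, counted with sign, across zero. This is the
    source of the factor [n] in the central term of the affine algebra. *)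
Lemma count_window (K : pzRingType) M (n : int) : (absz n <= M)%N ->
  \sum_(a <- window M) ((0 <= a + n)%R%:R - (0 <= a)%R%:R) = n%:~R :> K.
Proof.
have cnt c m : (c <= m)%N -> \sum_(i <- iota 0 m) ((c <= i)%N%:R : K) = (m - c)%N%:R.
  elim: m c => [|m IH] c; first by rewrite leqn0 => /eqP->; rewrite big_nil.
  rewrite -addn1 iotaD big_cat big_seq1 /= add0n leq_eqVlt => /orP[/eqP->|].
    rewrite subnn addn1 ltnn addr0 big1_seq // => i /andP[_]; rewrite mem_iota.
    by move=> h; rewrite (_ : (m.+1 <= i)%N = false) //; lia.
  rewrite addn1 ltnS => h; rewrite IH // h -natrD; congr (_%:R); lia.
move=> hn; rewrite sumrB /window !big_map.
have e (d : int) : (absz d <= M)%N ->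
    \sum_(i <- iota 0 (M + M)) (0 <= i%:Z - M%:Z + d)%R%:R = (M%:Z + d)%:~R :> K.
  move=> hd; rewrite (eq_bigr (fun i => (absz (M%:Z - d)%R <= i)%N%:R)) => [|i _].
    by rewrite cnt; [rewrite pmulrn; congr (_%:~R)|]; lia.
  by congr (_%:R); congr nat_of_bool; lia.
have e0 : \sum_(i <- iota 0 (M + M)) (0 <= i%:Z - M%:Z)%R%:R = M%:Z%:~R :> K.
  by rewrite -[M%:Z in RHS]addr0 -e //; apply: eq_bigr => i _; rewrite addr0.
by rewrite e // e0 rmorphD /= addrAC subrr add0r.
Qed.

(** * The central term, the matrix units and the derivation [d] under the embedding *)

Section Embedding.
Variables (K : numFieldType) (l : nat) (l_gt0 : (0 < l)%N).
Local Notation quo p := (p %/ l%:Z)%Z.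
Local Notation res := (residue l_gt0).
Local Notation act x := (cc_act (ainf_cl x)).
Local Notation phi := (@loop_ainf K l l_gt0).

Lemma window_cocycle_diff (t : int -> K) N M : (N < M)%N ->
  (forall n, (N < absz n)%N -> t n = 0) ->
  \sum_(a <- window M) \sum_(b <- window M) t (b - a) * ((0 <= b)%R%:R - (0 <= a)%R%:R)
  = \sum_(n \in [set: int]) n%:~R * t n.
Proof.
move=> lt ht; rewrite (fsumT_seq (s := window M)) ?window_uniq // => [|n]; last first.
  by rewrite mem_window => hn; rewrite ht ?mulr0 //; lia.
(* Passing from [b] to [n = b - a] shifts the window; a term lost or gained has either [t] zero or
   [a] and [b] on the same side of zero. *)
rewrite (eq_big_seq (fun a => \sum_(n <- window M) t n * ((0 <= a + n)%R%:R - (0 <= a)%R%:R))).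
  rewrite exchange_big /=; apply: eq_bigr => n _; rewrite -mulr_sumr.
  have [h|h] := leqP (absz n) N; first by rewrite count_window; [exact: mulrC|lia].
  by rewrite ht // mul0r mulr0.
move=> a; rewrite mem_window => ha.
transitivity (\sum_(b \in [set: int]) t (b - a) * ((0 <= b)%R%:R - (0 <= a)%R%:R)).
  apply/esym/fsumT_seq; first exact: window_uniq.
  move=> b; rewrite mem_window => hb; have [h|h] := leqP (absz (b - a)%R) N.
    by rewrite (_ : (0 <= b) = (0 <= a)) ?subrr ?mulr0 //; lia.
  by rewrite ht // mul0r.
rewrite (fsumT_seq (s := [seq n + a | n <- window M])).
- by rewrite big_map; apply: eq_bigr => n _; rewrite addrK [n + a]addrC.
- by rewrite map_inj_uniq ?window_uniq // => x y; lia.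
move=> b hb; rewrite ht ?mul0r // ltnNge; apply: contra hb => hb.
by apply/mapP; exists (b - a); rewrite ?mem_window; lia.
Qed.

(** The sign of a position depends only on its block. Within blocks the cocycle therefore sums to a
    trace, and [window_cocycle_diff] sums over the blocks. *)
Lemma phi_bracket (x y : glhat' K l) :
  phi (glhat'_bracket x y) = ainf_bracket (phi x) (phi y).
Proof.
apply: ainf_eqP => [p q|]; first exact: loop_bracket_band.
have [N hN] := loop_bound x.1.
have [L hL] := window_cocycleE (phi x) (phi y).
pose M := (L + N).+1; rewrite (hL (M * l)%N); last by rewrite /M; nia.
rewrite /= -(window_cocycle_diff (N := N) (M := M)); first last.
- by move=> n /hN->; rewrite mul0mx mxtrace0.
- by rewrite /M; lia.
rewrite /window_cocycle (sum_window_block l_gt0); apply: eq_bigr => a _.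
apply/esym; under [RHS]eq_bigr do rewrite /mxtrace mulr_suml.
rewrite [RHS]exchange_big; apply: eq_bigr => i _ /=.
rewrite (sum_window_block l_gt0); apply: eq_bigr => b _.
rewrite mxE mulr_suml; apply: eq_bigr => j _.
rewrite !(block_quo l_gt0) (block_residue l_gt0 a i) (block_residue l_gt0 b j).
by rewrite !(block_ge0 l_gt0) opprB.
Qed.

Lemma phi_c : phi (glhat'_c K l) = ainf_c K.
Proof. by apply: ainf_eqP => // p q; rewrite /= mxE. Qed.

Lemma ainf_shiftE (i j : 'I_l) m p q : ((ainf_shift K i j m).1 p q : K) =
  ((res p == i) && (res q == j) && (quo q - quo p == m))%:R.
Proof.
(* Only the block index of the row can contribute. *)
rewrite /= (fsumT_seq (s := [:: quo p])) // => [|k]; last first.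
  rewrite inE /munit => hk; case: eqP => //= h1.
  by case/eqP: hk; rewrite h1 [i%:Z + _]addrC (block_quo l_gt0).
rewrite big_seq1 /munit; congr (nat_of_bool _)%:R.
rewrite -andbA; congr (_ && _).
  apply/eqP/eqP => [->|<-]; last by rewrite addrC -block_eq.
  by rewrite addrC block_residue.
rewrite -addrA -mulrDl addrC; apply/eqP/andP => [->|[/eqP<- /eqP<-]].
  by rewrite (block_quo l_gt0) block_residue addrAC subrr add0r !eqxx.
by rewrite [quo p + _]addrC subrK -block_eq.
Qed.

Lemma phi_mono (i j : 'I_l) m :
  phi (loop_mono (delta_mx i j) m, 0) = ainf_shift K i j m.
Proof.
apply: ainf_eqP => // p q; rewrite [RHS]ainf_shiftE /=.
by case: eqP => _; rewrite mxE ?andbT ?andbF.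
Qed.

Lemma ainf_band_sum (I : Type) (s : seq I) (F : I -> ainf K) p q :
  ((\sum_(i <- s) F i).1 p q : K) = \sum_(i <- s) ((F i).1 p q : K).
Proof.
elim: s => [|i s IH]; first by rewrite !big_nil.
by rewrite !big_cons -IH.
Qed.

Lemma ainf_snd_sum (I : Type) (s : seq I) (F : I -> ainf K) :
  ((\sum_(i <- s) F i).2 : K) = \sum_(i <- s) ((F i).2 : K).
Proof.
elim: s => [|i s IH]; first by rewrite !big_nil.
by rewrite !big_cons -IH.
Qed.

Lemma loop_sum_shift (f : loop K l) :
  \sum_(m \in [set: int]) \sum_(i < l) \sum_(j < l) (f m i j) *: ainf_shift K i j m
  = phi (f, 0).
Proof.
have [N hN] := loop_bound f.
rewrite (fsumT_seq (s := window N.+1)) ?window_uniq // => [|m]; last first.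
  rewrite mem_window => hm; rewrite big1 // => i _; rewrite big1 // => j _.
  by rewrite hN ?mxE ?scale0r //; lia.
apply: ainf_eqP => [p q|]; last first.
  rewrite ainf_snd_sum big1 // => m _; rewrite ainf_snd_sum big1 // => i _.
  by rewrite ainf_snd_sum big1 // => j _ /=; rewrite scaler0.
rewrite [LHS]ainf_band_sum.
transitivity (\sum_(m <- window N.+1 | m == quo q - quo p) f m (res p) (res q)).
  rewrite [RHS]big_mkcond; apply: eq_bigr => m _; rewrite ainf_band_sum.
  transitivity (\sum_(i < l) \sum_(j < l)
      f m i j * ((res p == i) && (res q == j) && (quo q - quo p == m))%:R).
    apply: eq_bigr => i _; rewrite ainf_band_sum; apply: eq_bigr => j _.
    by rewrite -ainf_shiftE.
  rewrite (bigD1 (res p)) //= [X in _ + X]big1 ?addr0 => [|i /negbTE hi].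
    rewrite (bigD1 (res q)) //= [X in _ + X]big1 ?addr0 => [|j /negbTE hj].
      by rewrite !eqxx eq_sym; case: eqP => _; rewrite ?mulr1 ?mulr0.
    by rewrite eqxx eq_sym hj mulr0.
  by rewrite big1 // => j _; rewrite eq_sym hi mulr0.
rewrite big_delta_seq ?window_uniq // mem_window; case: ifP => // hm.
by rewrite /= hN ?mxE //; lia.
Qed.

Lemma act_split (x : ainf K) v : act x v = act (x.1, 0) v + (x.2 : K) *: v.
Proof.
have -> : act x v = act ((x.2 : K) *: ainf_c K + (x.1, 0)) v.
  congr (cc_act (ainf_cl _) _); case: x => A z; apply: ainf_eqP => [p q|].
    by rewrite -[RHS]/((z : K) * 0 + A p q) mulr0 add0r.
  by rewrite /= addr0; apply/esym/mulr1.
by rewrite ainf_actP ainf_cl_c cc_act1 addrC.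
Qed.

Lemma phi_slhat (x : slhat' K l) v : act (phi x) v = slhat'_act x v.
Proof. by rewrite /slhat'_act loop_sum_shift [LHS]act_split. Qed.

Fact loop_shift_subproof (n : int) :
  is_loop (fun m => \matrix_(i < l, j < l) (j%:Z + m * l%:Z == i%:Z + n)%:R : 'M[K]_l).
Proof.
apply/asboolP; exists (absz n).+1 => m hm; apply/matrixP => i j; rewrite !mxE.
by have := ltn_ord i; have := ltn_ord j; case: eqP => // e; nia.
Qed.
(** The [n]-th power of the cyclic element, which is the sum of all [X_{i,i+1}] plus [X_{l,1} t]. It
    puts the principal Heisenberg operators into the image. *)
Definition loop_shift n : loop K l := Loop (loop_shift_subproof n).

Lemma phi_shift n : phi (loop_shift n, 0) = shift_ainf (fun=> 1) n.
Proof.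
apply: ainf_eqP => // p q; rewrite /= mxE.
have -> : ((res q)%:Z + (quo q - quo p) * l%:Z == (res p)%:Z + n) = (q == p + n).
  by have := block_eq l_gt0 q; have := block_eq l_gt0 p; rewrite mulrBl; lia.
by case: eqP.
Qed.

Definition quo_diag : ainf K := diag_ainf (fun p => (quo p)%:~R).

(** The commutator with [quo_diag] multiplies an entry by the block index of its row minus that of
    its column, which is minus the exponent of [t]. *)
Lemma act_quo_diag (x : glhat' K l) v :
  act (phi x) (act quo_diag v) - act quo_diag (act (phi x) v)
  = act (phi (loop_deriv x.1, 0)) v.
Proof.
apply: oppr_inj; rewrite opprB.
have -> : - act (phi (loop_deriv x.1, 0)) v = act (- phi (loop_deriv x.1, 0)) v.
  by rewrite -[LHS]scaleN1r -ainf_actZ scaleN1r.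
apply: act_diag_comm => [p q|]; last exact: oppr0.
have -> : (- phi (loop_deriv x.1, 0)).1 p q = - (phi (loop_deriv x.1, 0)).1 p q by [].
by rewrite /= mxE -rmorphB -mulNr -rmorphN opprB.
Qed.

End Embedding.

(** * Irreducibility under the Heisenberg operators *)

Section Newton.
Variable K : numFieldType.
Local Notation op := (fock K -> fock K).
Local Notation act x := (cc_act (ainf_cl x)).
Local Notation vac c := (wvec K (wedge_of empty_partition c)).

Section Recursion.
Variables (comp : op -> op -> op) (a : nat -> op).

(** The bound [n] makes the course-of-values recursion structural; values at [k <= n] do not depend
    on it. The parameter [comp] fixes the order of composition, so that one recursion can be the
    term-by-term transpose of another. *)
Fixpoint newton_upto (n k : nat) : op :=
  if n is n'.+1 then
    if (k <= n')%N then newton_upto n' k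
    else fun v => n'.+1%:R^-1 *:
      \sum_(i < n'.+1) (-1) ^+ i *: comp (a i) (newton_upto n' (n' - i)) v
  else id.

Definition newton n := newton_upto n n.

Lemma newton_uptoE n k : (k <= n)%N -> newton_upto n k = newton k.
Proof.
elim: n => [|n IH]; first by rewrite leqn0 => /eqP->.
rewrite leq_eqVlt => /orP[/eqP->//|h]; rewrite /= ifT ?IH //.
Qed.

Lemma newtonS n v : newton n.+1 v =
  n.+1%:R^-1 *: \sum_(i < n.+1) (-1) ^+ i *: comp (a i) (newton (n - i)) v.
Proof.
rewrite /newton /= ltnn; congr (_ *: _); apply: eq_bigr => i _.
by rewrite newton_uptoE // leq_subr.
Qed.

Lemma newton_ind (P : op -> Prop) :
  P id -> (forall (c : K) (n : nat) (F : nat -> op), (forall i, (i < n)%N -> P (F i)) ->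
    P (fun v => c *: \sum_(i < n) (-1) ^+ i *: F i v)) ->
  (forall i f, P f -> P (comp (a i) f)) -> forall n, P (newton n).
Proof.
move=> P0 PS PC; elim/ltn_ind => -[|n] IH //.
have -> : newton n.+1 = fun v =>
    n.+1%:R^-1 *: \sum_(i < n.+1) (-1) ^+ i *: comp (a i) (newton (n - i)) v.
  by apply/funext => v; exact: newtonS.
by apply: (PS _ _ (fun i => comp (a i) (newton (n - i)))) => i hi; apply/PC/IH; lia.
Qed.

End Recursion.

Definition heis (n : int) : op := act (shift_ainf (fun=> 1 : K) n).
HB.instance Definition _ n := GRing.Linear.copy (heis n) (act (shift_ainf (fun=> 1 : K) n)).

(* In terms of symmetric functions, emul n multiplies by the n-th elementary
   symmetric function and estar n is its adjoint. *)
Definition estar : nat -> op := newton (fun f g => f \o g) (fun i => heis i.+1%:Z).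
Definition emul : nat -> op := newton (fun f g => g \o f) (fun i => heis (- i.+1%:Z)).

Lemma heisE n v : heis n v = act (shift_ainf (fun=> 1 : K) n) v.
Proof. by []. Qed.

Lemma heis_psi n m v : heis n (psi_op m v) = psi_op m (heis n v) + psi_op (m - n) v.
Proof. by rewrite [LHS]act_shift_psi scale1r. Qed.

Lemma heisD n u v : heis n (u + v) = heis n u + heis n v.
Proof. exact: linearD. Qed.

Lemma heisZ n (c : K) u : heis n (c *: u) = c *: heis n u.
Proof. exact: linearZ. Qed.

Lemma heis_vac n c : 0 < n -> heis n (vac c) = 0.
Proof. exact: act_shift_vac. Qed.

Lemma linear_newton_sum (c : K) n (F : nat -> op) : (forall i, (i < n)%N -> linear (F i)) ->
  linear (fun v => c *: \sum_(i < n) (-1) ^+ i *: F i v).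
Proof.
move=> h b u v; rewrite (scalerA b c) mulrC -scalerA -scalerDr; congr (_ *: _).
rewrite scaler_sumr -big_split; apply: eq_bigr => i _ /=.
by rewrite h // scalerDr !scalerA mulrC.
Qed.

Lemma estar_linear n : linear (estar n).
Proof.
apply: newton_ind => [//|c k F h|i f hf a u v]; first exact: linear_newton_sum.
by rewrite /= hf linearP.
Qed.

Lemma estarS n v : n.+1%:R *: estar n.+1 v =
  \sum_(i < n.+1) (-1) ^+ i *: heis i.+1%:Z (estar (n - i) v).
Proof.
by rewrite /estar newtonS scalerA divff ?scale1r // pnatr_eq0.
Qed.

Lemma emulS n v : n.+1%:R *: emul n.+1 v =
  \sum_(i < n.+1) (-1) ^+ i *: emul (n - i) (heis (- i.+1%:Z) v).
Proof.
by rewrite /emul newtonS scalerA divff ?scale1r // pnatr_eq0.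
Qed.

Opaque estar emul heis.

(** One wedge factor behaves like a single variable, whose elementary symmetric functions vanish
    above degree one. *)
Lemma estar_psi n m v : estar n.+1 (psi_op m v) =
  psi_op m (estar n.+1 v) + psi_op (m - 1) (estar n v).
Proof.
pose pr k := if k is k'.+1 then psi_op (m - 1) (estar k' v) else 0.
elim/ltn_ind: n => n IH.
have IH' k : (k <= n)%N -> estar k (psi_op m v) = psi_op m (estar k v) + pr k.
  by case: k => [|k] h; [rewrite addr0 | exact: IH].
have n0 : (n.+1%:R : K) != 0 by rewrite pnatr_eq0.
apply: (scalerI n0); rewrite scalerDr.
have zl k (u : fock K) : n.+1%:R *: psi_op k u = psi_op k (n.+1%:R *: u) by rewrite linearZ.
rewrite [X in _ = X + _]zl [X in _ = _ + X]zl [LHS]estarS [X in psi_op m X + _]estarS.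
transitivity (psi_op m (\sum_(i < n.+1) (-1) ^+ i *: heis i.+1%:Z (estar (n - i) v))
  + \sum_(i < n.+1) (-1) ^+ i *: psi_op (m - 1 - i%:Z) (estar (n - i) v)
  + \sum_(i < n.+1) (-1) ^+ i *: heis i.+1%:Z (pr (n - i)%N)).
  rewrite linear_sum -!big_split; apply: eq_bigr => i _ /=.
  rewrite IH' ?leq_subr // heisD heis_psi !scalerDr linearZ /=.
  by rewrite (_ : m - i.+1%:Z = m - 1 - i%:Z); last lia.
(* Of the terms with [psi (m - 1 - i)] only [i = 0] survives; each later one cancels against the
   shift that arises when [heis] passes [psi (m - 1)]. *)
rewrite -addrA; congr (_ + _); rewrite big_ord_recl /= expr0 scale1r !subr0.
rewrite [X in _ + X = _]big_ord_recr /= subnn linear0 scaler0 addr0.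
rewrite -addrA mulrS scalerDl scale1r linearD /= subn0; congr (_ + _).
rewrite -big_split /=.
(* The rest is the Newton identity one degree lower, which supplies [n] further copies. *)
have -> : n%:R *: estar n v = \sum_(i < n) (-1) ^+ i *: heis i.+1%:Z (estar (n - i.+1) v).
  case: (n) => [|k]; first by rewrite big_ord0 scale0r.
  by rewrite estarS; apply: eq_bigr => i _; rewrite subSS.
rewrite linear_sum; apply: eq_bigr => i _ /=.
have -> : bump 0 i = i.+1 by [].
have -> : (n - i = (n - i.+1).+1)%N by have := ltn_ord i; lia.
rewrite [pr _]/= heis_psi scalerDr linearZ /= addrCA exprS mulN1r scaleNr addNr.
by rewrite addr0.
Qed.

Lemma estar0 v : estar 0 v = v.
Proof. by []. Qed.

Lemma estar_vac n c : estar n.+1 (vac c) = 0.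
Proof.
elim/ltn_ind: n => n IH; have n0 : (n.+1%:R : K) != 0 by rewrite pnatr_eq0.
apply: (scalerI n0); rewrite scaler0 estarS big1 // => i _.
have [->|h] := eqVneq (n - i)%N 0%N; first by rewrite estar0 heis_vac // scaler0.
have -> : (n - i = (n - i).-1.+1)%N by lia.
by rewrite IH ?linear0 ?scaler0 //; lia.
Qed.

(** By [estar_psi] each factor absorbs at most one degree; the excess reaches the vacuum and kills
    it. *)
Lemma estar_ket0 n s h : (size s < n)%N -> estar n (psi_ket K s h) = 0.
Proof.
elim: s n h => [|a s IH] [|n] h //= hn; first exact: estar_vac.
by rewrite estar_psi !IH ?linear0 ?addr0 // ltnW.
Qed.

(** With as many degrees as rows, every row must absorb one: the term that spares the first row dies
    by [estar_ket0]. *)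
Lemma estar_ket s h : all (leq 1) s ->
  estar (size s) (psi_ket K s h) = psi_ket K [seq a.-1 | a <- s] h.
Proof.
elim: s h => [|a s IH] h //= /andP[ha hs].
rewrite estar_psi estar_ket0 // linear0 add0r.
rewrite (_ : a%:Z + h - 1 - 1 = a.-1%:Z + h - 1); last lia.
by rewrite (IH _ hs).
Qed.

End Newton.

(** * The bilinear form with orthonormal wedges, and transposed operators *)

Section Transpose.
Variable K : numFieldType.
Local Notation act x := (cc_act (ainf_cl x)).

Definition dot (u v : fock K) : K := \sum_(w <- msupp u) u@_w * v@_w.

Lemma dotEw (u v : fock K) (D : {fset wedge}) : (msupp u `<=` D)%fset ->
  dot u v = \sum_(w <- D) u@_w * v@_w.
Proof.
move=> le; rewrite /dot (big_fset_incl _ le) // => w _.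
by rewrite -mcoeff_eq0 => /eqP->; rewrite mul0r.
Qed.

Lemma dotC u v : dot u v = dot v u.
Proof.
rewrite (dotEw _ (fsubsetUl _ (msupp v))) (dotEw _ (fsubsetUr (msupp u) _)).
by apply: eq_bigr => w _; rewrite mulrC.
Qed.

Lemma dotPr a u v v' : dot u (a *: v + v') = a * dot u v + dot u v'.
Proof.
rewrite /dot mulr_sumr -big_split; apply: eq_bigr => w _ /=.
by rewrite mcoeffD mcoeffZ mulrDr mulrCA.
Qed.

Lemma dotPl a u u' v : dot (a *: u + u') v = a * dot u v + dot u' v.
Proof. by rewrite dotC dotPr !(dotC v). Qed.

Lemma dot0r u : dot u 0 = 0.
Proof. by rewrite /dot big1 // => w _; rewrite mcoeff0 mulr0. Qed.

Lemma dot0l u : dot 0 u = 0.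
Proof. by rewrite dotC dot0r. Qed.

Lemma dotDr u v v' : dot u (v + v') = dot u v + dot u v'.
Proof. by have := dotPr 1 u v v'; rewrite scale1r mul1r. Qed.

Lemma dotDl u u' v : dot (u + u') v = dot u v + dot u' v.
Proof. by rewrite dotC dotDr !(dotC v). Qed.

Lemma dotZr a u v : dot u (a *: v) = a * dot u v.
Proof. by have := dotPr a u v 0; rewrite dot0r !addr0. Qed.

Lemma dotZl a u v : dot (a *: u) v = a * dot u v.
Proof. by rewrite dotC dotZr dotC. Qed.

Lemma dot_wvec w v : dot (wvec K w) v = v@_w.
Proof.
rewrite (@dotEw _ _ [fset w]%fset) ?msuppU_le //.
by rewrite big_seq_fset1 mcoeffUU mul1r.
Qed.

Definition transposes (f g : fock K -> fock K) := forall u v, dot (f u) v = dot u (g v).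

Lemma transposes_sym f g : transposes f g -> transposes g f.
Proof. by move=> h u v; rewrite dotC -h dotC. Qed.

(** Insertion and deletion of [e_m] are inverse to each other and carry the same sign, since the
    position of [m] counts only larger factors. *)
Lemma psi_transposes m : transposes (psi_op m) (psis_op m).
Proof.
move=> u; elim/fock_ind: u => [|a w u IH] v; first by rewrite linear0 !dot0l.
rewrite linearP /= !dotPl IH; congr (_ * _ + _).
elim/fock_ind: v => [|b w' v IHv]; first by rewrite linear0 !dot0r.
rewrite linearP /= !dotPr IHv; congr (_ * _ + _) => {IHv v b}.
rewrite psi_opE psis_opE dotC !dot_wvec /psi_basis /psis_basis.
case: (boolP (wedge_mem w m)) => hm; case: (boolP (wedge_mem w' m)) => hm' //=;
  rewrite ?mcoeff0 // ?mcoeffZ ?mcoeffU.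
- case: eqP => [e|]; rewrite ?mulr0 //.
  by move: hm; rewrite -e wedge_mem_del // eqxx andbF.
- have [e|ne] := eqVneq (wedge_ins w m) w'.
    have -> : wedge_del w' m = w.
      apply: wedge_pos_inj => k; apply/eqP; rewrite -(eqn_add2r (k < m)%R).
      by rewrite -wedge_pos_del // -e wedge_pos_ins.
    by rewrite eqxx -e wedge_pos_ins // ltxx addn0.
  case: eqP => [e|_]; last by rewrite !mulr0.
  case/eqP: ne; apply: wedge_pos_inj => k.
  by rewrite wedge_pos_ins // -e -wedge_pos_del.
- case: eqP => [e|]; rewrite ?mulr0 //.
  by move: hm'; rewrite -e wedge_mem_ins // eqxx orbT.
Qed.

Lemma munit_transposes i j :
  transposes (cl_act (cl_munit K i j)) (cl_act (cl_munit K j i)).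
Proof.
move=> u v; rewrite /cl_munit eq_sym.
have -> : (j != i) || (0 <= j) = (j != i) || (0 <= i) by case: eqP => [->|].
case: ifP => [_|/negbT].
  rewrite !cl_actM !cl_act_psi !cl_act_psis psi_transposes.
  exact/transposes_sym/psi_transposes.
rewrite negb_or negbK => /andP[/eqP-> _].
have nE (x : clifford K) w : cl_act (- x) w = - cl_act x w.
  by rewrite -scaleN1r cl_actZ scaleN1r.
rewrite !nE -!scaleN1r dotZl dotZr; congr (_ * _).
rewrite !cl_actM !cl_act_psi !cl_act_psis.
by rewrite (transposes_sym (@psi_transposes i)) psi_transposes.
Qed.

Lemma dot_suml (I : Type) (s : seq I) (F : I -> fock K) v :
  dot (\sum_(i <- s) F i) v = \sum_(i <- s) dot (F i) v.
Proof.
elim: s => [|i s IH]; first by rewrite !big_nil dot0l.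
by rewrite !big_cons dotDl IH.
Qed.

Lemma dot_sumr (I : Type) (s : seq I) (F : I -> fock K) v :
  dot v (\sum_(i <- s) F i) = \sum_(i <- s) dot v (F i).
Proof. by rewrite dotC dot_suml; apply: eq_bigr => i _; rewrite dotC. Qed.

Lemma ainf_transposes (x y : ainf K) :
  (forall i j, x.1 i j = y.1 j i) -> x.2 = y.2 ->
  transposes (fun v => act x v) (fun v => act y v).
Proof.
move=> h1 h2 u v; have [L1 hx] := ainf_actE x u; have [L2 hy] := ainf_actE y v.
rewrite (hx (L1 + L2)%N) ?leq_addr // (hy (L1 + L2)%N) ?leq_addl //.
rewrite dotDl dotDr dotZl dotZr h2; congr (_ + _).
rewrite !cl_act_square dot_suml exchange_big dot_sumr; apply: eq_bigr => i _.
rewrite dot_suml dot_sumr; apply: eq_bigr => j _.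
by rewrite dotZl dotZr h1 munit_transposes.
Qed.

Lemma heis_transposes n : transposes (@heis K n) (heis (- n)).
Proof.
apply: ainf_transposes => // i j /=; have -> : (i == j - n) = (j == i + n) by lia.
by [].
Qed.

Lemma estar_emul_transposes n : transposes (@estar K n) (emul n).
Proof.
elim/ltn_ind: n => -[|n] IH //; have n0 : (n.+1%:R : K) != 0 by rewrite pnatr_eq0.
move=> u v; apply: (mulfI n0); rewrite -dotZl -dotZr estarS emulS.
rewrite dot_suml dot_sumr; apply: eq_bigr => i _; rewrite dotZl dotZr.
by rewrite heis_transposes IH // ltnS leq_subr.
Qed.

Lemma subspace_sum (W : set (fock K)) (I : Type) (s : seq I) (a : I -> K) F :
  subspace W -> (forall i, W (F i)) -> W (\sum_(i <- s) a i *: F i).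
Proof.
move=> [W0 WP] h; elim: s => [|i s IH]; first by rewrite big_nil.
by rewrite big_cons; apply: WP.
Qed.

Lemma subspaceZ (W : set (fock K)) a v : subspace W -> W v -> W (a *: v).
Proof. by move=> [W0 WP] h; rewrite -[_ *: _]addr0; apply: WP. Qed.

Lemma estar_stable (W : set (fock K)) : subspace W ->
  (forall n v, W v -> W (heis n v)) -> forall n v, W v -> W (estar n v).
Proof.
move=> sW hW n; elim/ltn_ind: n => -[|n] IH // v Wv.
have n0 : (n.+1%:R : K) != 0 by rewrite pnatr_eq0.
rewrite -[estar _ _]scale1r -(mulVf n0) -scalerA estarS.
apply: (subspaceZ _ sW); apply: (subspace_sum _ _ sW) => i; apply/hW/IH => //.
by rewrite ltnS leq_subr.
Qed.

Lemma emul_stable (W : set (fock K)) : subspace W ->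
  (forall n v, W v -> W (heis n v)) -> forall n v, W v -> W (emul n v).
Proof.
move=> sW hW n; elim/ltn_ind: n => -[|n] IH // v Wv.
have n0 : (n.+1%:R : K) != 0 by rewrite pnatr_eq0.
rewrite -[emul _ _]scale1r -(mulVf n0) -scalerA emulS.
apply: (subspaceZ _ sW); apply: (subspace_sum _ _ sW) => i; apply/IH/hW => //.
by rewrite ltnS leq_subr.
Qed.

Lemma subspace_fock_charge h : subspace (fock_charge K h).
Proof.
split; first by exists [::]; rewrite big_nil.
move=> a u v [s ->] [t ->]; exists ([seq (a * p.1, p.2) | p <- s] ++ t).
rewrite big_cat big_map scaler_sumr; congr (_ + _); apply: eq_bigr => p _ /=.
by rewrite scalerA.
Qed.

Lemma ket_fock_charge la h : fock_charge K h (ket K la h).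
Proof. by exists [:: (1, la)]; rewrite big_seq1 scale1r. Qed.

Lemma heis_fock_charge n h v : fock_charge K h v -> fock_charge K h (heis n v).
Proof. exact: act_fock_charge. Qed.

End Transpose.

(** * Removing the first column of a partition *)

Section FirstColumn.

Fact pred_partition_subproof (la : nat_partition) : sorted geq [seq a.-1 | a <- parts la].
Proof.
have : sorted geq (parts la) by case: la => s /= /andP[].
by apply: homo_sorted => a b /=; lia.
Qed.
Definition pred_partition la : nat_partition := strip0 (pred_partition_subproof la).

Lemma nth_pred_partition (la : nat_partition) k :
  nth 0%N (pred_partition la) k = (nth 0%N la k).-1.
Proof.
rewrite nth_strip0; last exact: pred_partition_subproof.
have [h|h] := ltnP k (size la); first by rewrite (nth_map 0%N).
by rewrite !nth_default ?size_map.
Qed.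

(** Rows of length one vanish together with the first column; the number of rows restores them. *)
Lemma pred_partition_inj (la mu : nat_partition) :
  size la = size mu -> pred_partition la = pred_partition mu -> la = mu.
Proof.
move=> e1 e2; apply: partition_eq => k.
have := congr1 (fun nu : nat_partition => nth 0%N nu k) e2.
rewrite !nth_pred_partition => h.
by have := partition_nth_gt0 la k; have := partition_nth_gt0 mu k; rewrite e1; lia.
Qed.

Lemma all_parts_gt0 (la : nat_partition) : all (leq 1) la.
Proof.
case: la => s /= /andP[_ h0]; apply/allP => a ha; rewrite lt0n.
by apply: contra h0 => /eqP <-.
Qed.

Lemma sumn_pred_partition (la : nat_partition) :
  sumn la = (sumn (pred_partition la) + size la)%N.
Proof.
rewrite /=; elim: (parts la) (all_parts_gt0 la) => //= a s IH /andP[ha /IH->].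
by case: eqP => /= e; lia.
Qed.

Lemma partition_empty (la : nat_partition) : size la = 0%N -> la = empty_partition.
Proof.
by move=> h; apply: partition_eq => k; rewrite !nth_default ?h.
Qed.

End FirstColumn.

(** * From a nonzero vector to the vacuum, and from the vacuum to every ket *)

Section Irreducibility.
Variable K : numFieldType.

Lemma estar_ket_col (la : nat_partition) h :
  estar (size la) (ket K la h) = ket K (pred_partition la) h.
Proof.
rewrite -psi_ket_ket (estar_ket _ _ (all_parts_gt0 la)).
apply: psi_ketE => k /=; rewrite nth_strip0 //; exact: pred_partition_subproof.
Qed.

Lemma linear_coef (f : fock K -> fock K) v x : linear f ->
  (f v)@_x = \sum_(w <- msupp v) v@_w * (f (wvec K w))@_x.
Proof.
move=> lf; have -> : f v = linext (fun w => f (wvec K w)) v.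
  apply: fock_linear_ext => [//|a y z|w]; first exact: linearP.
  by rewrite linext_wvec.
by rewrite /linext raddf_sum; apply: eq_bigr => w _; rewrite /= mcoeffZ.
Qed.

Lemma support_partition h (v : fock K) w : fock_charge K h v -> v@_w != 0 ->
  exists la, w = wedge_of la h.
Proof. by move=> /fock_chargeP hv /hv <-; exact: wedge_of_charge. Qed.

Lemma support_bound (F : nat_partition -> nat) h (v : fock K) : exists B, forall la,
  v@_(wedge_of la h) != 0 -> (F la <= B)%N.
Proof.
suff [B hB] : exists B, forall la, wedge_of la h \in (msupp v : seq wedge) -> (F la <= B)%N.
  by exists B => la hla; apply: hB; rewrite -mcoeff_neq0.
elim: (msupp v : seq wedge) => [|w s [B IH]]; first by exists 0%N.
have [[la e]|ne] := pselect (exists la, w = wedge_of la h).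
  exists (B + F la)%N => mu; rewrite inE e => /orP[/eqP/wedge_of_inj->|/IH]; lia.
exists B => mu; rewrite inE => /orP[/eqP e|/IH //].
by case: ne; exists mu.
Qed.

(** Induction on a bound [n] for the first rows in the support of [v]. With [r] the largest number
    of rows, [estar r] kills the kets with fewer rows and removes the first column of the others
    injectively, so its value is nonzero with shorter first rows. *)
Lemma stable_vacuum (W : set (fock K)) h v : subspace W ->
  (forall n u, W u -> W (heis n u)) ->
  W v -> fock_charge K h v -> v != 0 -> W (ket K empty_partition h).
Proof.
move=> sW hW.
have supp u : u != 0 -> fock_charge K h u -> exists la, u@_(wedge_of la h) != 0.
  move=> u0 cu; apply: contrapT => hno; case/eqP: u0; apply/malgP => w.
  rewrite mcoeff0; apply/eqP; apply: contrapT => /negP hw.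
  by have [la e] := support_partition cu hw; apply: hno; exists la; rewrite -e.
have [n hn] : exists n, forall la, v@_(wedge_of la h) != 0 -> (nth 0%N la 0 <= n)%N.
  exact: support_bound.
elim: n v hn => [|n IH] v hn Wv cv v0.
  (* All first rows are empty here, so [v] is a multiple of the vacuum. *)
  have [la hla] := supp v v0 cv.
  have e mu : v@_(wedge_of mu h) != 0 -> mu = empty_partition.
    move=> /hn; rewrite leqn0 => /eqP h0; apply: partition_empty.
    by have := partition_nth_gt0 mu 0; rewrite h0; lia.
  suff ev : v = v@_(wedge_of empty_partition h) *: ket K empty_partition h.
    have c0 : v@_(wedge_of empty_partition h) != 0 by rewrite -(e la hla).
    by rewrite -[ket _ _ _]scale1r -(mulVf c0) -scalerA -ev; exact: subspaceZ.
  apply/malgP => w; rewrite mcoeffZ mcoeffU.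
  case: eqP => [<-|ne]; rewrite ?mulr1 ?mulr0 //.
  apply/eqP; apply: contra_notT ne => hw.
  by have [mu emu] := support_partition cv hw; rewrite emu (e mu) // -emu.
have [B hB] := support_bound (fun la : nat_partition => size la) h v.
pose P r := `[< exists2 la, v@_(wedge_of la h) != 0 & size la = r >].
have exP : exists r, P r.
  by have [la hla] := supp v v0 cv; exists (size la); apply/asboolP; exists la.
have bdP r : P r -> (r <= B)%N by move=> /asboolP[la /hB + <-].
have [r /asboolP[la hla er] rmax] := ex_maxnP exP bdP.
have rows mu : v@_(wedge_of mu h) != 0 -> (size mu <= r)%N.
  by move=> hmu; apply: rmax; apply/asboolP; exists mu.
have coef w mu : v@_w * (estar r (wvec K w))@_(wedge_of mu h) != 0 ->
    exists nu, [/\ w = wedge_of nu h, size nu = r & mu = pred_partition nu].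
  have [->|hw] := eqVneq v@_w 0; first by rewrite mul0r eqxx.
  have [nu enu] := support_partition cv hw; rewrite enu in hw *.
  move: (rows nu hw); rewrite leq_eqVlt => /orP[/eqP enr|lt]; last first.
    have -> : estar r (wvec K (wedge_of nu h)) = 0.
      by rewrite -[wvec _ _]/(ket K nu h) -psi_ket_ket estar_ket0.
    by rewrite mcoeff0 mulr0 eqxx.
  rewrite -enr -[wvec _ _]/(ket K nu h) estar_ket_col mcoeffU.
  have [/wedge_of_inj <- _|_] := eqVneq (wedge_of (pred_partition nu) h) (wedge_of mu h).
    by exists nu.
  by rewrite mulr0 eqxx.
apply: (IH (estar r v)).
- move=> mu; rewrite (linear_coef _ _ (@estar_linear K r)) => hs.
  have [w hw] : exists w, v@_w * (estar r (wvec K w))@_(wedge_of mu h) != 0.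
    apply: contrapT => hno; case/eqP: hs; apply: big1 => w _; apply/eqP.
    by apply: contrapT => /negP hw; apply: hno; exists w.
  have [nu [ew _ ->]] := coef w mu hw.
  rewrite nth_pred_partition; have : v@_(wedge_of nu h) != 0.
    by rewrite -ew; apply: contraNneq hw => ->; rewrite mul0r.
  by move=> /hn; lia.
- exact: estar_stable.
- apply: (@estar_stable K (fock_charge K h)) => //; first exact: subspace_fock_charge.
  by move=> k u; exact: heis_fock_charge.
apply/eqP => e0.
(* This coefficient receives a contribution from [la] alone, and it equals the nonzero coefficient
   of [v] there. *)
have : (estar r v)@_(wedge_of (pred_partition la) h) = 0 by rewrite e0 mcoeff0.
rewrite (linear_coef _ _ (@estar_linear K r)).
rewrite (bigD1_seq (wedge_of la h)) ?mcoeff_neq0 ?fset_uniq //=; last by rewrite -mcoeff_neq0.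
rewrite big1 => [|w nw].
  rewrite addr0 -[wvec _ _]/(ket K la h) -er estar_ket_col mcoeffUU mulr1 => /eqP.
  by rewrite (negbTE hla).
apply/eqP; apply: contraNT nw => /coef[nu [-> enu /pred_partition_inj <-]] //.
by rewrite er enu.
Qed.

(** The diagonal matrix with entries [p] counts boxes. It serves to show that [emul n] adds exactly
    [n] boxes. *)
Lemma diag_eig_degree (la : nat_partition) h : diag_eig (fun p => p%:~R : K) (wedge_of la h) =
  diag_eig (fun p => p%:~R : K) (wedge_of empty_partition h) + (sumn la)%:R.
Proof.
rewrite diag_eig_wedge; congr (_ + _); rewrite sumnE (big_nth 0%N) big_mkord natr_sum.
apply: eq_bigr => r _; rewrite -rmorphB /= pmulrn; congr (_%:~R); lia.
Qed.

Local Notation degree := (cc_act (ainf_cl (diag_ainf (fun p => p%:~R : K)))).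

Lemma degree_heis n v : degree (heis n v) = heis n (degree v) - n%:~R *: heis n v.
Proof.
have h p q : ((- n%:~R : K) *: shift_ainf (fun=> 1 : K) n).1 p q
    = ((p%:~R : K) - q%:~R) * (shift_ainf (fun=> 1 : K) n).1 p q.
  rewrite /= -[LHS]/(- n%:~R * _ : K); case: eqP => [->|_]; last by rewrite !mulr0.
  by rewrite rmorphD /= opprD addrA subrr add0r.
have h2 : ((- n%:~R : K) *: shift_ainf (fun=> 1 : K) n).2 = 0 by exact: mulr0.
have e := act_diag_comm v h h2.
rewrite (ainf_actZ (- n%:~R) (shift_ainf (fun=> 1) n) v) scaleNr in e.
by rewrite !heisE -e addrC subrK.
Qed.

Lemma degree_emul n v (e : K) : degree v = e *: v ->
  degree (emul n v) = (e + n%:R) *: emul n v.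
Proof.
elim/ltn_ind: n v e => -[|n] IH v e hv; first by rewrite addr0.
have n0 : (n.+1%:R : K) != 0 by rewrite pnatr_eq0.
apply: (scalerI n0); rewrite scalerA mulrC -scalerA -linearZ /= emulS linear_sum scaler_sumr.
apply: eq_bigr => i _; rewrite linearZ /= scalerA mulrC -scalerA; congr (_ *: _).
rewrite (IH _ _ _ (e + i.+1%:R)); first last.
- by rewrite degree_heis hv heisZ rmorphN scaleNr opprK -scalerDl.
- by rewrite ltnS leq_subr.
by rewrite -addrA -natrD addSn subnKC // -ltnS.
Qed.

(** Double induction: on the number of boxes, then on the number of boxes outside the first column,
    so that partitions with more rows come first. Applied to [la] without its first column, [emul n]
    yields [la] plus kets of equal size with more rows. *)
Lemma stable_kets (W : set (fock K)) h : subspace W ->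
  (forall n u, W u -> W (heis n u)) -> W (ket K empty_partition h) ->
  forall la, W (ket K la h).
Proof.
move=> sW hW W0 la; have [d] := ubnP (sumn la).
elim: d la => // d IHd la; rewrite ltnS => hd.
have [j] := ubnP (sumn la - size la)%N; elim: j la hd => // j IHj la hd hj.
have [/partition_empty-> //|nz] := eqVneq (size la) 0%N.
pose n := size la; pose mu := pred_partition la; pose u := emul n (ket K mu h).
have hmu : sumn la = (sumn mu + n)%N by exact: sumn_pred_partition.
have Wu : W u by apply: emul_stable => //; apply: IHd; lia.
have cu : fock_charge K h u.
  apply: (@emul_stable K (fock_charge K h)); first exact: subspace_fock_charge.
    by move=> k x; exact: heis_fock_charge.
  exact: ket_fock_charge.
(* Transposition expresses the coefficients of [u] through [estar n], whose values on kets are known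
   when there are at most [n] rows. *)
have ucoef w : u@_w = (estar n (wvec K w))@_(wedge_of mu h).
  rewrite -(dot_wvec w u) -(estar_emul_transposes n (wvec K w) (ket K mu h)) dotC.
  exact: dot_wvec.
have udeg nu : u@_(wedge_of nu h) != 0 -> sumn nu = sumn la.
  move=> hnu; pose c := diag_eig (fun p => p%:~R : K) (wedge_of empty_partition h).
  have := @degree_emul n (ket K mu h) (c + (sumn mu)%:R).
  rewrite {1}/ket act_diag_wvec diag_eig_degree => /(_ erefl) => e.
  have := congr1 (mcoeff (wedge_of nu h)) e; rewrite act_diag_coef mcoeffZ => /(mulIf hnu).
  rewrite diag_eig_degree -addrA -natrD -hmu => /addrI/eqP.
  by rewrite eqr_nat => /eqP.
have ula : u@_(wedge_of la h) = 1.
  by rewrite ucoef -[wvec _ _]/(ket K la h) estar_ket_col mcoeffUU.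
have eu : u = \sum_(w <- msupp u) u@_w *: wvec K w.
  rewrite [LHS]monalgE; apply: eq_bigr => w _.
  by apply/malgP => k; rewrite mcoeffZ !mcoeffU mulrnAr mulr1.
have hmem : wedge_of la h \in msupp u by rewrite -mcoeff_neq0 ula oner_eq0.
have : ket K la h = (-1) *: (\sum_(w <- msupp u | w != wedge_of la h) u@_w *: wvec K w) + u.
  rewrite {3}eu (bigD1_seq (wedge_of la h)) ?fset_uniq //= ula scale1r.
  by rewrite scaleN1r addrCA addNr addr0.
move->; apply: sW.2 => //; rewrite big_seq_cond.
elim/big_ind: _ => [|x y Wx Wy|w /andP[hw nw]]; first exact: sW.1.
  by have := sW.2 1 x y Wx Wy; rewrite scale1r.
apply: (subspaceZ _ sW); rewrite -mcoeff_neq0 in hw.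
have [nu enu] := support_partition cu hw; rewrite enu in hw nw *.
have hs := udeg nu hw; apply: IHj; first lia.
suff : (size la < size nu)%N by have := sumn_pred_partition nu; lia.
rewrite ucoef -[wvec _ _]/(ket K nu h) in hw.
(* With exactly [n] rows [nu] would equal [la] by injectivity; with fewer, [estar n] would kill its
   ket. *)
rewrite ltnNge leq_eqVlt; apply/negP => /orP[/eqP e|lt].
  move: hw; rewrite /n -e estar_ket_col mcoeffU.
  have [/wedge_of_inj/pred_partition_inj e'|_] :=
    eqVneq (wedge_of (pred_partition nu) h) (wedge_of mu h); last by rewrite eqxx.
  by rewrite e' ?eqxx in nw.
by move: hw; rewrite -psi_ket_ket estar_ket0 // mcoeff0 eqxx.
Qed.

Lemma fock_charge_irreducible (W : set (fock K)) h : subspace W ->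
  (W `<=` fock_charge K h)%classic -> (forall n u, W u -> W (heis n u)) ->
  W = [set 0]%classic \/ W = fock_charge K h.
Proof.
move=> sW WU hW; have [[v Wv v0]|h0] := pselect (exists2 v, W v & v != 0).
  right; apply/seteqP; split=> // _ [s ->].
  apply: subspace_sum => // p; apply: stable_kets => //.
  exact: (stable_vacuum sW hW Wv (WU _ Wv) v0).
left; apply/seteqP; split=> v /=; last by move->; exact: sW.1.
by move=> Wv; apply/eqP; apply: contrapT => /negP v0; apply: h0; exists v.
Qed.

End Irreducibility.

(** * The degree operator and the representation *)

Section Representation.
Variables (K : numFieldType) (l : nat) (l_gt0 : (0 < l)%N).
Local Notation act x := (cc_act (ainf_cl x)).
Local Notation phi := (@loop_ainf K l l_gt0).

Definition vacuum_energy (h : int) : K :=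
  diag_eig (fun p => (p %/ l%:Z)%Z%:~R) (wedge_of empty_partition h).

(** The sign turns [quo_diag] into the derivation [t d/dt] by [act_quo_diag]; the first term makes
    every vacuum have eigenvalue zero. *)
Definition d_op (v : fock K) : fock K :=
  charge_scalar vacuum_energy v - act (quo_diag K l) v.

Lemma d_op_linear : linear d_op.
Proof.
move=> a u v; rewrite /d_op [X in X - _]linearP [X in _ - X]linearP /= opprD scalerBr.
exact: addrACA.
Qed.

Lemma d_op_act (x : glhat' K l) v :
  d_op (act (phi x) v) - act (phi x) (d_op v) = act (phi (loop_deriv x.1, 0)) v.
Proof.
rewrite -act_quo_diag /d_op charge_scalar_act linearB /= opprB.
by rewrite addrC addrA subrK.
Qed.

Lemma d_op_ket la h : d_op (ket K la h) = - (num_c0 l h la)%:R *: ket K la h.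
Proof.
rewrite /d_op (charge_scalarE _ (ket_fock_charge _ la h)) act_diag_wvec -scalerBl.
by rewrite diag_eig_wedge -num_c0E // opprD addrA subrr add0r.
Qed.

Definition glhat_act (x : glhat K l) (v : fock K) : fock K :=
  act (phi x.1) v + (x.2 : K) *: d_op v.

Lemma glhat_act_d v : glhat_act (glhat_d K l) v = d_op v.
Proof.
have e : phi (glhat_d K l).1 = 0 by apply: ainf_eqP => // p q; rewrite /= mxE.
by rewrite /glhat_act e ainf_act0 add0r; exact: scale1r.
Qed.

Lemma glhat_act_linear (x : glhat K l) : linear (glhat_act x).
Proof.
move=> a u v; rewrite /glhat_act linearP d_op_linear /= !scalerDr !scalerA mulrC.
by rewrite addrACA.
Qed.

Lemma glhat_act_linearl v : linear (glhat_act^~ v).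
Proof.
move=> a x y; rewrite /glhat_act loop_ainf_linear ainf_actP /= scalerDl.
rewrite [a *: (_ + _)]scalerDr scalerA.
exact: addrACA.
Qed.

Lemma phi_act_bracket (x y : glhat' K l) v :
  act (phi (glhat'_bracket x y)) v =
  act (phi x) (act (phi y) v) - act (phi y) (act (phi x) v).
Proof. by rewrite phi_bracket ainf_act_bracket. Qed.

Lemma glhat_act_bracket (x y : glhat K l) v :
  glhat_act (glhat_bracket x y) v =
  glhat_act x (glhat_act y v) - glhat_act y (glhat_act x v).
Proof.
case: x y => [x a] [y b]; rewrite /glhat_act /glhat_bracket /= scale0r addr0.
set z := (_, 0); have -> : phi (glhat'_bracket x y + z) =
    (a : K) *: phi (loop_deriv y.1, 0) +
    ((- b : K) *: phi (loop_deriv x.1, 0) + phi (glhat'_bracket x y)).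
  rewrite -!loop_ainf_linear; congr loop_ainf; rewrite addrA addrC; congr (_ + _).
  rewrite /z; congr pair; last by rewrite /= !scaler0 addr0.
  by rewrite scaleNr.
have act3 (c d : K) (p q r : ainf K) :
    act (c *: p + (d *: q + r)) v = c *: act p v + (d *: act q v + act r v).
  exact: (etrans (ainf_actP c p _ v) (congr1 (fun u => c *: act p v + u) (ainf_actP d q r v))).
rewrite act3 phi_act_bracket -(d_op_act x) -(d_op_act y).
have lin (w : glhat' K l) (c : K) u1 u2 :
    act (phi w) (u1 + c *: u2) = act (phi w) u1 + c *: act (phi w) u2.
  by rewrite linearD linearZ.
have dlin (c : K) u1 u2 : d_op (u1 + c *: u2) = d_op u1 + c *: d_op u2.
  by rewrite addrC d_op_linear addrC.
(* Coefficient by coefficient this is an identity of scalars; the two terms with [d_op] applied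
   twice cancel. *)
rewrite !lin !dlin; apply/malgP => w.
rewrite !(mcoeffD, mcoeffB, mcoeffN, mcoeffZ); ring.
Qed.

Lemma glhat_lie_rep : lie_rep (@glhat_bracket K l) glhat_act.
Proof.
split; [exact: glhat_act_linear|exact: glhat_act_linearl|exact: glhat_act_bracket].
Qed.

Lemma glhat_act_fock_charge h : invariant_under glhat_act (fock_charge K h).
Proof.
move=> x v hv; have [_ WP] := subspace_fock_charge K h.
rewrite /glhat_act addrC; apply: (WP); last exact: act_fock_charge.
rewrite /d_op -scaleN1r addrC; apply: (WP); first exact: act_fock_charge.
by rewrite (charge_scalarE _ hv); apply: subspaceZ => //; exact: subspace_fock_charge.
Qed.

(** Every [heis n] is the action of a loop with zero [c] and [d] parts, so a submodule is stable
    under the Heisenberg operators. *)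
Lemma glhat_act_irreducible h : irreducible_on glhat_act (fock_charge K h).
Proof.
split; first by exists (ket K empty_partition h); [exact: ket_fock_charge|exact: wvec_neq0].
move=> W sW WU hW; apply: fock_charge_irreducible => // n u Wu.
have := hW ((loop_shift K l_gt0 n, 0), 0) u Wu.
by rewrite /glhat_act phi_shift scale0r addr0.
Qed.

End Representation.

Theorem proposition3p37 (R : realType) (l : nat) (hl : (2 <= l)%N) :
  exists phi : glhat' R[i] l -> ainf R[i],
    let act (x : glhat' R[i] l) (v : fock R[i]) : fock R[i] :=
      cc_act (ainf_cl (phi x)) v in
    [/\ [/\ lie_embedding (@glhat'_bracket R[i] l) (@ainf_bracket R[i]) phi,
            phi (glhat'_c R[i] l) = ainf_c R[i] &
            forall (i j : 'I_l) (m : int),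
              phi (loop_mono (delta_mx i j) m, 0) = ainf_shift R[i] i j m],
        lie_embedding (@glhat'_bracket R[i] l) (@commutator R[i] (cclifford R[i]))
          (fun x => ainf_cl (phi x))
        /\ ainf_cl (phi (glhat'_c R[i] l)) = 1,
        lie_rep (@glhat'_bracket R[i] l) act
        /\ (forall (x : slhat' R[i] l) (v : fock R[i]), act x v = slhat'_act x v) &
        exists rho : glhat R[i] l -> fock R[i] -> fock R[i],
          [/\ lie_rep (@glhat_bracket R[i] l) rho,
              forall (x : glhat' R[i] l) (v : fock R[i]), rho (x, 0) v = act x v,
              forall (la : nat_partition) (h : int),
                rho (glhat_d R[i] l) (ket R[i] la h)
                  = - (num_c0 l h la)%:R *: ket R[i] la h &
              forall h : int,
                invariant_under rho (fock_charge R[i] h)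
                /\ irreducible_on rho (fock_charge R[i] h)]].
Proof.
have l_gt0 : (0 < l)%N by exact: ltnW.
exists (@loop_ainf R[i] l l_gt0) => act; split.
- split; [split|exact: phi_c|exact: phi_mono].
  + exact: loop_ainf_linear.
  + exact: loop_ainf_inj.
  + exact: phi_bracket.
- split; last by rewrite phi_c ainf_cl_c.
  split=> [a x y|x y /ainf_cl_inj/loop_ainf_inj //|x y].
    by rewrite loop_ainf_linear ainf_cl_linear.
  by rewrite phi_bracket ainf_cl_bracket.
- split; last exact: phi_slhat.
  split=> [x|v a x y|x y v].
  + exact: cc_actP.
  + by rewrite /act loop_ainf_linear ainf_actP.
  + exact: phi_act_bracket.
exists (glhat_act l_gt0); split.
- exact: glhat_lie_rep.
- by move=> x v; rewrite /glhat_act scale0r addr0.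
- by move=> la h; rewrite glhat_act_d; exact: d_op_ket.
- by move=> h; split; [exact: glhat_act_fock_charge|exact: glhat_act_irreducible].
Qed.
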